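(* Let $\Omega\subset\mathbb{S}^2$ be a simply connected domain whose boundary has more than two points, and let $\rho=\rho_\Omega$. At the points $R_\rho(\theta)$ with $|\mathcal{S}_\Omega(\theta)|\neq\mu_\Omega(\theta)$, the principal curvatures of the $(-1)$-Weingarten surface $\Sigma(\rho)$ are $$k_\pm=\frac{1}{1\pm\left|\frac{\mu_\Omega}{\mathcal{S}_\Omega}\right|}=\frac{\frac{|\mathcal{S}_\Omega|}{\mu_\Omega}}{\frac{|\mathcal{S}_\Omega|}{\mu_\Omega}\pm1},$$ where the last expression is used when $\mathcal{S}_\Omega=0$.
   Context: Hyperbolic 3-space $\mathbb{H}^3$ is the open unit ball in $\mathbb{R}^3$ with metric $4|dx|^2/(1-|x|^2)^2$; its ideal boundary is the unit sphere $\mathbb{S}^2$, with round metric $d\sigma^2$. For a function $\rho$ on a domain $\Omega\subset\mathbb{S}^2$, define $R_\rho:\Omega\to\mathbb{H}^3$ by $$R_\rho(\theta)=\frac{|D\rho|^2+(e^{2\rho}-1)}{|D\rho|^2+(e^{\rho}+1)^2}\,\theta+\frac{2D\rho}{|D\rho|^2+(e^\rho+1)^2},$$ where $D\rho$ is the gradient of $\rho$ with respect to $d\sigma^2$, regarded as a vector in $\mathbb{R}^3$ tangent to $\mathbb{S}^2$ at $\theta$. $\Sigma(\rho)$ is the surface parametrized by $R_\rho$ (the outer envelope of the horospheres $H(\theta,\rho(\theta))$ based at $\theta$ with signed distance $\rho(\theta)$ from the origin). Its unit normal $N$ at $R_\rho(\theta)$ is the unit normal to $H(\theta,\rho(\theta))$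 pointing into the horoball, i.e. the geodesic with initial velocity $N$ converges to $\theta$. Principal curvatures are the eigenvalues of $\Pi^i_j=g^{ik}\Pi_{kj}$ where $g_{ij}=\langle X_i,X_j\rangle$, $\Pi_{ij}=\langle\nabla_{X_j}X_i,N\rangle$ for the coordinate tangent fields $X_i$ and $\nabla$ the Levi-Civita connection of $\mathbb{H}^3$. Let $f_\Omega:\Omega\to D_1$ be a conformal bijection onto the unit disk of $\mathbb{C}$. In a local (stereographic) conformal parameter $z$ on $\Omega$ with $d\sigma^2=\gamma^2|dz|^2$, put $\mu_\Omega=4|f_\Omega'|^2(1-|f_\Omega|^2)^{-2}$, $\rho_\Omega=\log\big(2|f_\Omega'|\gamma^{-1}(1-|f_\Omega|^2)^{-1}\big)$ (so $e^{2\rho_\Omega}d\sigma^2=\mu_\Omega|dz|^2$ is the hyperbolic metric of $\Omega$), and $\mathcal{S}_\Omega=\big(\tfrac{f_\Omega''}{f_\Omega'}\big)'-\tfrac12\big(\tfrac{f_\Omega''}{f_\Omega'}\big)^2$. The ratio $|\mathcal{S}_\Omega|/\mu_\Omega$ does not depend on the choice of the stereographic parameter. A $(-1)$-Weingarten surface is one with $k_1k_2-1=-(1-k_1)(1-k_2)$ at its smooth points. *)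

(* Defs.v *)
From HB Require Import structures.
From mathcomp Require Import all_boot all_order all_algebra.
From mathcomp Require Import complex.
From mathcomp Require Import all_classical all_reals all_analysis.

Set Implicit Arguments.
Unset Strict Implicit.
Unset Printing Implicit Defensive.

Import Order.TTheory GRing.Theory Num.Theory.
Import numFieldNormedType.Exports.

Local Open Scope classical_set_scope.
Local Open Scope ring_scope.
Local Open Scope complex_scope.

Section Euclidean.
Context {R : realType}.

Definition dot n (x y : 'rV[R]_n) : R := \sum_i x 0 i * y 0 i.

(* The library norm [`|x|] on row vectors is the sup norm, hence this one. *)
Definition enorm n (x : 'rV[R]_n) : R := Num.sqrt (dot x x).

Definition evec n (i : 'I_n) : 'rV[R]_n := delta_mx 0 i.

End Euclidean.

Section Surfaces.
Context {R : realType}.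

(* A Riemannian metric on (an open part of) R^n is given by its Gram matrices
   in the coordinate frame. *)
Definition metric_dot n (g : 'rV[R]_n -> 'M[R]_n) (x v w : 'rV[R]_n) : R :=
  (v *m g x *m w^T) 0 0.

(* Gamma^k_ij of the Levi-Civita connection of g. *)
Definition christoffel n (g : 'rV[R]_n -> 'M[R]_n) (x : 'rV[R]_n)
    (i j k : 'I_n) : R :=
  2^-1 * \sum_l invmx (g x) k l *
    ('D_(evec i) (fun y => g y j l) x + 'D_(evec j) (fun y => g y i l) x
     - 'D_(evec l) (fun y => g y i j) x).

Variables (n m : nat) (g : 'rV[R]_n -> 'M[R]_n) (Y : 'rV[R]_m -> 'rV[R]_n).

Definition tangent_field (i : 'I_m) (p : 'rV[R]_m) : 'rV[R]_n :=
  'D_(evec i) Y p.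

(* nabla_{X_j} X_i, for the tangent fields X_i of the parametrization Y. *)
Definition cov_deriv_tangent (i j : 'I_m) (p : 'rV[R]_m) : 'rV[R]_n :=
  'D_(evec j) (tangent_field i) p +
  \row_k \sum_a \sum_b
    christoffel g (Y p) a b k * tangent_field j p 0 a * tangent_field i p 0 b.

Definition first_form (p : 'rV[R]_m) : 'M[R]_m :=
  \matrix_(i, j) metric_dot g (Y p) (tangent_field i p) (tangent_field j p).

Definition second_form (N : 'rV[R]_n) (p : 'rV[R]_m) : 'M[R]_m :=
  \matrix_(i, j) metric_dot g (Y p) (cov_deriv_tangent i j p) N.

(* The derivatives used above exist (the operator 'D is total) and Y is an
   immersion at p. *)
Definition regular_point (p : 'rV[R]_m) : Prop :=
  [/\ \forall q \near p, forall i, derivable Y q (evec i),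
      forall i j, derivable (tangent_field i) p (evec j)
    & first_form p \in unitmx].

End Surfaces.

(* A real 2 x 2 matrix whose set of eigenvalues is {k1, k2}, with k1 = k2
   allowed, has k1, k2 as its eigenvalues counted with multiplicity. *)
Definition principal_curvatures {R : realType} n (g : 'rV[R]_n -> 'M[R]_n)
    (Y : 'rV[R]_2 -> 'rV[R]_n) (N : 'rV[R]_n) (p : 'rV[R]_2) (k1 k2 : R) :
    Prop :=
  regular_point g Y p /\
  forall k, eigenvalue (invmx (first_form g Y p) *m second_form g Y N p) k
            <-> k = k1 \/ k = k2.

Section Sphere.
Context {R : realType}.

Definition sphere : set 'rV[R]_3 := [set x | dot x x = 1].

Definition sphere_domain (Om : set 'rV[R]_3) : Prop :=
  [/\ exists2 U : set 'rV[R]_3, open U & Om = U `&` sphere,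
      connected Om & Om !=set0].

Definition sphere_boundary (Om : set 'rV[R]_3) : set 'rV[R]_3 :=
  closure Om `&` closure (sphere `\` Om).

Definition unit_interval : set R := `[0, 1].

Definition simply_connected (Om : set 'rV[R]_3) : Prop :=
  connected Om /\
  forall c : R -> 'rV[R]_3,
    {within unit_interval, continuous c} ->
    (forall t, unit_interval t -> Om (c t)) -> c 0 = c 1 ->
    exists H : R * R -> 'rV[R]_3,
      [/\ {within unit_interval `*` unit_interval, continuous H},
          forall s t, unit_interval s -> unit_interval t -> Om (H (s, t)),
          forall t, unit_interval t -> H (0, t) = c t,
          forall t, unit_interval t -> H (1, t) = c 0
        & forall s, unit_interval s -> H (s, 0) = c 0 /\ H (s, 1) = c 0].

(* The rows e0, e1, e2 of E are a positive orthonormal basis of R^3. The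
   stereographic parameter attached to E is the projection from the pole e2,
   so that the pole is arbitrary and the parameters for different E differ by
   rotations of the sphere. *)
Definition oriented_frame (E : 'M[R]_3) : Prop :=
  E *m E^T = 1%:M /\ \det E = 1.

Definition pole (E : 'M[R]_3) : 'rV[R]_3 := row 2 E.

Definition stereo (E : 'M[R]_3) (x : 'rV[R]_3) : R[i] :=
  (dot x (row 0 E) / (1 - dot x (pole E)))
  +i* (dot x (row 1 E) / (1 - dot x (pole E))).

Definition cabs (z : R[i]) : R := complex.Re `|z|.

Definition stereo_inv (E : 'M[R]_3) (z : R[i]) : 'rV[R]_3 :=
  (1 + cabs z ^+ 2)^-1 *:
    ((2 * complex.Re z) *: row 0 E + (2 * complex.Im z) *: row 1 E
     + (cabs z ^+ 2 - 1) *: pole E).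

(* d sigma^2 = gamma^2 |dz|^2 for every stereographic parameter. *)
Definition gamma (z : R[i]) : R := 2 / (1 + cabs z ^+ 2).

(* x |-> rho (x / |x|) is constant along rays, so its gradient in R^3 at a
   point of the sphere is the gradient of rho with respect to d sigma^2. *)
Definition sphere_grad (rho : 'rV[R]_3 -> R) (th : 'rV[R]_3) : 'rV[R]_3 :=
  \row_i 'D_(evec i) (fun x => rho ((enorm x)^-1 *: x)) th.

(* Gram matrices of 4 |dx|^2 / (1 - |x|^2)^2. *)
Definition hyp_metric (x : 'rV[R]_3) : 'M[R]_3 :=
  (4 / (1 - dot x x) ^+ 2)%:M.

Definition horo_map (rho : 'rV[R]_3 -> R) (th : 'rV[R]_3) : 'rV[R]_3 :=
  let D := sphere_grad rho th in
  let q := dot D D + (expR (rho th) + 1) ^+ 2 in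
  ((dot D D + (expR (2 * rho th) - 1)) / q) *: th + (2 / q) *: D.

(* H(th, r) is the Euclidean sphere tangent to the unit sphere at th and
   through tanh(r/2) th = ((e^r - 1)/(e^r + 1)) th, the point of the diameter
   of th at signed distance r from the origin; its centre is the midpoint. *)
Definition horo_centre (th : 'rV[R]_3) (r : R) : 'rV[R]_3 :=
  (2^-1 * (1 + (expR r - 1) / (expR r + 1))) *: th.

(* Normal at x in H(th, r) towards the centre of that Euclidean sphere, i.e.
   into the horoball, with hyperbolic length 1. Hyperbolic and Euclidean
   orthogonality agree since the metric is conformal. *)
Definition horo_normal (th : 'rV[R]_3) (r : R) (x : 'rV[R]_3) : 'rV[R]_3 :=
  let v := horo_centre th r - x in
  ((1 - dot x x) / 2 / enorm v) *: v.

(* Coordinates (Re z, Im z) of a stereographic parameter z. *)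
Definition coords (z : R[i]) : 'rV[R]_2 :=
  \row_i (if i == 0 then complex.Re z else complex.Im z).

Definition of_coords (p : 'rV[R]_2) : R[i] := p 0 0 +i* p 0 1.

End Sphere.

Section FieldDerivative.
Variable K : numFieldType.
Implicit Types (F : K -> K) (z : K).

(* K-differentiability; for K = R[i] this is complex differentiability. *)
Definition fderivable F z : Prop := derivable F z 1.

Definition fderiv F z : K := derive1 F z.

Definition schwarzian F z : K :=
  let q w := fderiv (fderiv F) w / fderiv F w in
  fderiv q z - 2^-1 * q z ^+ 2.

End FieldDerivative.

Section Conformal.
Context {R : realType}.

Definition unit_disk : set R[i] := [set z | cabs z < 1].

Definition in_stereo (E : 'M[R]_3) (f : 'rV[R]_3 -> R[i]) (z : R[i]) : R[i] :=
  f (stereo_inv E z).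

(* Conformal = holomorphic in the (conformal) stereographic parameters, with
   non-vanishing derivative. *)
Definition conformal_on (Om : set 'rV[R]_3) (f : 'rV[R]_3 -> R[i]) : Prop :=
  forall (E : 'M[R]_3) (th : 'rV[R]_3), oriented_frame E -> Om th ->
    th <> pole E ->
    fderivable (in_stereo E f) (stereo E th) /\
    fderiv (in_stereo E f) (stereo E th) <> 0.

Definition conformal_bijection_disk (Om : set 'rV[R]_3)
    (f : 'rV[R]_3 -> R[i]) : Prop :=
  conformal_on Om f /\ set_bij Om unit_disk f.

(* [schwarzian_at], [mu_at] and [rho_at] are S_Omega, mu_Omega and rho_Omega,
   computed at th in the stereographic parameter of the frame E
   (th <> pole E). The value of rho_at does not depend on E. *)
Definition schwarzian_at (E : 'M[R]_3) (f : 'rV[R]_3 -> R[i])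
    (th : 'rV[R]_3) : R[i] :=
  schwarzian (in_stereo E f) (stereo E th).

Definition mu_at (E : 'M[R]_3) (f : 'rV[R]_3 -> R[i]) (th : 'rV[R]_3) : R :=
  4 * cabs (fderiv (in_stereo E f) (stereo E th)) ^+ 2
  / (1 - cabs (f th) ^+ 2) ^+ 2.

Definition rho_at (E : 'M[R]_3) (f : 'rV[R]_3 -> R[i]) (th : 'rV[R]_3) : R :=
  ln (2 * cabs (fderiv (in_stereo E f) (stereo E th))
      / gamma (stereo E th) / (1 - cabs (f th) ^+ 2)).

End Conformal.

(* The surface Sigma(rho) in the coordinates (Re z, Im z) of the frame E. *)
Definition horo_surface {R : realType} (E : 'M[R]_3) (rho : 'rV[R]_3 -> R)
    (p : 'rV[R]_2) : 'rV[R]_3 :=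
  horo_map rho (stereo_inv E (of_coords p)).

Definition horo_curvatures {R : realType} (E : 'M[R]_3)
    (rho : 'rV[R]_3 -> R) (th : 'rV[R]_3) (k1 k2 : R) : Prop :=
  principal_curvatures hyp_metric (horo_surface E rho)
    (horo_normal th (rho th) (horo_map rho th)) (coords (stereo E th)) k1 k2.

(* Main.v *)
From HB Require Import structures.
Require Import Defs.
From mathcomp Require Import all_boot all_order all_algebra.
From mathcomp Require Import complex.
From mathcomp Require Import all_classical all_reals all_analysis.
From mathcomp Require Import ring lra.

Set Implicit Arguments.
Unset Strict Implicit.
Unset Printing Implicit Defensive.

Import Order.TTheory GRing.Theory Num.Theory.
Import numFieldNormedType.Exports.

Local Open Scope classical_set_scope.
Local Open Scope ring_scope.
Local Open Scope complex_scope.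

(** In the hyperboloid model the horosphere H(th, rho) is the set of X with
    <X, psi> = -1, where psi = e^rho (1, th) is a point of the light cone. The
    envelope X, together with its unit normal N, therefore satisfies
    X + N = psi, <X, psi> = -1 and <X, d psi> = 0.
    In a stereographic parameter z write e^(2 rho) d sigma^2 = lam^2 |dz|^2, so
    that lam^2 = mu and psi = lam n with
    n = ((1 + |z|^2) / 2, z, (|z|^2 - 1) / 2). The vectors d_i psi are tangent
    to the surface, orthogonal with common length lam, and
      d_i X = sum_j (1 + sig)_ij d_j psi
    with sig symmetric. Hence, with N = psi - X,
      g = mu (1 + sig)^2,   Pi = mu (1 + sig) sig,
    and the shape operator is (1 + sig)^-1 sig.

    The function u = log lam satisfies u_(z zbar) = lam^2 / 4 (curvature -1) and
    u_zz - u_z^2 = S / 2 because lam = 2 |f'| / (1 - |f|^2). The first equation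
    makes sig trace free, the second gives its entries Re S / mu, - Im S / mu,
    - Re S / mu. Its eigenvalues are therefore s and - s with s = |S| / mu, and
    those of the shape operator are s / (1 + s) and - s / (1 - s).

    The two equations on u say that (lam, u_x, u_y) solves a first order system
    that is closed once S is known ([density_grad], [log_density_x_grad],
    [log_density_y_grad]). In the ball the surface is a quotient of explicit
    polynomials in x, y, lam, u_x, u_y ([horo_map_rho]), so that its tangent
    fields follow from the system by the chain rule ([epstein_coord_grad]). Its
    second derivatives enter the second form only through their component along
    the normal, which is obtained by differentiating the orthogonality of the
    tangent fields and the normal ([epstein_second_derivative]).

    For these derivatives to exist f must have four derivatives, whereas a
    conformal map is only given with one. This is where complex analysis enters:
    Goursat's theorem on rectangles ([goursat]) gives Cauchy's formula in the
    form f(w) W(w) = G(w), where W and G are the integrals of 1 / (z - w) and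
    f(z) / (z - w) over the boundary of a square; both may be differentiated in
    w under the integral, so that f' is differentiable again
    ([holomorphic_derivative]), and this can be repeated. *)

(** * Limits and derivatives in a numeric field *)

Section NumField.
Variable K : numFieldType.
Implicit Types (f : K -> K) (z : K).

Lemma near_normP z (P : K -> Prop) :
  (\forall w \near z, P w) <->
  exists2 e : K, 0 < e & forall w, `|z - w| < e -> P w.
Proof. exact: nbhs_normP. Qed.

Lemma continuous_normP f z : {for z, continuous f} <->
  forall e : K, 0 < e -> \forall w \near z, `|f z - f w| < e.
Proof.
exact: (@pseudometric_normed_Zmodule.cvgrPdist_lt _ K K (nbhs z) _ f (f z)).
Qed.

Lemma derive1_normP f z l :
  (derivable f z 1 /\ derive1 f z = l) <->
  forall e : K, 0 < e -> \forall h \near (0 : K), h != 0 ->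
     `|l - h^-1 * (f (z + h) - f z)| < e.
Proof.
set q := fun h : K => h^-1 *: ((f \o shift z) (h *: 1) - f z).
have qE h : q h = h^-1 * (f (z + h) - f z).
  rewrite /q /=; have -> : h *: (1 : K) = h * 1 by [].
  by rewrite mulr1 (addrC h).
have lim_q : (q @ 0^' --> l) <-> forall e : K, 0 < e ->
    \forall h \near (0 : K), h != 0 -> `|l - h^-1 * (f (z + h) - f z)| < e.
  split=> [/(proj1 (@pseudometric_normed_Zmodule.cvgrPdist_lt _ K K _ _ q l)) H e e0|H].
    have := H e e0; rewrite near_withinE.
    by apply: filterS => h /[apply]; rewrite qE.
  apply/(@pseudometric_normed_Zmodule.cvgrPdist_lt _ K K _ _ q l) => e e0.
  rewrite near_withinE; have := H e e0.
  by apply: filterS => h /[apply]; rewrite qE.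
rewrite -lim_q derive1E; split=> [[/cvg_ex[/= l' ll'] <-]|ql].
  have -> // : 'D_1 f z = l' by exact: (cvg_lim (@norm_hausdorff _ _) ll').
by split; [apply/cvg_ex; exists l|exact: (cvg_lim (@norm_hausdorff _ _) ql)].
Qed.

End NumField.

Section DerivableNumField.
Variable K : numFieldType.
Implicit Types (f g : K -> K) (z w : K).

Lemma derivable_inv_sub_exp w z n : z != w -> derivable (fun z => ((z - w)^-1) ^+ n) z 1.
Proof.
move=> zw; elim: n => [|n IH].
  have -> : (fun z => ((z - w)^-1) ^+ 0) = cst 1 by apply/funext => y; rewrite expr0.
  exact: derivable_cst.
have -> : (fun z => ((z - w)^-1) ^+ n.+1) =
    (fun z => (z - w)^-1) * (fun z => ((z - w)^-1) ^+ n).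
  by apply/funext => y; rewrite exprS.
apply: derivableM => //; apply: derivableV; first by rewrite subr_eq0.
by apply: derivableB; [exact: derivable_id|exact: derivable_cst].
Qed.

Lemma derivable_inv_sub w z : z != w -> derivable (fun z => (z - w)^-1) z 1.
Proof. exact: (@derivable_inv_sub_exp w z 1). Qed.

Lemma derivable_divided_difference f w z : z != w -> derivable f z 1 ->
  derivable (fun z => (f z - f w) * (z - w)^-1) z 1.
Proof.
move=> zw df; apply: derivableM; last exact: derivable_inv_sub.
by apply: derivableB => //; exact: derivable_cst.
Qed.

Lemma derivable_continuous f z : derivable f z 1 -> {for z, continuous f}.
Proof. by move=> /derivable1_diffP /differentiable_continuous. Qed.

Lemma continuous_affine (p q : K) z : {for z, continuous (fun w => p + q * w)}.
Proof.
apply: continuousD; first exact: cst_continuous.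
by apply: continuousM; [exact: cst_continuous|exact: cvg_id].
Qed.

Lemma continuous_combination (l : K) f g z : {for z, continuous f} ->
  {for z, continuous g} -> {for z, continuous (fun w => l * f w + g w)}.
Proof.
move=> cf cg; apply: continuousD => //.
by apply: continuousM => //; exact: cst_continuous.
Qed.

Lemma continuous_mul f g z : {for z, continuous f} ->
  {for z, continuous g} -> {for z, continuous (fun w => f w * g w)}.
Proof. exact: continuousM. Qed.

Lemma eq_near_derivable f g z : (\forall w \near z, f w = g w) ->
  derivable g z 1 -> derivable f z 1.
Proof. by move=> fg; apply: near_eq_derivable; apply: filterS fg => w ->. Qed.

Lemma eq_near_derive1 f g z : (\forall w \near z, f w = g w) ->
  derive1 f z = derive1 g z.
Proof. by move=> fg; rewrite !derive1E; exact: near_eq_derive. Qed.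

(** Solving a product rule for one factor: with f g = h it expresses f' through
    functions that are known to be differentiable, which is how f' inherits
    regularity from a Cauchy integral. *)
Lemma derivative_mul_eq f g h z : (\forall w \near z, f w * g w = h w) ->
  derivable f z 1 -> derivable g z 1 -> g z != 0 ->
  derive1 f z = (derive1 h z - f z * derive1 g z) * (g z)^-1.
Proof.
move=> fg df dg g0.
have -> : derive1 h z = derive1 (fun w => f w * g w) z.
  by apply/esym/eq_near_derive1.
rewrite !derive1E (deriveM df dg) /GRing.scale/= (mulrC (g z)) addrC addKr mulfK//.
Qed.

Lemma derivable_quotient (f g h : K -> K) (k : K -> K) z :
  derivable f z 1 -> derivable g z 1 -> derivable h z 1 -> derivable k z 1 ->
  k z != 0 -> derivable (fun w => (f w - g w * h w) * (k w)^-1) z 1.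
Proof.
move=> df dg dh dk k0; apply: derivableM; last exact: derivableV.
exact: (derivableB df (derivableM dg dh)).
Qed.

End DerivableNumField.

(** * Moduli and limits in the complex plane *)

Section ComplexModulus.
Context {R : realType}.
Implicit Types z w : R[i].

Lemma eq_ReIm z w : complex.Re z = complex.Re w -> complex.Im z = complex.Im w -> z = w.
Proof. by case: z => a b; case: w => c d /= -> ->. Qed.

Lemma Im_addc z w : complex.Im (z + w) = complex.Im z + complex.Im w.
Proof. by case: z; case: w. Qed.

Lemma Re_subc z w : complex.Re (z - w) = complex.Re z - complex.Re w.
Proof. by case: z; case: w. Qed.

Lemma Im_subc z w : complex.Im (z - w) = complex.Im z - complex.Im w.
Proof. by case: z; case: w. Qed.

Lemma Re_mulc z w : complex.Re (z * w) =
  complex.Re z * complex.Re w - complex.Im z * complex.Im w.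
Proof. by case: z; case: w. Qed.

Lemma Im_mulc z w : complex.Im (z * w) =
  complex.Re z * complex.Im w + complex.Im z * complex.Re w.
Proof. by case: z; case: w. Qed.

Lemma cabsE z : cabs z = Num.sqrt (complex.Re z ^+ 2 + complex.Im z ^+ 2).
Proof. by rewrite /cabs normc_def. Qed.

Lemma normC_cabs z : `|z| = (cabs z)%:C.
Proof. by rewrite /cabs normc_def. Qed.

Lemma cabs_ge0 z : 0 <= cabs z.
Proof. by rewrite cabsE sqrtr_ge0. Qed.

Lemma cabs_sqr z : cabs z ^+ 2 = complex.Re z ^+ 2 + complex.Im z ^+ 2.
Proof. by rewrite cabsE sqr_sqrtr// addr_ge0 ?sqr_ge0. Qed.

Lemma cabsM z w : cabs (z * w) = cabs z * cabs w.
Proof. by apply: complexI; rewrite -normC_cabs normrM !normC_cabs rmorphM. Qed.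

Lemma cabsV z : cabs z^-1 = (cabs z)^-1.
Proof. by apply: complexI; rewrite -normC_cabs normfV !normC_cabs fmorphV. Qed.

Lemma cabsN z : cabs (- z) = cabs z.
Proof. by apply: complexI; rewrite -!normC_cabs normrN. Qed.

Lemma cabsB z w : cabs (z - w) = cabs (w - z).
Proof. by rewrite -cabsN opprB. Qed.

Lemma cabs_eq0 z : (cabs z == 0) = (z == 0).
Proof. by rewrite -[RHS]normr_eq0 normC_cabs -[LHS](inj_eq (@complexI R)). Qed.

Lemma cabs_gt0 z : (0 < cabs z) = (z != 0).
Proof. by rewrite lt_neqAle cabs_ge0 eq_sym cabs_eq0 andbT. Qed.

Lemma cabs0 : cabs (0 : R[i]) = 0.
Proof. by apply/eqP; rewrite cabs_eq0. Qed.

Lemma ler_cabsD z w : cabs (z + w) <= cabs z + cabs w.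
Proof. by rewrite -lecR rmorphD/= -!normC_cabs ler_normD. Qed.

Lemma ler_cabsB z w : cabs (z - w) <= cabs z + cabs w.
Proof. by rewrite -(cabsN w) ler_cabsD. Qed.

Lemma ler_dist_cabs z w : cabs z - cabs w <= cabs (z - w).
Proof. by rewrite lerBlDr (le_trans _ (ler_cabsD _ _))// subrK. Qed.

Lemma cabs_real (x : R) : cabs x%:C = `|x|.
Proof. by rewrite cabsE/= expr0n addr0 sqrtr_sqr. Qed.

Lemma cabs_i : cabs ('i : R[i]) = 1.
Proof. by rewrite cabsE/= expr0n add0r expr1n sqrtr1. Qed.

Lemma ler_Re_cabs z : `|complex.Re z| <= cabs z.
Proof. by rewrite cabsE -sqrtr_sqr ler_wsqrtr// lerDl sqr_ge0. Qed.

Lemma ler_Im_cabs z : `|complex.Im z| <= cabs z.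
Proof. by rewrite cabsE -sqrtr_sqr ler_wsqrtr// lerDr sqr_ge0. Qed.

Lemma ler_cabs_ReIm z : cabs z <= `|complex.Re z| + `|complex.Im z|.
Proof.
rewrite -ler_sqr ?nnegrE ?cabs_ge0 ?addr_ge0// cabs_sqr sqrrD !real_normK ?num_real//.
have := mulr_ge0 (normr_ge0 (complex.Re z)) (normr_ge0 (complex.Im z)).
by rewrite -mulr_natr; lra.
Qed.

(* Topology and derivatives are attached to the numeric field structure of
   the complex numbers; [C] is its carrier. *)
Local Notation C := (Num.NumField.sort (complex_complex__canonical__Num_NumField R)).

(** The norm of R[i] takes values in R[i]; this and the next two lemmas restate
    neighbourhoods, continuity and derivatives with real radii. *)
Lemma near_complexP (z0 : C) (P : C -> Prop) :
  (\forall z \near z0, P z) <->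
  exists2 r : R, 0 < r & forall z, cabs (z - z0) < r -> P z.
Proof.
rewrite near_normP; split=> [[e e0 He]|[r r0 Hr]].
  exists (complex.Re e); first by move: e0; rewrite ltcE => /andP[].
  move=> z zz0; apply: He; move: e0.
  by rewrite distrC normC_cabs !ltcE/= => /andP[/eqP -> _]; rewrite eqxx.
exists (r%:C); first by rewrite ltcR.
by move=> z; rewrite distrC normC_cabs ltcR; exact: Hr.
Qed.

Lemma complex_continuousP (f : C -> C) (z : C) : {for z, continuous f} <->
  forall e : R, 0 < e -> exists2 d : R, 0 < d &
    forall w, cabs (w - z) < d -> cabs (f w - f z) < e.
Proof.
rewrite continuous_normP; split=> [H e e0|H e].
  have : 0 < e%:C by rewrite ltcR.
  move=> /H /near_complexP[d d0 Hd]; exists d => // w /Hd.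
  by rewrite normC_cabs ltcR cabsB.
rewrite ltcE => /andP[/eqP/= e0 /H[d d0 Hd]].
apply/near_complexP; exists d => // w /Hd wz; rewrite normC_cabs ltcE/= e0 eqxx/=.
by rewrite cabsB.
Qed.

Lemma complex_derivativeP (f : C -> C) (z l : C) :
  (derivable f z 1 /\ derive1 f z = l) <->
  forall e : R, 0 < e -> exists2 d : R, 0 < d &
    forall h, cabs h < d -> cabs (f (z + h) - f z - l * h) <= e * cabs h.
Proof.
rewrite derive1_normP; split=> [H e e0|H e].
  have : 0 < e%:C by rewrite ltcR.
  move=> /H /near_complexP[d d0 Hd]; exists d => // h hd.
  have [->|h0] := eqVneq h 0.
    by rewrite addr0 subrr mulr0 subr0 cabs0 mulr0.
  have := Hd h; rewrite subr0 => /(_ hd h0); rewrite normC_cabs ltcR => /ltW.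
  have -> : f (z + h) - f z - l * h = - ((l - h^-1 * (f (z + h) - f z)) * h).
    by field.
  by rewrite cabsN cabsM; apply: ler_wpM2r; exact: cabs_ge0.
rewrite ltcE => /andP[/eqP/= e0 ep].
have [|d d0 Hd] := H (complex.Re e / 2); first by rewrite divr_gt0.
apply/near_complexP; exists d => // h.
rewrite subr0 => hd h0; rewrite normC_cabs ltcE/= e0 eqxx/=.
have h1 : 0 < cabs h by rewrite cabs_gt0.
rewrite -(ltr_pM2r h1) -cabsM.
have -> : (l - h^-1 * (f (z + h) - f z)) * h = - (f (z + h) - f z - l * h) by field.
rewrite cabsN (le_lt_trans (Hd _ hd))// ltr_pM2r//.
by rewrite ltr_pdivrMr// ltr_pMr// ltr1n.
Qed.

End ComplexModulus.

(** * Integrals of complex functions of a real variable *)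

Section PathIntegral.
Context {R : realType}.
Local Notation C := (Num.NumField.sort (complex_complex__canonical__Num_NumField R)).
Local Notation mu := (@lebesgue_measure R).
Implicit Types (a b c d : R) (phi psi : R -> R[i]).

Lemma addcE (p q r s : R) : (p +i* q) + (r +i* s) = (p + r) +i* (q + s).
Proof. by []. Qed.

Lemma mulcE (p q r s : R) :
  (p +i* q) * (r +i* s) = (p * r - q * s) +i* (p * s + q * r).
Proof. by []. Qed.

Definition path_integral a b phi : R[i] :=
  (\int[mu]_(t in `[a, b]) complex.Re (phi t)) +i*
  (\int[mu]_(t in `[a, b]) complex.Im (phi t)).

(** Continuity is two-sided also at the end points, as it is for the restriction
    to a segment of a function that is continuous on a neighbourhood. *)
Definition continuous_path a b phi := forall t, a <= t <= b ->
  {for t, continuous (fun s => complex.Re (phi s))} /\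
  {for t, continuous (fun s => complex.Im (phi s))}.

Lemma continuous_itv_integrable a b (g : R -> R) :
  (forall t, a <= t <= b -> {for t, continuous g}) ->
  mu.-integrable `[a, b] (EFin \o g).
Proof.
move=> cg; apply: continuous_compact_integrable; first exact: segment_compact.
by apply: continuous_in_subspaceT => t /set_mem /=; rewrite in_itv/=; exact: cg.
Qed.

Lemma integrable_Re a b phi : continuous_path a b phi ->
  mu.-integrable `[a, b] (EFin \o (fun t => complex.Re (phi t))).
Proof. by move=> H; apply: continuous_itv_integrable => t /H[]. Qed.

Lemma integrable_Im a b phi : continuous_path a b phi ->
  mu.-integrable `[a, b] (EFin \o (fun t => complex.Im (phi t))).
Proof. by move=> H; apply: continuous_itv_integrable => t /H[]. Qed.

Lemma eq_path_integral a b phi psi : (forall t, a <= t <= b -> phi t = psi t) ->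
  path_integral a b phi = path_integral a b psi.
Proof.
by move=> e; congr (_ +i* _); apply: eq_Rintegral => t /set_mem/=;
  rewrite in_itv/= => /e ->.
Qed.

Lemma path_integralD a b phi psi : continuous_path a b phi -> continuous_path a b psi ->
  path_integral a b (fun t => phi t + psi t) = path_integral a b phi + path_integral a b psi.
Proof.
move=> h1 h2; rewrite /path_integral addcE -!RintegralD//;
  [|exact: integrable_Im|exact: integrable_Im|exact: integrable_Re|exact: integrable_Re].
by congr (_ +i* _); apply: eq_Rintegral => t _; case: (phi t); case: (psi t).
Qed.

Lemma path_integralZ a b (k : R[i]) phi : continuous_path a b phi ->
  path_integral a b (fun t => k * phi t) = k * path_integral a b phi.
Proof.
move=> h; rewrite /path_integral; case: k => p q.
have iR := integrable_Re h; have iI := integrable_Im h.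
have zR r : mu.-integrable `[a, b] (EFin \o (fun t => r * complex.Re (phi t))).
  exact: (integrableZl _ r iR).
have zI r : mu.-integrable `[a, b] (EFin \o (fun t => r * complex.Im (phi t))).
  exact: (integrableZl _ r iI).
rewrite mulcE -!RintegralZl//.
congr (_ +i* _).
  rewrite -RintegralB//; apply: eq_Rintegral => t _; by case: (phi t).
rewrite -RintegralD//; apply: eq_Rintegral => t _; by case: (phi t).
Qed.

Lemma path_integral_cst a b (k : R[i]) : a <= b -> path_integral a b (fun=> k) = k * (b - a)%:C.
Proof.
move=> ab; rewrite /path_integral !Rintegral_cst//= lebesgue_measure_itv/= lte_fin.
have -> : fine (if a < b then (b%:E - a%:E)%E else 0%E) = b - a.
  by case: ltP => // ba; apply/esym/eqP; rewrite subr_eq0 eq_le ba.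
by case: k => p q; rewrite mulcE !mulr0 subr0 add0r.
Qed.

Lemma path_integral_cat a b c phi : a <= b -> b <= c -> continuous_path a c phi ->
  path_integral a c phi = path_integral a b phi + path_integral b c phi.
Proof.
move=> ab bc h; rewrite /path_integral addcE.
have cat (g : R -> R) : mu.-integrable `[a, c] (EFin \o g) ->
    \int[mu]_(t in `[a, c]) g t =
    \int[mu]_(t in `[a, b]) g t + \int[mu]_(t in `[b, c]) g t.
  move=> ig; apply/eqP; rewrite addrC -subr_eq; apply/eqP.
  rewrite Rintegral_itvB ?bnd_simp// Rintegral_itv_obnd_cbnd//.
  apply: integrableS ig => // t /=; rewrite !in_itv/= => /andP[bt ->].
  by rewrite andbT (le_trans ab (ltW bt)).
by congr (_ +i* _); apply: cat; [exact: integrable_Re|exact: integrable_Im].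
Qed.

(** The factor 2 comes from bounding real and imaginary part separately. *)
Lemma ler_path_integral a b phi M : a <= b -> continuous_path a b phi ->
  (forall t, a <= t <= b -> cabs (phi t) <= M) ->
  cabs (path_integral a b phi) <= 2 * M * (b - a).
Proof.
move=> ab h bd.
have cst_int : mu.-integrable `[a, b] (EFin \o (fun=> M : R)).
  by apply: continuous_itv_integrable => t _; exact: cst_continuous.
have bnd (g : R -> R) : mu.-integrable `[a, b] (EFin \o g) ->
    (forall t, a <= t <= b -> `|g t| <= M) ->
    `|\int[mu]_(t in `[a, b]) g t| <= M * (b - a).
  move=> ig gM; rewrite (le_trans (le_normr_Rintegral _ _))//.
  have -> : M * (b - a) = \int[mu]_(t in `[a, b]) M.
    rewrite Rintegral_cst//= lebesgue_measure_itv/= lte_fin.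
    case: ltP => //= ba; congr (_ * _).
    by apply/eqP; rewrite subr_eq0 eq_le ba.
  by apply: le_Rintegral => //; exact: (integrable_norm ig).
rewrite (le_trans (ler_cabs_ReIm _))//= -mulrA mulr2n mulrDl mul1r.
apply: lerD; apply: bnd.
- exact: integrable_Re.
- by move=> t /bd; exact: le_trans (ler_Re_cabs _).
- exact: integrable_Im.
- by move=> t /bd; exact: le_trans (ler_Im_cabs _).
Qed.

End PathIntegral.

(** * Contour integrals over rectangles *)

Section RectangleIntegral.
Context {R : realType}.
Local Notation C := (Num.NumField.sort (complex_complex__canonical__Num_NumField R)).
Implicit Types (a b c d t : R) (f g : C -> C) (z w : C).

(** The integral over the positively oriented boundary, with opposite sides
    paired under one integral sign. *)
Definition rect_integral f a b c d : C :=
  path_integral a b (fun t => f (t +i* c) - f (t +i* d)) +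
  'i * path_integral c d (fun t => f (b +i* t) - f (a +i* t)).

Definition in_rect a b c d z :=
  a <= complex.Re z <= b /\ c <= complex.Im z <= d.

Definition on_rect a b c d z :=
  (a <= complex.Re z <= b /\ (complex.Im z = c \/ complex.Im z = d)) \/
  (c <= complex.Im z <= d /\ (complex.Re z = a \/ complex.Re z = b)).

Definition continuous_on (P : C -> Prop) f := forall z, P z -> {for z, continuous f}.

Lemma on_rect_in a b c d z : a <= b -> c <= d -> on_rect a b c d z -> in_rect a b c d z.
Proof.
by move=> ab cd [] [h [] e]; split=> //; rewrite e lexx ?ab ?cd.
Qed.

Lemma continuous_path_comp f (gam : R -> C) t :
  (forall s, cabs (gam s - gam t) <= `|s - t|) -> {for gam t, continuous f} ->
  {for t, continuous (fun s => complex.Re (f (gam s)))} /\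
  {for t, continuous (fun s => complex.Im (f (gam s)))}.
Proof.
move=> lip /complex_continuousP cf.
suff H (e : R) : 0 < e -> \forall s \near t, cabs (f (gam s) - f (gam t)) < e.
  split; apply/cvgrPdist_lt => e /H; apply: filterS => s; apply: le_lt_trans.
    by rewrite -Re_subc cabsB ler_Re_cabs.
  by rewrite -Im_subc cabsB ler_Im_cabs.
move=> /cf[d d0 Hd]; apply/nbhs_normP; exists d => // s /= ts.
by apply: Hd; rewrite (le_lt_trans (lip s))// distrC.
Qed.

Lemma continuous_pathB a b (phi psi : R -> R[i]) :
  continuous_path a b phi -> continuous_path a b psi ->
  continuous_path a b (fun t => phi t - psi t).
Proof.
move=> h1 h2 t /[dup] /h1[r1 i1] /h2[r2 i2]; split.
  have -> : (fun s => complex.Re (phi s - psi s)) =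
     (fun s => complex.Re (phi s)) - (fun s => complex.Re (psi s)).
    by apply/funext => s; rewrite ?(Re_subc, Im_subc).
  exact: continuousB.
have -> : (fun s => complex.Im (phi s - psi s)) =
   (fun s => complex.Im (phi s)) - (fun s => complex.Im (psi s)).
  by apply/funext => s; rewrite ?(Re_subc, Im_subc).
exact: continuousB.
Qed.

Lemma continuous_pathx a b c f :
  continuous_on (fun z => a <= complex.Re z <= b /\ complex.Im z = c) f ->
  continuous_path a b (fun t => f (t +i* c)).
Proof.
move=> cf t tab; apply: (@continuous_path_comp f (fun t => t +i* c)); last exact: cf.
move=> s; rewrite (_ : _ - _ = (s - t)%:C) ?cabs_real//.
by apply: eq_ReIm; rewrite !(Re_subc, Im_subc)/= ?subrr.
Qed.

Lemma continuous_pathy a b c f :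
  continuous_on (fun z => a <= complex.Im z <= b /\ complex.Re z = c) f ->
  continuous_path a b (fun t => f (c +i* t)).
Proof.
move=> cf t tab; apply: (@continuous_path_comp f (fun t => c +i* t)); last exact: cf.
move=> s; rewrite (_ : _ - _ = 'i * (s - t)%:C) ?cabsM ?cabs_real ?cabs_i ?mul1r//.
by apply: eq_ReIm; rewrite !(Re_subc, Im_subc, Re_mulc, Im_mulc)/=; ring.
Qed.

Lemma continuous_sides a b c d f : continuous_on (on_rect a b c d) f ->
  continuous_path a b (fun t => f (t +i* c) - f (t +i* d)) /\
  continuous_path c d (fun t => f (b +i* t) - f (a +i* t)).
Proof.
move=> cf; split; apply: continuous_pathB;
  (apply: continuous_pathx || apply: continuous_pathy) => z [h1 h2]; apply: cf;
  by [left; split=> //; left|left; split=> //; right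
     |right; split=> //; left|right; split=> //; right].
Qed.

Lemma eq_rect_integral f g a b c d : a <= b -> c <= d ->
  (forall z, on_rect a b c d z -> f z = g z) -> rect_integral f a b c d = rect_integral g a b c d.
Proof.
move=> ab cd e; rewrite /rect_integral.
by congr (_ + _ * _); apply: eq_path_integral => t h; congr (_ - _); apply: e;
  [left; split=> //; left|left; split=> //; right
     |right; split=> //; right|right; split=> //; left].
Qed.

Lemma rect_integral_linear f g (k : C) a b c d :
  continuous_on (on_rect a b c d) f -> continuous_on (on_rect a b c d) g ->
  rect_integral (fun z => k * f z + g z) a b c d = k * rect_integral f a b c d + rect_integral g a b c d.
Proof.
move=> /[dup] cf /continuous_sides[f1 f2] /[dup] cg /continuous_sides[g1 g2].
have Z phi u v : continuous_path u v phi -> continuous_path u v (fun t => k * phi t).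
  move=> h t /h[r i]; case: (k) => p q; split.
    have -> : (fun s => complex.Re ((p +i* q) * phi s)) =
       p *: (fun s => complex.Re (phi s)) - q *: (fun s => complex.Im (phi s)).
      by apply/funext => s; rewrite ?(Re_mulc, Im_mulc).
    by apply: continuousB; apply: continuousZr.
  have -> : (fun s => complex.Im ((p +i* q) * phi s)) =
     p *: (fun s => complex.Im (phi s)) + q *: (fun s => complex.Re (phi s)).
    by apply/funext => s; rewrite ?(Re_mulc, Im_mulc).
  by apply: continuousD; apply: continuousZr.
rewrite /rect_integral mulrDr [k * ('i * _)]mulrCA -!(path_integralZ k)//.
rewrite addrACA -mulrDr -(path_integralD (Z _ _ _ f1) g1) -(path_integralD (Z _ _ _ f2) g2).
congr (_ + _ * _); apply: eq_path_integral => t _; ring.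
Qed.

Lemma rect_integral_catx f a b e c d : a <= b -> b <= e -> c <= d ->
  continuous_on (in_rect a e c d) f ->
  rect_integral f a e c d = rect_integral f a b c d + rect_integral f b e c d.
Proof.
move=> ab be cd cf; rewrite /rect_integral (@path_integral_cat _ a b e)//; last first.
  apply: (proj1 (@continuous_sides a e c d f _)) => z h; apply: cf; apply: on_rect_in => //; exact: le_trans be.
rewrite [RHS]addrACA -mulrDr -path_integralD.
- congr (_ + _ * _); apply: eq_path_integral => t _; ring.
- apply: (proj2 (@continuous_sides a b c d f _)) => z /on_rect_in [//|//|/andP[h1 h2] h3]; apply: cf; split=> //.
  by rewrite h1 (le_trans h2).
- apply: (proj2 (@continuous_sides b e c d f _)) => z /on_rect_in [//|//|/andP[h1 h2] h3]; apply: cf; split=> //.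
  by rewrite h2 (le_trans ab).
Qed.

Lemma rect_integral_caty f a b c e d : a <= b -> c <= e -> e <= d ->
  continuous_on (in_rect a b c d) f ->
  rect_integral f a b c d = rect_integral f a b c e + rect_integral f a b e d.
Proof.
move=> ab ce ed cf; rewrite /rect_integral (@path_integral_cat _ c e d)//; last first.
  apply: (proj2 (@continuous_sides a b c d f _)) => z h; apply: cf; apply: on_rect_in => //; exact: le_trans ed.
rewrite [RHS]addrACA -mulrDr -path_integralD.
- congr (_ + _ * _); apply: eq_path_integral => t _; ring.
- apply: (proj1 (@continuous_sides a b c e f _)) => z /on_rect_in [//|//|h3 /andP[h1 h2]]; apply: cf; split=> //.
  by rewrite h1 (le_trans h2).
- apply: (proj1 (@continuous_sides a b e d f _)) => z /on_rect_in [//|//|h3 /andP[h1 h2]]; apply: cf; split=> //.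
  by rewrite h2 (le_trans ce).
Qed.

Lemma ler_rect_integral f a b c d M : a <= b -> c <= d ->
  continuous_on (on_rect a b c d) f ->
  (forall z, on_rect a b c d z -> cabs (f z) <= M) ->
  cabs (rect_integral f a b c d) <= 4 * M * (b - a + (d - c)).
Proof.
move=> ab cd cf fM; have [c1 c2] := continuous_sides cf.
have -> : 4 * M * (b - a + (d - c)) =
  2 * (M + M) * (b - a) + 2 * (M + M) * (d - c) by ring.
rewrite (le_trans (ler_cabsD _ _))// cabsM cabs_i mul1r.
apply: lerD; apply: ler_path_integral => // t h;
  rewrite (le_trans (ler_cabsB _ _))// lerD//; apply: fM;
  by [left; split=> //; left|left; split=> //; right
     |right; split=> //; right|right; split=> //; left].
Qed.

(** The values of an affine function on opposite sides differ by a constant,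
    and the contributions of the two pairs of sides cancel. *)
Lemma rect_integral_affine (p q : C) a b c d : a <= b -> c <= d ->
  rect_integral (fun z => p + q * z) a b c d = 0.
Proof.
move=> ab cd; rewrite /rect_integral.
have -> : path_integral a b (fun t : R => p + q * (t +i* c) - (p + q * (t +i* d))) =
    path_integral a b (fun=> q * ('i * (c - d)%:C)).
  apply: eq_path_integral => t _.
  have -> : 'i * (c - d)%:C = (t +i* c) - (t +i* d) :> R[i].
    by apply: eq_ReIm; rewrite !(Re_subc, Im_subc, Re_mulc, Im_mulc)/=; ring.
  ring.
have -> : path_integral c d (fun t : R => p + q * (b +i* t) - (p + q * (a +i* t))) =
    path_integral c d (fun=> q * (b - a)%:C).
  apply: eq_path_integral => t _.
  have -> : (b - a)%:C = (b +i* t) - (a +i* t) :> R[i].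
    by apply: eq_ReIm; rewrite !(Re_subc, Im_subc)/=; ring.
  ring.
rewrite !path_integral_cst// !rmorphB/=; ring.
Qed.

End RectangleIntegral.

(** * Goursat's theorem *)

Section Goursat.
Context {R : realType}.
Local Notation C := (Num.NumField.sort (complex_complex__canonical__Num_NumField R)).
Implicit Types (a b c d t : R) (f g : C -> C) (z w : C).

Lemma in_rect_cabs a b c d z w : in_rect a b c d z -> in_rect a b c d w ->
  cabs (z - w) <= b - a + (d - c).
Proof.
move=> [/andP[? ?] /andP[? ?]] [/andP[? ?] /andP[? ?]].
rewrite (le_trans (ler_cabs_ReIm _))// Re_subc Im_subc.
by apply: lerD; rewrite ler_norml; lra.
Qed.

(** Up to a remainder that is small relative to the diameter, f is affine near
    z, and affine functions have vanishing contour integral. *)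
Lemma goursat_local f z : derivable f z 1 -> forall e : R, 0 < e ->
  exists2 del : R, 0 < del & forall a b c d, a <= b -> c <= d ->
    in_rect a b c d z -> b - a + (d - c) < del ->
    continuous_on (on_rect a b c d) f ->
    cabs (rect_integral f a b c d) <= e * (b - a + (d - c)) ^+ 2.
Proof.
move=> df e e0.
have e4 : 0 < e / 4 by rewrite divr_gt0.
have [del del0 Hd] := proj1 (complex_derivativeP f z _) (conj df erefl) _ e4.
exists del => // a b c d ab cd zin Ld cf.
set l := derive1 f z in Hd.
pose p := f z - l * z.
pose r := fun w => f w - (p + l * w).
have ca : continuous_on (on_rect a b c d) (fun w => p + l * w).
  by move=> w _; exact: continuous_affine.
have cr : continuous_on (on_rect a b c d) r.
  by move=> w h; apply: continuousB; [exact: cf|exact: ca].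
have -> : rect_integral f a b c d = rect_integral r a b c d.
  rewrite (@eq_rect_integral _ f (fun w => 1 * (p + l * w) + r w))//; last first.
    by move=> w _; rewrite /r; ring.
  by rewrite rect_integral_linear// rect_integral_affine// mulr0 add0r.
have L0 : 0 <= b - a + (d - c) by rewrite addr_ge0// subr_ge0.
have -> : e * (b - a + (d - c)) ^+ 2 =
  4 * (e / 4 * (b - a + (d - c))) * (b - a + (d - c)) by field.
apply: ler_rect_integral => // w /(on_rect_in ab cd) win.
have wz := in_rect_cabs win zin.
have := Hd (w - z) (le_lt_trans wz Ld).
have -> : f (z + (w - z)) - f z - l * (w - z) = r w.
  by rewrite /r /p (addrC z) subrK; ring.
move=> /le_trans; apply; exact: ler_wpM2l (ltW e4) _ _ wz.
Qed.

Lemma rect_integral_quarter f a b c d eta : a <= b -> c <= d ->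
  continuous_on (in_rect a b c d) f -> eta <= cabs (rect_integral f a b c d) ->
  let m := (a + b) / 2 in let n := (c + d) / 2 in
  exists x y, [/\ x = a \/ x = m, y = c \/ y = n &
    eta / 4 <= cabs (rect_integral f x (x + (b - a) / 2) y (y + (d - c) / 2))].
Proof.
move=> ab cd cf He m n.
have am : a <= m by rewrite /m; lra.
have mb : m <= b by rewrite /m; lra.
have cn : c <= n by rewrite /n; lra.
have nd : n <= d by rewrite /n; lra.
have E1 : a + (b - a) / 2 = m by rewrite /m; field.
have E2 : m + (b - a) / 2 = b by rewrite /m; field.
have E3 : c + (d - c) / 2 = n by rewrite /n; field.
have E4 : n + (d - c) / 2 = d by rewrite /n; field.
move: He; rewrite (@rect_integral_catx _ f a m b)// (@rect_integral_caty _ f a m c n d)//; last first.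
  by move=> z [/andP[h1 h2] h3]; apply: cf; split=> //; rewrite h1 (le_trans h2).
rewrite (@rect_integral_caty _ f m b c n d)//; last first.
  by move=> z [/andP[h1 h2] h3]; apply: cf; split=> //; rewrite h2 (le_trans am).
set r1 := rect_integral f a m c n; set r2 := rect_integral f a m n d.
set r3 := rect_integral f m b c n; set r4 := rect_integral f m b n d => He.
have [h1|h1] := leP (eta / 4) (cabs r1).
  by exists a, c; rewrite E1 E3; split=> //; left.
have [h2|h2] := leP (eta / 4) (cabs r2).
  by exists a, n; rewrite E1 E4; split=> //; [left|right].
have [h3|h3] := leP (eta / 4) (cabs r3).
  by exists m, c; rewrite E2 E3; split=> //; [right|left].
have [h4|h4] := leP (eta / 4) (cabs r4).
  by exists m, n; rewrite E2 E4; split=> //; right.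
have t1 := ler_cabsD (r1 + r2) (r3 + r4).
have t2 := ler_cabsD r1 r2; have t3 := ler_cabsD r3 r4.
by clear -He h1 h2 h3 h4 t1 t2 t3; lra.
Qed.

Lemma nested_intervals (x l : nat -> R) :
  (forall n, 0 <= l n) -> (forall n, x n <= x n.+1) ->
  (forall n, x n.+1 + l n.+1 <= x n + l n) ->
  exists y, forall n, x n <= y <= x n + l n.
Proof.
move=> l0 xS lS.
have x_le m n : (m <= n)%N -> x m <= x n.
  by move=> mn; apply: (@nondecreasing_seqP _ _ x).1 => //.
have l_le m n : (m <= n)%N -> x n + l n <= x m + l m.
  elim: n => [|n IH]; first by rewrite leqn0 => /eqP ->.
  by rewrite leq_eqVlt => /predU1P[->//|/IH]; exact: le_trans.
have ub n : ubound (range x) (x n + l n).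
  move=> _ [m _ <-]; have [mn|/ltnW nm] := leqP m n.
    by rewrite (le_trans (x_le _ _ mn))// lerDl.
  by rewrite (le_trans _ (l_le _ _ nm))// lerDl.
exists (sup (range x)) => n; apply/andP; split.
  by apply: ub_le_sup; [exists (x 0%N + l 0%N); exact: ub|exists n].
by apply: ge_sup; [exists (x 0%N); exists 0%N|exact: ub].
Qed.

(** Bisect, always keeping a quarter whose integral has at least a quarter of
    the modulus. The quarters shrink to a point, where [goursat_local] makes the
    integral too small in comparison with the squared diameter. *)
Theorem goursat f a b c d : a <= b -> c <= d ->
  (forall z, in_rect a b c d z -> derivable f z 1) -> rect_integral f a b c d = 0.
Proof.
move=> ab cd df; apply/eqP; rewrite -cabs_eq0; apply/eqP/le_anti.
rewrite cabs_ge0 andbT leNgt; apply/negP => eta0.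
set eta := cabs (rect_integral f a b c d) in eta0.
have cf : continuous_on (in_rect a b c d) f.
  by move=> z /df; exact: derivable_continuous.
pose w n := (b - a) / 2 ^+ n; pose h n := (d - c) / 2 ^+ n.
have w0 n : 0 <= w n by rewrite divr_ge0 ?exprn_ge0 ?subr_ge0.
have h0 n : 0 <= h n by rewrite divr_ge0 ?exprn_ge0 ?subr_ge0.
have wS n : w n = w n.+1 + w n.+1 by rewrite /w exprS; field; rewrite expf_neq0.
have hS n : h n = h n.+1 + h n.+1 by rewrite /h exprS; field; rewrite expf_neq0.
pose big n (x y : R) := [/\ a <= x, x + w n <= b, c <= y, y + h n <= d &
   eta / 4 ^+ n <= cabs (rect_integral f x (x + w n) y (y + h n))].
pose step (s s' : nat * (R * R)) := big s.1 s.2.1 s.2.2 ->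
  [/\ s'.1 = s.1.+1, big s'.1 s'.2.1 s'.2.2,
      s.2.1 <= s'.2.1 /\ s'.2.1 + w s'.1 <= s.2.1 + w s.1 &
      s.2.2 <= s'.2.2 /\ s'.2.2 + h s'.1 <= s.2.2 + h s.1].
have stepP s : {s' | step s s'}.
  apply: cid; case: s => n [x y]; rewrite /step /=.
  have [[ax xb cy yd He]|nb] := pselect (big n x y); last by exists (n, (x, y)).
  have [|||x' [y' [xE yE He']]] := @rect_integral_quarter f x (x + w n) y (y + h n) _ _ _ _ He.
  - by rewrite lerDl.
  - by rewrite lerDl.
  - move=> z [/andP[z1 z2] /andP[z3 z4]]; apply: cf; split.
      by rewrite (le_trans ax z1) (le_trans z2 xb).
    by rewrite (le_trans cy z3) (le_trans z4 yd).
  exists (n.+1, (x', y')) => _ /=.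
  have wSn := wS n; have hSn := hS n; have wSp := w0 n.+1; have hSp := h0 n.+1.
  have wE : (x + w n - x) / 2 = w n.+1 by rewrite wSn; field.
  have hE : (y + h n - y) / 2 = h n.+1 by rewrite hSn; field.
  rewrite wE hE in He'.
  have e4 : eta / 4 ^+ n / 4 = eta / 4 ^+ n.+1.
    by rewrite exprS; field; rewrite expf_neq0.
  rewrite e4 in He'.
  have x2 : (x + (x + w n)) / 2 = x + w n.+1 by rewrite wSn; field.
  have y2 : (y + (y + h n)) / 2 = y + h n.+1 by rewrite hSn; field.
  rewrite x2 in xE; rewrite y2 in yE.
  have X : x <= x' /\ x' + w n.+1 <= x + w n.
    by clear -xE wSn wSp; case: xE => ->; split; lra.
  have Y : y <= y' /\ y' + h n.+1 <= y + h n.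
    by clear -yE hSn hSp; case: yE => ->; split; lra.
  case: (X) (Y) => X1 X2 [Y1 Y2]; split=> //.
  by clear -ax xb cy yd He' X1 X2 Y1 Y2; split=> //; lra.
have [s [s0 sS]] := dependent_choice stepP (0%N, (a, c)).
have inv n : (s n).1 = n /\ big n (s n).2.1 (s n).2.2.
  elim: n => [|n [IH1 IH2]].
    rewrite s0; split=> //; rewrite /big /w /h !expr0 !divr1 /=.
    by rewrite !(addrC _ (_ - _)) !subrK !lexx; split.
  by have := sS n; rewrite /step IH1 => /(_ IH2)[E B _ _]; rewrite E in B *.
have incr n : [/\ (s n).2.1 <= (s n.+1).2.1,
   (s n.+1).2.1 + w n.+1 <= (s n).2.1 + w n, (s n).2.2 <= (s n.+1).2.2 &
   (s n.+1).2.2 + h n.+1 <= (s n).2.2 + h n].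
  have [E1 B1] := inv n; have := sS n; rewrite /step E1 => /(_ B1)[E _ [X1 X2] [Y1 Y2]].
  by rewrite E in X2 Y2; split.
have [x Hx] : exists x, forall n, (s n).2.1 <= x <= (s n).2.1 + w n.
  by apply: nested_intervals => // n; have [] := incr n.
have [y Hy] : exists y, forall n, (s n).2.2 <= y <= (s n).2.2 + h n.
  by apply: nested_intervals => // n; have [] := incr n.
have zin : in_rect a b c d (x +i* y).
  have := Hx 0%N; have := Hy 0%N; rewrite s0 /w /h expr0 !divr1/=.
  by rewrite !(addrC _ (_ - _)) !subrK.
pose L := b - a + (d - c).
have L0 : 0 <= L by rewrite /L; lra.
have L1 : 0 < L ^+ 2 + 1 by rewrite ltr_wpDl ?sqr_ge0.
(* Any e with e L^2 < eta contradicts the lower bound eta / 4^n. *)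
have e0 : 0 < eta / (L ^+ 2 + 1) by exact: divr_gt0.
have [del del0 Hd] := goursat_local (df _ zin) e0.
have [n Ln] : exists n, L / 2 ^+ n < del.
  exists (Num.Def.archi_bound (L / del)).
  rewrite ltr_pdivrMr ?exprn_gt0// mulrC -ltr_pdivrMr//.
  apply: lt_le_trans (archi_boundP _) _; first by rewrite divr_ge0// ltW.
  by rewrite -natrX ler_nat ltnW// ltn_expl.
have wh : w n + h n = L / 2 ^+ n by rewrite /w /h /L -mulrDl.
have [_ [B1 B2 B3 B4 B5]] := inv n.
set xn := (s n).2.1 in B1 B2 B5 *; set yn := (s n).2.2 in B3 B4 B5 *.
have sz : xn + w n - xn + (yn + h n - yn) = L / 2 ^+ n by rewrite -wh; ring.
have xw : xn <= xn + w n by rewrite lerDl.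
have yh : yn <= yn + h n by rewrite lerDl.
have cs : continuous_on (on_rect xn (xn + w n) yn (yn + h n)) f.
  move=> z /(on_rect_in xw yh)[/andP[z1 z2] /andP[z3 z4]]; apply: cf; split.
    by rewrite (le_trans B1 z1) (le_trans z2 B2).
  by rewrite (le_trans B3 z3) (le_trans z4 B4).
have := Hd xn (xn + w n) yn (yn + h n); rewrite sz.
move=> /(_ xw yh (conj (Hx n) (Hy n)) Ln cs) /(le_trans B5).
have -> : eta / (L ^+ 2 + 1) * (L / 2 ^+ n) ^+ 2 =
    (eta / (L ^+ 2 + 1) * L ^+ 2) / 4 ^+ n.
  rewrite -[RHS]mulrA expr_div_n -exprM mulnC exprM; congr (_ * (_ / _ ^+ _)).
  by rewrite -natrX.
rewrite ler_pM2r ?invr_gt0 ?exprn_gt0// mulrAC ler_pdivlMr//.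
by rewrite ler_pM2l// gerDl ler10.
Qed.

End Goursat.

(** * Cauchy's formula and the smoothness of holomorphic functions *)

Section Cauchy.
Context {R : realType}.
Local Notation C := (Num.NumField.sort (complex_complex__canonical__Num_NumField R)).
Implicit Types (a b c d t r s : R) (f g phi : C -> C) (z w h : C).

Lemma sub_in_rect a b c d a' b' c' d' z : a <= a' -> b' <= b -> c <= c' -> d' <= d ->
  in_rect a' b' c' d' z -> in_rect a b c d z.
Proof.
move=> aa bb cc dd [/andP[h1 h2] /andP[h3 h4]]; split.
  by rewrite (le_trans aa h1) (le_trans h2 bb).
by rewrite (le_trans cc h3) (le_trans h4 dd).
Qed.

(** By additivity the integral equals the one over any small square around w,
    and there g is bounded, so that it tends to 0 with the side. *)
Lemma goursat_punctured g a b c d w :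
  a < complex.Re w < b -> c < complex.Im w < d ->
  continuous_on (in_rect a b c d) g ->
  (forall z, in_rect a b c d z -> z != w -> derivable g z 1) ->
  rect_integral g a b c d = 0.
Proof.
case: w => u v /= /andP[au ub] /andP[cv vd] cg dg.
have shrink e : 0 < e -> e <= u - a -> e <= b - u -> e <= v - c -> e <= d - v ->
    rect_integral g a b c d = rect_integral g (u - e) (u + e) (v - e) (v + e).
  move=> e0 ea eb ec ed.
  (* The four rectangles cut off around the small square avoid w. *)
  have zero a' b' c' d' : a <= a' -> b' <= b -> c <= c' -> d' <= d ->
      a' <= b' -> c' <= d' -> ~ in_rect a' b' c' d' (u +i* v) ->
      rect_integral g a' b' c' d' = 0.
    move=> aa bb cc dd ab cd nin; apply: goursat => // z zin; apply: dg.
      exact: sub_in_rect zin.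
    by apply/eqP => zw; apply: nin; rewrite -zw.
  have cgS a' b' c' d' : a <= a' -> b' <= b -> c <= c' -> d' <= d ->
      continuous_on (in_rect a' b' c' d') g.
    by move=> aa bb cc dd z zin; apply: cg; exact: sub_in_rect zin.
  rewrite (@rect_integral_catx _ g a (u - e) b); [|lra|lra|lra|apply: cgS; lra].
  rewrite zero; [rewrite add0r|lra|lra|lra|lra|lra|lra|by case=> /andP[]/=; lra].
  rewrite (@rect_integral_catx _ g _ (u + e) b); [|lra|lra|lra|apply: cgS; lra].
  rewrite [X in _ + X]zero; [rewrite addr0|lra|lra|lra|lra|lra|lra|by case=> /andP[]/=; lra].
  rewrite (@rect_integral_caty _ g _ _ c (v - e) d); [|lra|lra|lra|apply: cgS; lra].
  rewrite zero; [rewrite add0r|lra|lra|lra|lra|lra|lra|by case=> _ /andP[]/=; lra].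
  rewrite (@rect_integral_caty _ g _ _ _ (v + e) d); [|lra|lra|lra|apply: cgS; lra].
  rewrite [X in _ + X]zero; [by rewrite addr0|lra|lra|lra|lra|lra|lra|by case=> _ /andP[]/=; lra].
apply/eqP; rewrite -cabs_eq0; apply/eqP/le_anti.
rewrite cabs_ge0 andbT leNgt; apply/negP => eta0.
set eta := cabs (rect_integral g a b c d) in eta0.
have win : in_rect a b c d (u +i* v) by split=> /=; apply/andP; split; lra.
have [del del0 Hd] := proj1 (complex_continuousP g _) (cg _ win) 1 ltr01.
set M := cabs (g (u +i* v)) + 1.
have M0 : 0 < M by rewrite ltr_wpDl ?cabs_ge0.
pose e := Num.min (Num.min (Num.min (u - a) (b - u)) (Num.min (v - c) (d - v)))
            (Num.min (del / 8) (eta / (32 * M))).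
have e0 : 0 < e by rewrite /e !lt_min !subr_gt0 au ub cv vd !divr_gt0// mulr_gt0.
have : e <= e by []; rewrite {2}/e !le_min.
move=> /andP[/andP[/andP[e1 e2] /andP[e3 e4]] /andP[e5 e6]].
have := shrink e e0 e1 e2 e3 e4; rewrite /eta => E; rewrite /eta E in eta0 e6.
have xx : u - e <= u + e by lra.
have yy : v - e <= v + e by lra.
have : cabs (rect_integral g (u - e) (u + e) (v - e) (v + e)) <=
    4 * M * (u + e - (u - e) + (v + e - (v - e))).
  have sub z : in_rect (u - e) (u + e) (v - e) (v + e) z -> in_rect a b c d z.
    by apply: sub_in_rect; lra.
  apply: ler_rect_integral => // [z /(on_rect_in xx yy) /sub|z /(on_rect_in xx yy) zin]; first exact: cg.
  have win' : in_rect (u - e) (u + e) (v - e) (v + e) (u +i* v).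
    by split=> /=; apply/andP; split; lra.
  have := in_rect_cabs zin win' => zw.
  have /Hd : cabs (z - (u +i* v)) < del by lra.
  by have := ler_dist_cabs (g z) (g (u +i* v)); rewrite /M; lra.
have -> : 4 * M * (u + e - (u - e) + (v + e - (v - e))) = 16 * M * e by ring.
move: e6; rewrite ler_pdivlMr ?mulr_gt0//.
move: eta0; set eta' := cabs _; have := mulr_gt0 M0 e0; nra.
Qed.

(** [goursat_punctured] for the difference quotient (f z - f w) / (z - w),
    extended by f' w at w. The winding integral on the left is nonzero at the
    centre of a square by [rect_integral_inv_neq0]. *)
Lemma cauchy_formula f a b c d w :
  a < complex.Re w < b -> c < complex.Im w < d ->
  (forall z, in_rect a b c d z -> derivable f z 1) ->
  f w * rect_integral (fun z => (z - w)^-1) a b c d = rect_integral (fun z => f z * (z - w)^-1) a b c d.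
Proof.
move=> wx wy df; have [w1 w2] := andP wx; have [w3 w4] := andP wy.
have ab : a <= b by lra.
have cd : c <= d by lra.
have win : in_rect a b c d w by split; apply/andP; split; exact: ltW.
pose q z := (f z - f w) * (z - w)^-1.
pose g z := if z == w then derive1 f w else q z.
have dg z : in_rect a b c d z -> z != w -> derivable g z 1.
  move=> /df dfz zw; apply: (eq_near_derivable _ (derivable_divided_difference zw dfz)).
  apply/near_complexP; exists (cabs (z - w)); first by rewrite cabs_gt0 subr_eq0.
  move=> y yz; rewrite /g ifN//; apply/eqP => yw.
  by move: yz; rewrite yw cabsB ltxx.
have cg : continuous_on (in_rect a b c d) g.
  move=> z zin; have [->|zw] := eqVneq z w; last exact/derivable_continuous/dg.
  apply/complex_continuousP => e e0.
  have [del del0 Hd] := proj1 (complex_derivativeP f w _) (conj (df w win) erefl)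
    (e / 2) (divr_gt0 e0 (ltr0Sn _ _)).
  exists del => // y yw; rewrite /g eqxx; case: ifPn => [_|ny].
    by rewrite subrr cabs0.
  have := Hd _ yw; rewrite (addrC w) subrK.
  have p0 : 0 < cabs (y - w) by rewrite cabs_gt0 subr_eq0.
  have -> : f y - f w - f^`()%classic w * (y - w) = (q y - f^`()%classic w) * (y - w).
    by rewrite /q; field; rewrite subr_eq0.
  by rewrite cabsM ler_pM2r// => /le_lt_trans; apply; rewrite ltr_pdivrMr// ltr_pMr// ltr1n.
have nw z : on_rect a b c d z -> z != w.
  by case=> [[_ []]|[_ []]] E; apply/eqP => zw; move: w1 w2 w3 w4; rewrite -zw E ltxx.
have E : rect_integral (fun z => f z * (z - w)^-1) a b c d =
   rect_integral (fun z => f w * (z - w)^-1 + g z) a b c d.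
  apply: eq_rect_integral => // z /nw zw; rewrite /g ifN// /q; ring.
rewrite E rect_integral_linear ?(@goursat_punctured g a b c d w) ?addr0//.
- by move=> z /nw zw; exact: (derivable_continuous (derivable_inv_sub zw)).
- by move=> z /(on_rect_in ab cd); exact: cg.
Qed.

(** A quadratic bound on the Taylor remainder of the kernel, uniform on the
    contour, carries the derivative through the integral. *)
Lemma derivative_under_rect phi (k k' : C -> C -> C) a b c d w (M B s : R) :
  a <= b -> c <= d -> 0 < s ->
  continuous_on (on_rect a b c d) (fun z => phi z * k' w z) ->
  (forall h, cabs h < s ->
     continuous_on (on_rect a b c d) (fun z => phi z * k (w + h) z)) ->
  (forall z, on_rect a b c d z -> cabs (phi z) <= M) ->
  (forall z h, on_rect a b c d z -> cabs h < s ->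
     cabs (k (w + h) z - k w z - h * k' w z) <= B * cabs h ^+ 2) ->
  derivable (fun w => rect_integral (fun z => phi z * k w z) a b c d) w 1 /\
  derive1 (fun w => rect_integral (fun z => phi z * k w z) a b c d) w =
    rect_integral (fun z => phi z * k' w z) a b c d.
Proof.
move=> ab cd s0 ck' ck phiM kB; apply/complex_derivativeP => e e0.
have M0 : 0 <= M.
  have : on_rect a b c d (a +i* c) by left; rewrite /= lexx ab; split=> //; left.
  by move=> /phiM; apply: le_trans; exact: cabs_ge0.
have B0 : 0 <= B.
  have z1 : on_rect a b c d (a +i* c) by left; rewrite /= lexx ab; split=> //; left.
  have s2 : 0 < s / 2 by rewrite divr_gt0.
  have hs : cabs (s / 2)%:C < s by rewrite cabs_real gtr0_norm//; lra.
  have := le_trans (cabs_ge0 _) (kB _ _ z1 hs).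
  by rewrite pmulr_lge0// exprn_gt0// cabs_real gtr0_norm.
pose L := 4 * (M * B) * (b - a + (d - c)).
have L0 : 0 <= L by rewrite !mulr_ge0//; lra.
exists (Num.min s (e / (L + 1))).
  by rewrite lt_min s0 divr_gt0// ltr_wpDl.
move=> h; rewrite lt_min => /andP[hs he].
have z0s : cabs 0 < s by rewrite cabs0.
have ck0 : continuous_on (on_rect a b c d) (fun z => phi z * k w z).
  by have := ck 0 z0s; rewrite addr0.
have cN (g1 g2 : C -> C) (l : C) : continuous_on (on_rect a b c d) g1 ->
    continuous_on (on_rect a b c d) g2 ->
    continuous_on (on_rect a b c d) (fun z => l * g1 z + g2 z).
  by move=> c1 c2 z zr; apply: continuous_combination; [exact: c1|exact: c2].
rewrite mulrC.
have -> : rect_integral (fun z => phi z * k (w + h) z) a b c d - rect_integral (fun z => phi z * k w z) a b c d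
  - h * rect_integral (fun z => phi z * k' w z) a b c d =
  rect_integral (fun z => - h * (phi z * k' w z) + (-1 * (phi z * k w z) + phi z * k (w + h) z)) a b c d.
  rewrite (rect_integral_linear (- h) ck' (cN _ _ (-1) ck0 (ck h hs))).
  rewrite (rect_integral_linear (-1) ck0 (ck h hs)).
  move: (rect_integral _ _ _ _ _) (rect_integral _ _ _ _ _) (rect_integral _ _ _ _ _) => r1 r2 r3; ring.
apply: (@le_trans _ _ (4 * (M * (B * cabs h ^+ 2)) * (b - a + (d - c)))).
  apply: (ler_rect_integral ab cd (cN _ _ (- h) ck' (cN _ _ (-1) ck0 (ck h hs)))) => z zr.
  have -> : - h * (phi z * k' w z) + (-1 * (phi z * k w z) + phi z * k (w + h) z) =
     phi z * (k (w + h) z - k w z - h * k' w z) by ring.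
  rewrite cabsM; apply: ler_pM; rewrite ?cabs_ge0//; [exact: phiM|exact: kB].
have -> : 4 * (M * (B * cabs h ^+ 2)) * (b - a + (d - c)) = L * cabs h * cabs h.
  by rewrite /L; ring.
apply: ler_wpM2r; first exact: cabs_ge0.
move: he; rewrite ltr_pdivlMr ?ltr_wpDl// => he.
by have := cabs_ge0 h; lra.
Qed.

End Cauchy.

Section HolomorphicDerivative.
Context {R : realType}.
Local Notation C := (Num.NumField.sort (complex_complex__canonical__Num_NumField R)).
Implicit Types (a b c d t r s : R) (f g phi : C -> C) (z w h : C).

(* The Cauchy kernels, for a point w at distance at least 2 s from the contour;
   then w + h stays at distance s for |h| < s. *)
Section Kernel.
Variables (phi : C -> C) (a b c d M s : R) (w : C).
Hypotheses (ab : a <= b) (cd : c <= d) (s0 : 0 < s).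
Hypothesis cphi : continuous_on (on_rect a b c d) phi.
Hypothesis phiM : forall z, on_rect a b c d z -> cabs (phi z) <= M.
Hypothesis far : forall z, on_rect a b c d z -> 2 * s <= cabs (z - w).

Lemma ler_shifted_kernel z h : on_rect a b c d z -> cabs h < s -> s <= cabs (z - (w + h)).
Proof.
move=> /far zw hs; rewrite opprD addrA.
by have := ler_dist_cabs (z - w) h; lra.
Qed.

Lemma continuous_kernel h n : cabs h < s ->
  continuous_on (on_rect a b c d) (fun z => phi z * ((z - (w + h))^-1) ^+ n).
Proof.
move=> hs z zr; apply: continuous_mul; first exact: cphi.
apply/derivable_continuous/derivable_inv_sub_exp.
have := ler_shifted_kernel zr hs; rewrite -subr_eq0 -cabs_gt0; exact: lt_le_trans.
Qed.

Lemma cabs_inv_le z h : on_rect a b c d z -> cabs h < s ->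
  z - (w + h) != 0 /\ cabs (z - (w + h))^-1 <= s^-1.
Proof.
move=> zr hs; have := ler_shifted_kernel zr hs => H.
have p : 0 < cabs (z - (w + h)) by exact: lt_le_trans H.
by rewrite -cabs_gt0 cabsV lef_pV2.
Qed.

Lemma derivative_cauchy_kernel1 :
  derivable (fun w => rect_integral (fun z => phi z * (z - w)^-1) a b c d) w 1 /\
  derive1 (fun w => rect_integral (fun z => phi z * (z - w)^-1) a b c d) w =
    rect_integral (fun z => phi z * (z - w)^-1 ^+ 2) a b c d.
Proof.
apply: (@derivative_under_rect _ phi (fun w z => (z - w)^-1)
  (fun w z => (z - w)^-1 ^+ 2) a b c d w M (s^-1 ^+ 3) s ab cd s0 _ _ phiM).
- by have := @continuous_kernel 0 2%N; rewrite cabs0 addr0; apply.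
- move=> h hs; exact: (continuous_kernel (n := 1)).
move=> z h zr hs.
have [n1 b1] := cabs_inv_le zr hs.
have h0 : cabs 0 < s by rewrite cabs0.
have [n0 b0] := cabs_inv_le zr h0; rewrite addr0 in n0 b0.
have -> : (z - (w + h))^-1 - (z - w)^-1 - h * (z - w)^-1 ^+ 2 =
  (z - w)^-1 * (z - w)^-1 * (z - (w + h))^-1 * (h * h).
  by field; rewrite n0 n1.
rewrite cabsM (cabsM h) -expr2; apply: ler_wpM2r; first exact: sqr_ge0.
rewrite !cabsM (_ : s^-1 ^+ 3 = s^-1 * s^-1 * s^-1); last by ring.
by do 2 (apply: ler_pM => //; rewrite ?mulr_ge0 ?cabs_ge0//).
Qed.

Lemma derivative_cauchy_kernel2 :
  derivable (fun w => rect_integral (fun z => phi z * (z - w)^-1 ^+ 2) a b c d) w 1.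
Proof.
apply: (proj1 (@derivative_under_rect _ phi (fun w z => (z - w)^-1 ^+ 2)
  (fun w z => 2 * (z - w)^-1 ^+ 3) a b c d w M (3 * s^-1 ^+ 4) s ab cd s0 _ _ phiM _)).
- move=> z zr; have -> : (fun z => phi z * (2 * (z - w)^-1 ^+ 3)) =
    (fun z => 2 * (phi z * (z - w)^-1 ^+ 3)) by apply/funext => y; ring.
  have ck := @continuous_kernel 0 3%N; rewrite cabs0 addr0 in ck.
  have -> : (fun z => 2 * (phi z * (z - w)^-1 ^+ 3)) =
    (fun z => 2 * (phi z * (z - w)^-1 ^+ 3) + 0) by apply/funext => y; rewrite addr0.
  by apply: continuous_combination; [exact: ck|exact: cst_continuous].
- move=> h hs; exact: continuous_kernel.
move=> z h zr hs.
have [n1 b1] := cabs_inv_le zr hs.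
have h0 : cabs 0 < s by rewrite cabs0.
have [n0 b0] := cabs_inv_le zr h0; rewrite addr0 in n0 b0.
set x := (z - w)^-1 in b0 *; set y := (z - (w + h))^-1 in b1 *.
(* Three products of four kernel values, each at most 1 / s^4. *)
have -> : y ^+ 2 - x ^+ 2 - h * (2 * x ^+ 3) =
  (x * x * (y * y) + (x * x * (x * y) + x * x * (x * y))) * (h * h).
  by rewrite /x /y; field; rewrite n0 n1.
rewrite cabsM (cabsM h) -expr2; apply: ler_wpM2r; first exact: sqr_ge0.
have q u v : cabs u <= s^-1 -> cabs v <= s^-1 -> cabs (x * x * (u * v)) <= s^-1 ^+ 4.
  move=> hu hv; rewrite !cabsM (_ : s^-1 ^+ 4 = s^-1 * s^-1 * (s^-1 * s^-1)); last by ring.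
  by do 2 (apply: ler_pM; rewrite ?mulr_ge0 ?cabs_ge0//).
have := ler_cabsD (x * x * (y * y)) (x * x * (x * y) + x * x * (x * y)).
have := ler_cabsD (x * x * (x * y)) (x * x * (x * y)).
have := q y y b1 b1; have := q x y b0 b1; lra.
Qed.

End Kernel.

Lemma ler_path_integral_Re a b (gam : R -> R[i]) (m : R) : a <= b -> continuous_path a b gam ->
  (forall t, a <= t <= b -> m <= complex.Re (gam t)) ->
  m * (b - a) <= complex.Re (path_integral a b gam).
Proof.
move=> ab cg gm; have -> : m * (b - a) = complex.Re (path_integral a b (fun=> m%:C)).
  by rewrite path_integral_cst// -rmorphM.
apply: le_Rintegral => //=; last exact: integrable_Re.
by apply: continuous_itv_integrable => t _; exact: cst_continuous.
Qed.

Lemma ler_path_integral_Im a b (gam : R -> R[i]) (m : R) : a <= b -> continuous_path a b gam ->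
  (forall t, a <= t <= b -> m <= complex.Im (gam t)) ->
  m * (b - a) <= complex.Im (path_integral a b gam).
Proof.
move=> ab cg gm; have -> : m * (b - a) = complex.Re (path_integral a b (fun=> m%:C)).
  by rewrite path_integral_cst// -rmorphM.
apply: le_Rintegral => //=; last exact: integrable_Im.
by apply: continuous_itv_integrable => t _; exact: cst_continuous.
Qed.

Lemma Re_invc (u v : R) : complex.Re (u +i* v)^-1 = u / (u ^+ 2 + v ^+ 2).
Proof. by []. Qed.

Lemma Im_invc (u v : R) : complex.Im (u +i* v)^-1 = - (v / (u ^+ 2 + v ^+ 2)).
Proof. by []. Qed.

(** On the side of a square of half side r, the angular density
    r / (u^2 + r^2) is at least 1 / (2 r). *)
Lemma ler_inv_side (r u : R) : 0 < r -> - r <= u <= r ->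
  r^-1 <= 2 * r / (u ^+ 2 + r ^+ 2).
Proof.
move=> r0 /andP[u1 u2]; rewrite -[leLHS]mul1r ler_pdivrMr// mulrAC ler_pdivlMr.
  by nra.
by rewrite ltr_wpDl ?sqr_ge0// exprn_gt0.
Qed.

(** Each side of a square contributes to the integral of dz / (z - z0) around
    its centre a positive imaginary part, namely the angle it subtends. *)
Lemma rect_integral_inv_neq0 (x y r : R) : 0 < r ->
  rect_integral (fun z => (z - (x +i* y))^-1) (x - r) (x + r) (y - r) (y + r) != 0.
Proof.
move=> r0; set f := fun z : C => _.
have xx : x - r <= x + r by lra.
have yy : y - r <= y + r by lra.
have cf : continuous_on (on_rect (x - r) (x + r) (y - r) (y + r)) f.
  move=> z zr; apply/derivable_continuous/derivable_inv_sub; apply/eqP => zE.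
  by move: zr; rewrite zE; case=> [[_ []]|[_ []]] /=; lra.
have [cx cy] := continuous_sides cf.
have E1 : y - r - y = - r by ring.
have E2 : y + r - y = r by ring.
have E3 : x - r - x = - r by ring.
have E4 : x + r - x = r by ring.
have fE (u v : R) : f (u +i* v) = ((u - x) +i* (v - y))^-1 by [].
have X : r^-1 * (x + r - (x - r)) <= complex.Im
    (path_integral (x - r) (x + r) (fun t => f (t +i* (y - r)) - f (t +i* (y + r)))).
  apply: (ler_path_integral_Im xx cx) => t /andP[t1 t2].
  rewrite Im_subc !fE E1 E2 !Im_invc sqrrN mulNr opprK -mulrDl -mulr2n -mulr_natl.
  by apply: ler_inv_side => //; apply/andP; split; lra.
have Y : r^-1 * (y + r - (y - r)) <= complex.Re
    (path_integral (y - r) (y + r) (fun t => f ((x + r) +i* t) - f ((x - r) +i* t))).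
  apply: (ler_path_integral_Re yy cy) => t /andP[t1 t2].
  rewrite Re_subc !fE E3 E4 !Re_invc sqrrN mulNr opprK -mulrDl -mulr2n -mulr_natl.
  rewrite [r ^+ 2 + _]addrC.
  by apply: ler_inv_side => //; apply/andP; split; lra.
apply/eqP => /(congr1 (@complex.Im R)); rewrite /rect_integral Im_addc Im_mulc/= mul0r add0r mul1r.
have : 0 < r^-1 * (x + r - (x - r)) by rewrite mulr_gt0 ?invr_gt0//; lra.
have : 0 < r^-1 * (y + r - (y - r)) by rewrite mulr_gt0 ?invr_gt0//; lra.
move: X Y; rewrite /path_integral/=; lra.
Qed.

(** On a small square around z0, f = G1 / W1 with Cauchy integrals G1 and W1,
    both twice differentiable in w. *)
Theorem holomorphic_derivative f z0 : (\forall z \near z0, derivable f z 1) ->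
  \forall z \near z0, derivable (derive1 f) z 1.
Proof.
move=> nf; have [r1 r10 H1] := proj1 (near_complexP _ _) nf.
have cf0 := derivable_continuous (nbhs_singleton nf).
have [r2 r20 H2] := proj1 (complex_continuousP f z0) cf0 1 ltr01.
case: z0 nf H1 cf0 H2 => x y nf H1 cf0 H2.
pose z0 : C := x +i* y.
(* Points of the square are within 4 r of z0, where f is differentiable
   (radius r1) and bounded by |f z0| + 1 (radius r2). *)
pose r := Num.min r1 r2 / 8.
have r0 : 0 < r by rewrite divr_gt0// lt_min r10 r20.
have [r81 r82] : 8 * r <= r1 /\ 8 * r <= r2.
  by rewrite /r mulrC divfK//; split; rewrite ge_min lexx ?orbT.
have xx : x - r <= x + r by lra.
have yy : y - r <= y + r by lra.
pose on := on_rect (x - r) (x + r) (y - r) (y + r).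
pose inn := in_rect (x - r) (x + r) (y - r) (y + r).
have z0in : inn z0 by split => /=; apply/andP; split; lra.
have near_z0 z : inn z -> cabs (z - z0) <= 4 * r.
  by move=> zin; have := in_rect_cabs zin z0in; lra.
have df z : inn z -> derivable f z 1.
  by move=> /near_z0 zz; apply: H1; rewrite -/z0; lra.
pose M := cabs (f z0) + 1.
have fM z : on z -> cabs (f z) <= M.
  move=> /(on_rect_in xx yy)/near_z0 zz.
  have : cabs (z - z0) < r2 by lra.
  by move=> /H2; have := ler_dist_cabs (f z) (f z0); rewrite /M -/z0; lra.
have cf : continuous_on on f.
  by move=> z /(on_rect_in xx yy)/df; exact: derivable_continuous.
have c1 : continuous_on on (fun=> 1 : C) by move=> z _; exact: cst_continuous.
have M1 z : on z -> cabs (1 : C) <= 1 by rewrite cabs_real normr1.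
pose s := r / 4.
have s0 : 0 < s by rewrite divr_gt0.
have far w : cabs (w - z0) < r / 2 -> forall z, on z -> 2 * s <= cabs (z - w).
  move=> wz z zr; have : r <= cabs (z - z0).
    have := ler_Re_cabs (z - z0); have := ler_Im_cabs (z - z0).
    rewrite Re_subc Im_subc /=.
    have := ler_norm (complex.Re z - x); have := ler_norm (complex.Im z - y).
    have := ler_norm (- (complex.Re z - x)); have := ler_norm (- (complex.Im z - y)).
    rewrite !normrN; move: (`|_|) (`|_|) (cabs _) => n1 n2 n3.
    by case: zr => [[_ []]|[_ []]] ->; lra.
  have := ler_cabsD (z - w) (w - z0); rewrite addrA subrK /s; lra.
pose G1 w := rect_integral (fun z => f z * (z - w)^-1) (x - r) (x + r) (y - r) (y + r).
pose G2 w := rect_integral (fun z => f z * (z - w)^-1 ^+ 2) (x - r) (x + r) (y - r) (y + r).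
pose W1 w := rect_integral (fun z => 1 * (z - w)^-1) (x - r) (x + r) (y - r) (y + r).
pose W2 w := rect_integral (fun z => 1 * (z - w)^-1 ^+ 2) (x - r) (x + r) (y - r) (y + r).
have dG1 w (wz : cabs (w - z0) < r / 2) : derivable G1 w 1 /\ derive1 G1 w = G2 w :=
  derivative_cauchy_kernel1 xx yy s0 cf fM (far w wz).
have dW1 w (wz : cabs (w - z0) < r / 2) : derivable W1 w 1 /\ derive1 W1 w = W2 w :=
  derivative_cauchy_kernel1 xx yy s0 c1 M1 (far w wz).
have dG2 w (wz : cabs (w - z0) < r / 2) : derivable G2 w 1 :=
  derivative_cauchy_kernel2 xx yy s0 cf fM (far w wz).
have dW2 w (wz : cabs (w - z0) < r / 2) : derivable W2 w 1 :=
  derivative_cauchy_kernel2 xx yy s0 c1 M1 (far w wz).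
have mulone w : W1 w = rect_integral (fun z => (z - w)^-1) (x - r) (x + r) (y - r) (y + r).
  by apply: eq_rect_integral => // z _; rewrite mul1r.
have z00 : cabs (z0 - z0) < r / 2 by rewrite subrr cabs0 divr_gt0.
have W0 : 0 < cabs (W1 z0) by rewrite cabs_gt0 mulone rect_integral_inv_neq0.
have cW := derivable_continuous (proj1 (dW1 z0 z00)).
have [r3 r30 H3] := proj1 (complex_continuousP W1 z0) cW _ W0.
pose rho := Num.min (r / 2) r3.
have rho0 : 0 < rho by rewrite lt_min r30 divr_gt0.
have rho_r w : cabs (w - z0) < rho -> cabs (w - z0) < r / 2.
  by rewrite lt_min => /andP[].
have W1n w : cabs (w - z0) < rho -> W1 w != 0.
  rewrite lt_min => /andP[_ /H3 hw]; apply/eqP => w0.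
  by move: hw; rewrite w0 sub0r cabsN ltxx.
have inner w : cabs (w - z0) < r / 2 ->
    x - r < complex.Re w < x + r /\ y - r < complex.Im w < y + r.
  move=> wz; have := ler_Re_cabs (w - z0); have := ler_Im_cabs (w - z0).
  rewrite Re_subc Im_subc /=.
  have := ler_norm (complex.Re w - x); have := ler_norm (complex.Im w - y).
  have := ler_norm (- (complex.Re w - x)); have := ler_norm (- (complex.Im w - y)).
  rewrite !normrN; move: (`|_|) (`|_|) (cabs _) wz => n1 n2 n3 wz.
  clear -wz r0 => *; by split; apply/andP; split; lra.
have fW w : cabs (w - z0) < r / 2 -> f w * W1 w = G1 w.
  by move=> /inner[w1 w2]; rewrite mulone; exact: cauchy_formula.
have nearball (P : C -> Prop) w : cabs (w - z0) < rho ->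
    (forall v, cabs (v - z0) < rho -> P v) -> \forall v \near w, P v.
  move=> wz HP; apply/near_complexP; exists (rho - cabs (w - z0)); first by rewrite subr_gt0.
  move=> v vw; apply: HP; have := ler_cabsD (v - w) (w - z0).
  rewrite addrA subrK; lra.
have derf w : cabs (w - z0) < rho -> derive1 f w = (G2 w - f w * W2 w) * (W1 w)^-1.
  move=> wz; have wr := rho_r w wz.
  rewrite -(proj2 (dG1 w wr)) -(proj2 (dW1 w wr)).
  apply: derivative_mul_eq.
  - by apply: (nearball _ w wz) => v /rho_r /fW.
  - apply: df; have [/andP[? ?] /andP[? ?]] := inner w wr.
    by split; apply/andP; split; exact: ltW.
  - exact: (proj1 (dW1 w wr)).
  - exact: W1n.
apply/near_complexP; exists rho; first exact: rho0.
move=> w wz; have wr := rho_r w wz.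
apply: (eq_near_derivable (nearball _ w wz derf)).
apply: derivable_quotient.
- exact: dG2.
- apply: df; have [/andP[? ?] /andP[? ?]] := inner w wr.
  by split; apply/andP; split; exact: ltW.
- exact: dW2.
- exact: (proj1 (dW1 w wr)).
- exact: W1n.
Qed.

End HolomorphicDerivative.

(** * Differentials of scalar functions *)

Section DifferentialApproximation.
Context {R : realType} {V W : normedModType R}.
Implicit Types (f : V -> W) (x v : V).

Lemma littleo_approx f (D : V -> W) x :
  (f \o shift x = cst (f x) + D +o_ 0 id) <->
  forall e : R, 0 < e -> exists2 del : R, 0 < del & forall v, `|v| < del ->
    `|f (x + v) - f x - D v| <= e * `|v|.
Proof.
split=> [/eqaddoP H e e0|H].
  have /nbhs_normP[del del0 Hd] := H e e0; exists del => // v vd.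
  have /= := Hd v; rewrite sub0r normrN => /(_ vd).
  by rewrite (addrC x) -[X in `|X| <= _ -> _]/(f (v + x) - (f x + D v)) opprD addrA.
apply/eqaddoP => e /H[del del0 Hd]; apply/nbhs_normP; exists del => // v /=.
rewrite sub0r normrN => /Hd.
by rewrite (addrC x) -[X in _ -> `|X| <= _]/(f (v + x) - (f x + D v)) opprD addrA.
Qed.

Lemma differentiable_approx f (D : {linear V -> W}) x : continuous D ->
  (differentiable f x /\ 'd f x = D :> (V -> W)) <->
  forall e : R, 0 < e -> exists2 del : R, 0 < del & forall v, `|v| < del ->
    `|f (x + v) - f x - D v| <= e * `|v|.
Proof.
move=> cD; rewrite -littleo_approx; split=> [[df <-]|H]; first exact: diff_locally.
have dE := diff_unique cD H.
by split=> //; apply/diff_locallyP; rewrite dE.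
Qed.

End DifferentialApproximation.

Section ScalarDifferential.
Context {R : realType} {V : normedModType R}.
Implicit Types (h k : V -> R) (L M : V -> R) (p v : V).

(** Differentiability together with the value of the differential as a bare
    function, so that the rules of calculus compose without a linear structure
    being rebuilt at each step. *)
Definition has_diff h p L := differentiable h p /\ 'd h p = L :> (V -> R).

Lemma has_diff_eq h p L M : has_diff h p L -> L =1 M -> has_diff h p M.
Proof. by move=> H /funext <-. Qed.

Lemma near_has_diff h k p L : (\forall q \near p, h q = k q) ->
  has_diff k p L -> has_diff h p L.
Proof.
move=> /nbhs_normP[r r0 hk] [dk <-]; have cd := diff_continuous dk.
apply/(@differentiable_approx R V R h ('d k p) p cd) => e e0.
have [d d0 Hd] := proj1 (@differentiable_approx R V R k ('d k p) p cd)
  (conj dk erefl) e e0.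
exists (Num.min d r); first by rewrite lt_min d0.
move=> v; rewrite lt_min => /andP[vd vr]; rewrite !hk ?Hd//=.
  by rewrite subrr normr0.
by rewrite opprD addrA subrr sub0r normrN.
Qed.

Lemma has_diff_derive h p L v : has_diff h p L -> derivable h p v /\ 'D_v h p = L v.
Proof. by move=> [dh <-]; rewrite deriveE//; split=> //; exact: diff_derivable. Qed.

Lemma has_diff_cst c p : has_diff (cst c) p (cst 0).
Proof. by split; [exact: differentiable_cst|rewrite diff_cst]. Qed.

Lemma has_diffD h k p L M : has_diff h p L -> has_diff k p M ->
  has_diff (fun q => h q + k q) p (fun v => L v + M v).
Proof.
move=> [h1 <-] [k1 <-]; split; first exact: differentiableD.
exact: (diffD h1 k1).
Qed.

Lemma has_diffM h k p L M : has_diff h p L -> has_diff k p M ->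
  has_diff (fun q => h q * k q) p (fun v => h p * M v + k p * L v).
Proof.
move=> [h1 <-] [k1 <-]; split; first exact: differentiableM.
exact: (diffM h1 k1).
Qed.

Lemma has_diffN h p L : has_diff h p L -> has_diff (fun q => - h q) p (fun v => - L v).
Proof.
move=> [h1 <-]; split; first exact: differentiableN.
exact: (diffN h1).
Qed.

Lemma has_diff_comp (g : R -> R) dg h p L : has_diff h p L ->
  is_derive (h p) 1 g dg -> has_diff (fun q => g (h q)) p (fun v => dg * L v).
Proof.
move=> [h1 <-] [g1 g2].
have g3 : differentiable g (h p) by apply/derivable1_diffP.
split; first exact: differentiable_comp.
rewrite (diff_comp h1 g3) deriv1E// derive1E g2; apply/funext => v.
exact: mulrC.
Qed.

Lemma has_diffV h p L : h p != 0 -> has_diff h p L ->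
  has_diff (fun q => (h q)^-1) p (fun v => - L v / h p ^+ 2).
Proof.
move=> h0 H; have g : is_derive (h p) 1 (@GRing.inv R) (- (h p) ^- 2).
  split; first exact: derivableV.
  by rewrite (deriveV (f := id))// derive_id /GRing.scale/= mulr1.
by apply: has_diff_eq (has_diff_comp H g) _ => v; field.
Qed.

Lemma has_diff_linear (h : {linear V -> R}) p : continuous h -> has_diff h p h.
Proof. by move=> ch; split; [exact: linear_differentiable|exact: diff_lin]. Qed.

End ScalarDifferential.

Section Gradient.
Context {R : realType}.
Local Notation V := 'rV[R]_2.
Implicit Types (h k : V -> R) (p v : V) (a b c d : R).

Definition pairing a b v : R := a * v 0 0 + b * v 0 1.

Lemma pairing_linear a b : linear (pairing a b : V -> R).
Proof. by move=> c u v; rewrite /pairing !mxE /GRing.scale/=; ring. Qed.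

Lemma pairing_continuous a b : continuous (pairing a b).
Proof.
move=> v; apply: (@continuousD _ _ _ (fun v : V => a * v 0 0) (fun v => b * v 0 1));
  by apply: continuousM; [exact: cst_continuous|exact: coord_continuous].
Qed.

Definition has_grad h p a b := has_diff h p (pairing a b).

Lemma has_gradP h p a b : has_grad h p a b <->
  forall e, 0 < e -> exists2 del, 0 < del & forall v, `|v| < del ->
    `|h (p + v) - h p - pairing a b v| <= e * `|v|.
Proof.
pose L : {linear V -> R} := HB.pack (pairing a b)
  (GRing.isLinear.Build _ _ _ _ _ (pairing_linear a b)).
exact: (@differentiable_approx R V R h L p (@pairing_continuous a b)).
Qed.

Lemma has_grad_eq h p a b c d : has_grad h p a b -> a = c -> b = d -> has_grad h p c d.
Proof. by move=> H <- <-. Qed.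

Lemma has_grad_ext h k p a b c d : has_grad h p a b -> h =1 k -> a = c -> b = d ->
  has_grad k p c d.
Proof. by move=> H /funext <- <- <-. Qed.

Lemma has_grad_derive h p a b : has_grad h p a b ->
  [/\ derivable h p (evec 0), 'D_(evec 0) h p = a,
      derivable h p (evec 1) & 'D_(evec 1) h p = b].
Proof.
move=> H; have [d0 e0] := has_diff_derive (evec 0) H.
have [d1 e1] := has_diff_derive (evec 1) H.
have P0 : pairing a b (evec 0) = a.
  by rewrite /pairing /evec !mxE /= mulr1 mulr0 addr0.
have P1 : pairing a b (evec 1) = b.
  by rewrite /pairing /evec !mxE /= mulr1 mulr0 add0r.
exact: (And4 d0 (etrans e0 P0) d1 (etrans e1 P1)).
Qed.

Lemma has_grad_cst c p : has_grad (cst c) p 0 0.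
Proof.
by apply: has_diff_eq (has_diff_cst c p) _ => v; rewrite /pairing !mul0r addr0.
Qed.

Lemma has_gradD h k p a b c d : has_grad h p a b -> has_grad k p c d ->
  has_grad (fun q => h q + k q) p (a + c) (b + d).
Proof.
by move=> H1 H2; apply: has_diff_eq (has_diffD H1 H2) _ => v; rewrite /pairing; ring.
Qed.

Lemma has_gradM h k p a b c d : has_grad h p a b -> has_grad k p c d ->
  has_grad (fun q => h q * k q) p (h p * c + k p * a) (h p * d + k p * b).
Proof.
by move=> H1 H2; apply: has_diff_eq (has_diffM H1 H2) _ => v; rewrite /pairing; ring.
Qed.

Lemma has_gradN h p a b : has_grad h p a b ->
  has_grad (fun q => - h q) p (- a) (- b).
Proof.
by move=> H; apply: has_diff_eq (has_diffN H) _ => v; rewrite /pairing; ring.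
Qed.

Lemma has_grad_comp (g : R -> R) dg h p a b : has_grad h p a b ->
  is_derive (h p) 1 g dg -> has_grad (fun q => g (h q)) p (dg * a) (dg * b).
Proof.
move=> H1 H2; apply: has_diff_eq (has_diff_comp H1 H2) _ => v; rewrite /pairing.
by ring.
Qed.

Lemma has_gradV h p a b : h p != 0 -> has_grad h p a b ->
  has_grad (fun q => (h q)^-1) p (- a / h p ^+ 2) (- b / h p ^+ 2).
Proof.
move=> h0 H; apply: has_diff_eq (has_diffV h0 H) _ => v; rewrite /pairing.
by field.
Qed.

Lemma has_grad_coord0 p : has_grad (fun q => q 0 0) p 1 0.
Proof.
apply/has_gradP => e e0; exists 1 => // v _; rewrite mxE /pairing.
have -> : p 0 0 + v 0 0 - p 0 0 - (1 * v 0 0 + 0 * v 0 1) = 0 by ring.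
by rewrite normr0 mulr_ge0// ltW.
Qed.

Lemma has_grad_coord1 p : has_grad (fun q => q 0 1) p 0 1.
Proof.
apply/has_gradP => e e0; exists 1 => // v _; rewrite mxE /pairing.
have -> : p 0 1 + v 0 1 - p 0 1 - (0 * v 0 0 + 1 * v 0 1) = 0 by ring.
by rewrite normr0 mulr_ge0// ltW.
Qed.

End Gradient.

(** * The hyperbolic density as a solution of a closed first order system *)

Section SchwarzianField.
Variable K : numFieldType.
Implicit Types (F : K -> K) (z : K).

(** The logarithmic derivative of F'. *)
Definition pre_schwarzian F z : K := fderiv (fderiv F) z / fderiv F z.

Lemma fderivE F : fderiv F = derive1 F.
Proof. by []. Qed.

Lemma derivable_pre_schwarzian F z : derivable (fderiv F) z 1 ->
  derivable (fderiv (fderiv F)) z 1 -> fderiv F z != 0 ->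
  derivable (pre_schwarzian F) z 1.
Proof. by move=> d1 d2 n0; apply: derivableM => //; exact: derivableV. Qed.

Lemma derivable_schwarzian F z : derivable (pre_schwarzian F) z 1 ->
  derivable (derive1 (pre_schwarzian F)) z 1 -> derivable (schwarzian F) z 1.
Proof.
move=> d1 d2; apply: derivableB => //; apply: derivableM; first exact: derivable_cst.
have -> : (fun z => pre_schwarzian F z ^+ 2) = pre_schwarzian F * pre_schwarzian F by [].
exact: derivableM.
Qed.

End SchwarzianField.

Section HolomorphicGradient.
Context {R : realType}.
Local Notation C := (Num.NumField.sort (complex_complex__canonical__Num_NumField R)).
Local Notation V := 'rV[R]_2.
Implicit Types (F : C -> C) (z l : C) (p v : V).

Lemma of_coordsD p v : of_coords (p + v) = of_coords p + of_coords v.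
Proof. by rewrite /of_coords !mxE. Qed.

Lemma ler_coord v j : `|v 0 j| <= `|v|.
Proof.
rewrite [leRHS]mx_normrE.
exact: (le_bigmax _ (fun ij : 'I_1 * 'I_2 => `|v ij.1 ij.2|) (0, j)).
Qed.

Lemma ler_cabs_coords v : cabs (of_coords v) <= 2 * `|v|.
Proof.
rewrite (le_trans (ler_cabs_ReIm _))//= mulr_natl mulr2n.
by apply: lerD; exact: ler_coord.
Qed.

(** The Cauchy-Riemann equations, with total differentiability. *)
Lemma holomorphic_has_grad F z l p : derivable F z 1 -> derive1 F z = l ->
  of_coords p = z ->
  has_grad (fun q => complex.Re (F (of_coords q))) p (complex.Re l) (- complex.Im l) /\
  has_grad (fun q => complex.Im (F (of_coords q))) p (complex.Im l) (complex.Re l).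
Proof.
move=> dF dl pz.
suff H e : 0 < e -> exists2 del, 0 < del & forall v, `|v| < del ->
    cabs (F (of_coords (p + v)) - F (of_coords p) - l * of_coords v) <= e * `|v|.
  split; apply/has_gradP => e /H[del d0 Hd]; exists del => // v /Hd.
    apply: le_trans; rewrite -Re_subc; apply: le_trans (ler_Re_cabs _).
    by rewrite !Re_subc Re_mulc /pairing /= mulNr.
  apply: le_trans; rewrite -Im_subc; apply: le_trans (ler_Im_cabs _).
  by rewrite !Im_subc Im_mulc /pairing /= [X in _ - X]addrC.
move=> e0; have e2 : 0 < e / 2 by rewrite divr_gt0.
have [del d0 Hd] := proj1 (complex_derivativeP F z l) (conj dF dl) _ e2.
exists (del / 2); first by rewrite divr_gt0.
move=> v vd; have v2 := ler_cabs_coords v.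
have vl : cabs (of_coords v) < del by lra.
rewrite of_coordsD pz (le_trans (Hd _ vl))//.
have -> : e * `|v| = e / 2 * (2 * `|v|) by field.
by apply: ler_wpM2l => //; exact: ltW.
Qed.

End HolomorphicGradient.

(* Here f, g, q stand for F, F', F'' / F' in real and imaginary parts, lam for
   the density 2 |F'| / (1 - |F|^2), and A, B for the partial derivatives of its
   logarithm, which are the real part and minus the imaginary part of
   q + 2 F' conj(F) / (1 - |F|^2). The gradients of F, F' are those of
   holomorphic functions, and that of q is S + q^2 / 2 by definition of S. *)
Section LiouvilleSystem.
Context {R : realType}.
Local Notation V := 'rV[R]_2.
Variables (f1 f2 g1 g2 q1 q2 : V -> R) (p : V) (Sr Si : R).
Let D (v : V) : R := 1 - (f1 v * f1 v + f2 v * f2 v).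
Let lam (v : V) : R := 2 * Num.sqrt (g1 v * g1 v + g2 v * g2 v) * (D v)^-1.
Let A (v : V) : R := q1 v + 2 * (g1 v * f1 v + g2 v * f2 v) * (D v)^-1.
Let B (v : V) : R := - q2 v + - (2 * (g2 v * f1 v + - (g1 v * f2 v)) * (D v)^-1).
Hypotheses (D0 : 0 < D p) (g0 : 0 < g1 p * g1 p + g2 p * g2 p).
Hypothesis f1_grad : has_grad f1 p (g1 p) (- g2 p).
Hypothesis f2_grad : has_grad f2 p (g2 p) (g1 p).
Hypothesis g1_grad : has_grad g1 p (q1 p * g1 p - q2 p * g2 p)
  (- (q1 p * g2 p + q2 p * g1 p)).
Hypothesis g2_grad : has_grad g2 p (q1 p * g2 p + q2 p * g1 p)
  (q1 p * g1 p - q2 p * g2 p).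
Hypothesis q1_grad : has_grad q1 p (Sr + (q1 p ^+ 2 - q2 p ^+ 2) / 2)
  (- (Si + q1 p * q2 p)).
Hypothesis q2_grad : has_grad q2 p (Si + q1 p * q2 p)
  (Sr + (q1 p ^+ 2 - q2 p ^+ 2) / 2).

Let D_grad : has_grad D p (- (f1 p * g1 p + f1 p * g1 p + (f2 p * g2 p + f2 p * g2 p)))
  (- (f1 p * - g2 p + f1 p * - g2 p + (f2 p * g1 p + f2 p * g1 p))).
Proof.
have H := has_gradD (has_grad_cst 1 p)
  (has_gradN (has_gradD (has_gradM f1_grad f1_grad) (has_gradM f2_grad f2_grad))).
by apply: has_grad_eq H _ _; rewrite add0r.
Qed.

Let Dn : D p != 0. Proof. by rewrite gt_eqF. Qed.

Let Dinv_grad := has_gradV Dn D_grad.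

(** A and B are the partial derivatives of log lam. *)
Lemma density_system : has_grad lam p (lam p * A p) (lam p * B p).
Proof.
have sq : is_derive (g1 p * g1 p + g2 p * g2 p) 1 Num.sqrt
   (2 * Num.sqrt (g1 p * g1 p + g2 p * g2 p))^-1 by exact: is_derive1_sqrt.
have G := has_gradD (has_gradM g1_grad g1_grad) (has_gradM g2_grad g2_grad).
have s2 := sqr_sqrtr (ltW g0); have s0 : 0 < Num.sqrt (g1 p * g1 p + g2 p * g2 p).
  by rewrite sqrtr_gt0.
have Gs := has_grad_comp G sq.
set s := Num.sqrt (g1 p * g1 p + g2 p * g2 p) in s2 s0 Gs.
have sn : s != 0 by rewrite gt_eqF.
have {}Gs : has_grad (fun v => Num.sqrt (g1 v * g1 v + g2 v * g2 v)) p (s * q1 p) (s * - q2 p).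
  apply: has_grad_eq Gs _ _; apply: (mulfI sn); rewrite [RHS]mulrA -expr2 s2; by field.
have H := has_gradM (has_gradM (has_grad_cst 2 p) Gs) Dinv_grad.
move: Dn H; rewrite /lam /A /B -/s /D /cst => Dn' H.
by apply: has_grad_eq H _ _; field.
Qed.

(** The sum of the second partial derivatives of log lam is lam^2 and the rest
    is 2 (u_zz - u_z^2) = S: the derivatives of A and B involve no new unknown
    except S. *)
Lemma log_density_x_system : has_grad A p ((lam p ^+ 2 + A p ^+ 2 - B p ^+ 2) / 2 + Sr)
  (A p * B p - Si).
Proof.
have H := has_gradD q1_grad (has_gradM (has_gradM (has_grad_cst 2 p)
  (has_gradD (has_gradM g1_grad f1_grad) (has_gradM g2_grad f2_grad))) Dinv_grad).
have lam2 : lam p ^+ 2 = 4 * (g1 p * g1 p + g2 p * g2 p) / (D p) ^+ 2.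
  by rewrite /lam !exprMn exprVn sqr_sqrtr ?ltW//; ring.
rewrite lam2; move: Dn H; rewrite /A /B /D /cst => Dn' H.
apply: has_grad_eq H _ _.
  by field.
by field.
Qed.

Lemma log_density_y_system : has_grad B p (A p * B p - Si)
  ((lam p ^+ 2 - A p ^+ 2 + B p ^+ 2) / 2 - Sr).
Proof.
have H := has_gradD (has_gradN q2_grad) (has_gradN (has_gradM (has_gradM (has_grad_cst 2 p)
  (has_gradD (has_gradM g2_grad f1_grad) (has_gradN (has_gradM g1_grad f2_grad)))) Dinv_grad)).
have lam2 : lam p ^+ 2 = 4 * (g1 p * g1 p + g2 p * g2 p) / (D p) ^+ 2.
  by rewrite /lam !exprMn exprVn sqr_sqrtr ?ltW//; ring.
rewrite lam2; move: Dn H; rewrite /A /B /D /cst => Dn' H.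
apply: has_grad_eq H _ _.
  by field.
by field.
Qed.

End LiouvilleSystem.

Section HyperbolicDensity.
Context {R : realType}.
Local Notation C := (Num.NumField.sort (complex_complex__canonical__Num_NumField R)).
Local Notation V := 'rV[R]_2.
Implicit Types (F : C -> C) (z : C) (p v : V).

(** The factor of |dz| in the pull-back by F of the hyperbolic metric of the
    disk. *)
Definition density F z : R := 2 * cabs (fderiv F z) / (1 - cabs (F z) ^+ 2).

(** This and the next definition are the partial derivatives of the logarithm
    of [density] in closed form; see [density_grad]. *)
Definition log_density_x F z : R :=
  complex.Re (pre_schwarzian F z) +
  2 * (complex.Re (fderiv F z) * complex.Re (F z) +
       complex.Im (fderiv F z) * complex.Im (F z)) / (1 - cabs (F z) ^+ 2).

Definition log_density_y F z : R :=
  - complex.Im (pre_schwarzian F z) -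
  2 * (complex.Im (fderiv F z) * complex.Re (F z) -
       complex.Re (fderiv F z) * complex.Im (F z)) / (1 - cabs (F z) ^+ 2).

Definition regular_at F z :=
  [/\ derivable F z 1, derivable (fderiv F) z 1, fderiv F z != 0, cabs (F z) < 1 &
    derivable (pre_schwarzian F) z 1 /\ derivable (schwarzian F) z 1].

(** Three applications of [holomorphic_derivative], to F, F' and F'' / F';
    together with F'' / F' the Schwarzian of F is holomorphic. *)
Lemma near_regular F z0 :
  (\forall z \near z0, [/\ derivable F z 1, fderiv F z != 0 & cabs (F z) < 1]) ->
  \forall z \near z0, regular_at F z.
Proof.
move=> H.
have n0 : \forall z \near z0, derivable F z 1 by apply: filterS H => z [].
have n1 := holomorphic_derivative n0; rewrite -fderivE in n1.
have n2 := holomorphic_derivative n1; rewrite -fderivE in n2.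
have nq : \forall z \near z0, derivable (pre_schwarzian F) z 1.
  apply: filterS3 H n1 n2 => z [_ h2 _] h4 h5.
  exact: (derivable_pre_schwarzian h4 h5 h2).
have nq' := holomorphic_derivative nq.
have nS : \forall z \near z0, derivable (schwarzian F) z 1.
  apply: filterS2 nq nq' => z h1 h2; exact: (derivable_schwarzian h1 h2).
have nqS : \forall z \near z0, derivable (pre_schwarzian F) z 1 /\ derivable (schwarzian F) z 1.
  by apply: filterS2 nq nS => z h1 h2; exact: (conj h1 h2).
apply: filterS3 H n1 nqS => z [h1 h2 h3] h4 h5.
exact: (And5 h1 h4 h2 h3 h5).
Qed.

Section AtRegularPoint.
Variables (F : C -> C) (z : C) (p : V).
Hypotheses (Fz : regular_at F z) (pz : of_coords p = z).

Let lam := density F z.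
Let A := log_density_x F z.
Let B := log_density_y F z.
Let Sr := complex.Re (schwarzian F z).
Let Si := complex.Im (schwarzian F z).

Lemma density_gt0 : 0 < lam.
Proof.
have [_ _ F1 F0 _] := Fz; rewrite /lam /density divr_gt0//.
  by rewrite mulr_gt0// cabs_gt0.
by rewrite subr_gt0 expr_lt1// cabs_ge0.
Qed.

Let f1 (v : V) := complex.Re (F (of_coords v)).
Let f2 (v : V) := complex.Im (F (of_coords v)).
Let g1 (v : V) := complex.Re (fderiv F (of_coords v)).
Let g2 (v : V) := complex.Im (fderiv F (of_coords v)).
Let q1 (v : V) := complex.Re (pre_schwarzian F (of_coords v)).
Let q2 (v : V) := complex.Im (pre_schwarzian F (of_coords v)).

Let D0 : 0 < 1 - (f1 p * f1 p + f2 p * f2 p).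
Proof.
have [_ _ _ F0 _] := Fz; rewrite /f1 /f2 pz -!expr2 -cabs_sqr.
by rewrite subr_gt0 expr_lt1// cabs_ge0.
Qed.

Let g0 : 0 < g1 p * g1 p + g2 p * g2 p.
Proof.
have [_ _ F1 _ _] := Fz; rewrite /g1 /g2 pz -!expr2 -cabs_sqr.
by rewrite exprn_gt0// cabs_gt0.
Qed.

Let derive1_fderiv : derive1 (fderiv F) z = pre_schwarzian F z * fderiv F z.
Proof. by have [_ _ F1 _ _] := Fz; rewrite /pre_schwarzian -mulrA mulVf// mulr1. Qed.

Let derive1_pre_schwarzian : derive1 (pre_schwarzian F) z =
  schwarzian F z + (2^-1)%:C * (pre_schwarzian F z * pre_schwarzian F z).
Proof.
have -> : (2^-1)%:C = 2^-1 :> C by rewrite fmorphV rmorph_nat.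
by rewrite -expr2 /schwarzian subrK.
Qed.

Let f_grads := let: And5 d _ _ _ _ := Fz in holomorphic_has_grad d erefl pz.
Let g_grads := let: And5 _ d _ _ _ := Fz in holomorphic_has_grad d derive1_fderiv pz.
Let q_grads := let: And5 _ _ _ _ (conj d _) := Fz in
  holomorphic_has_grad d derive1_pre_schwarzian pz.

Let f1_grad : has_grad f1 p (g1 p) (- g2 p).
Proof. by rewrite /g1 /g2 pz; exact: (proj1 f_grads). Qed.

Let f2_grad : has_grad f2 p (g2 p) (g1 p).
Proof. by rewrite /g1 /g2 pz; exact: (proj2 f_grads). Qed.

Let g1_grad : has_grad g1 p (q1 p * g1 p - q2 p * g2 p)
  (- (q1 p * g2 p + q2 p * g1 p)).
Proof.
rewrite /q1 /q2 /g1 /g2 pz; apply: has_grad_eq (proj1 g_grads) _ _.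
  by rewrite Re_mulc.
by rewrite Im_mulc.
Qed.

Let g2_grad : has_grad g2 p (q1 p * g2 p + q2 p * g1 p)
  (q1 p * g1 p - q2 p * g2 p).
Proof.
rewrite /q1 /q2 /g1 /g2 pz; apply: has_grad_eq (proj2 g_grads) _ _.
  by rewrite Im_mulc.
by rewrite Re_mulc.
Qed.

Let q_ReIm : complex.Re (schwarzian F z + (2^-1)%:C * (pre_schwarzian F z * pre_schwarzian F z)) =
   Sr + (q1 p ^+ 2 - q2 p ^+ 2) / 2 /\
  complex.Im (schwarzian F z + (2^-1)%:C * (pre_schwarzian F z * pre_schwarzian F z)) =
   Si + q1 p * q2 p.
Proof.
rewrite /q1 /q2 pz /Sr /Si.
move: (schwarzian F z) (pre_schwarzian F z) => [s1 s2] [w1 w2] /=.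
by split; field.
Qed.

Let q1_grad : has_grad q1 p (Sr + (q1 p ^+ 2 - q2 p ^+ 2) / 2) (- (Si + q1 p * q2 p)).
Proof.
by apply: has_grad_eq (proj1 q_grads) _ _; rewrite ?(proj1 q_ReIm) ?(proj2 q_ReIm).
Qed.

Let q2_grad : has_grad q2 p (Si + q1 p * q2 p) (Sr + (q1 p ^+ 2 - q2 p ^+ 2) / 2).
Proof.
by apply: has_grad_eq (proj2 q_grads) _ _; rewrite ?(proj1 q_ReIm) ?(proj2 q_ReIm).
Qed.

Let densityE : (fun v => density F (of_coords v)) = (fun v =>
  2 * Num.sqrt (g1 v * g1 v + g2 v * g2 v) * (1 - (f1 v * f1 v + f2 v * f2 v))^-1).
Proof. by apply/funext => v; rewrite /density cabsE cabs_sqr -!expr2. Qed.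

Let log_density_xE : (fun v => log_density_x F (of_coords v)) = (fun v =>
  q1 v + 2 * (g1 v * f1 v + g2 v * f2 v) * (1 - (f1 v * f1 v + f2 v * f2 v))^-1).
Proof. by apply/funext => v; rewrite /log_density_x cabs_sqr -!expr2. Qed.

Let log_density_yE : (fun v => log_density_y F (of_coords v)) = (fun v =>
  - q2 v + - (2 * (g2 v * f1 v + - (g1 v * f2 v)) *
     (1 - (f1 v * f1 v + f2 v * f2 v))^-1)).
Proof. by apply/funext => v; rewrite /log_density_y cabs_sqr -!expr2. Qed.

Let lamE : lam =
  2 * Num.sqrt (g1 p * g1 p + g2 p * g2 p) * (1 - (f1 p * f1 p + f2 p * f2 p))^-1.
Proof. by have := congr1 (@^~ p) densityE; rewrite /= pz. Qed.

Let AE : A =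
  q1 p + 2 * (g1 p * f1 p + g2 p * f2 p) * (1 - (f1 p * f1 p + f2 p * f2 p))^-1.
Proof. by have := congr1 (@^~ p) log_density_xE; rewrite /= pz. Qed.

Let BE : B = - q2 p + - (2 * (g2 p * f1 p + - (g1 p * f2 p)) *
     (1 - (f1 p * f1 p + f2 p * f2 p))^-1).
Proof. by have := congr1 (@^~ p) log_density_yE; rewrite /= pz. Qed.

Lemma density_grad : has_grad (fun v => density F (of_coords v)) p (lam * A) (lam * B).
Proof.
rewrite densityE lamE AE BE.
exact: (density_system D0 g0 f1_grad f2_grad g1_grad g2_grad).
Qed.

Lemma log_density_x_grad : has_grad (fun v => log_density_x F (of_coords v)) p
  ((lam ^+ 2 + A ^+ 2 - B ^+ 2) / 2 + Sr) (A * B - Si).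
Proof.
rewrite log_density_xE lamE AE BE.
exact: (log_density_x_system D0 g0 f1_grad f2_grad g1_grad g2_grad q1_grad).
Qed.

Lemma log_density_y_grad : has_grad (fun v => log_density_y F (of_coords v)) p
  (A * B - Si) ((lam ^+ 2 - A ^+ 2 + B ^+ 2) / 2 - Sr).
Proof.
rewrite log_density_yE lamE AE BE.
exact: (log_density_y_system D0 g0 f1_grad f2_grad g1_grad g2_grad q2_grad).
Qed.

Lemma schwarzian_grads :
  (exists a b, has_grad (fun v => complex.Re (schwarzian F (of_coords v))) p a b) /\
  (exists a b, has_grad (fun v => complex.Im (schwarzian F (of_coords v))) p a b).
Proof.
have [_ _ _ _ [_ d]] := Fz; have [h1 h2] := holomorphic_has_grad d erefl pz.
by split; do 2 eexists; [exact: h1|exact: h2].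
Qed.

End AtRegularPoint.
End HyperbolicDensity.

(** * Orthonormal frames and the Levi-Civita connection of the ball *)

Section Frames.
Context {R : realType}.
Implicit Types (E : 'M[R]_3) (u v w : 'rV[R]_3).

Lemma ord2_case (i : 'I_2) : i = 0 \/ i = 1.
Proof.
by case: i => [[|[|]]] // ?; [left|right]; exact: val_inj.
Qed.

Lemma ord3_case (k : 'I_3) : [\/ k = 0, k = 1 | k = 2].
Proof.
by case: k => [[|[|[|]]]] // ?; [apply: Or31|apply: Or32|apply: Or33];
  exact: val_inj.
Qed.

Lemma sum_ord3 (W : zmodType) (F : 'I_3 -> W) : \sum_(i < 3) F i = F 0 + F 1 + F 2.
Proof.
rewrite !big_ord_recl big_ord0 addr0 addrA; congr (_ + F _ + F _); exact: val_inj.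
Qed.

Lemma dotE3 u v : dot u v = u 0 0 * v 0 0 + u 0 1 * v 0 1 + u 0 2 * v 0 2.
Proof. exact: sum_ord3. Qed.

Lemma dotC u v : dot u v = dot v u.
Proof. by rewrite !dotE3; ring. Qed.

Lemma dotDl u v w : dot (u + v) w = dot u w + dot v w.
Proof. by rewrite !dotE3 !mxE; ring. Qed.

Lemma dotZl (a : R) u v : dot (a *: u) v = a * dot u v.
Proof. by rewrite !dotE3 !mxE; ring. Qed.

Lemma dotDr u v w : dot w (u + v) = dot w u + dot w v.
Proof. by rewrite dotC dotDl !(dotC _ w). Qed.

Lemma dotZr (a : R) u v : dot v (a *: u) = a * dot v u.
Proof. by rewrite dotC dotZl dotC. Qed.

Lemma dotNl u v : dot (- u) v = - dot u v.
Proof. by rewrite -scaleN1r dotZl mulN1r. Qed.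

Lemma dot_evec v i : dot v (evec i) = v 0 i.
Proof.
rewrite /dot (bigD1 i)//= big1 ?addr0; last first.
  by move=> j ji; rewrite mxE eqxx (negPf ji) mulr0.
by rewrite mxE !eqxx mulr1.
Qed.

Definition in_frame E (a b c : R) : 'rV[R]_3 :=
  a *: row 0 E + b *: row 1 E + c *: row 2 E.

Lemma in_frameD E a b c a' b' c' :
  in_frame E a b c + in_frame E a' b' c' = in_frame E (a + a') (b + b') (c + c').
Proof. by rewrite /in_frame !scalerDl addrACA (addrACA (a *: _)). Qed.

Lemma in_frameZ E k a b c : k *: in_frame E a b c = in_frame E (k * a) (k * b) (k * c).
Proof. by rewrite /in_frame !scalerDr !scalerA. Qed.

Section Orthonormal.
Variable E : 'M[R]_3.
Hypothesis EE : E *m E^T = 1%:M.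

Lemma dot_row i j : dot (row i E) (row j E) = (i == j)%:R.
Proof.
move/matrixP/(_ i j): EE; rewrite !mxE => <-.
by apply: eq_bigr => k _; rewrite !mxE.
Qed.

Lemma dot_in_frame a b c a' b' c' :
  dot (in_frame E a b c) (in_frame E a' b' c') = a * a' + b * b' + c * c'.
Proof.
rewrite /in_frame !(dotDl, dotDr, dotZl, dotZr) !dot_row /=; ring.
Qed.

Lemma dot_in_frame_row a b c :
  [/\ dot (in_frame E a b c) (row 0 E) = a, dot (in_frame E a b c) (row 1 E) = b &
      dot (in_frame E a b c) (row 2 E) = c].
Proof.
by split; rewrite /in_frame !(dotDl, dotZl) !dot_row /=; ring.
Qed.

Lemma in_frame_dot v :
  v = in_frame E (dot v (row 0 E)) (dot v (row 1 E)) (dot v (row 2 E)).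
Proof.
have -> : in_frame E (dot v (row 0 E)) (dot v (row 1 E)) (dot v (row 2 E)) =
   \sum_i dot v (row i E) *: row i E by rewrite sum_ord3.
have EE' : E^T *m E = 1%:M by exact: mulmx1C.
rewrite -[LHS]mulmx1 -EE' mulmxA mulmx_sum_row; apply: eq_bigr => i _.
by congr (_ *: _); rewrite mxE; apply: eq_bigr => k _; rewrite !mxE.
Qed.

End Orthonormal.

Lemma dot_linear u : linear (dot u : 'rV[R]_3 -> R).
Proof. by move=> a v w; rewrite dotDr dotZr. Qed.

Lemma dot_continuous u : continuous (dot u).
Proof.
have -> : dot u = (fun v => u 0 0 * v 0 0 + u 0 1 * v 0 1 + u 0 2 * v 0 2).
  by apply/funext => v; rewrite dotE3.
have c (i : 'I_3) : continuous (fun v : 'rV[R]_3 => u 0 i * v 0 i).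
  by move=> v; apply: continuousM; [exact: cst_continuous|exact: coord_continuous].
move=> v; apply: (@continuousD _ _ _ (fun v : 'rV[R]_3 => u 0 0 * v 0 0 + u 0 1 * v 0 1)).
  by apply: (@continuousD _ _ _ (fun v : 'rV[R]_3 => u 0 0 * v 0 0)); exact: c.
exact: c.
Qed.

Lemma has_diff_dot u p : has_diff (dot u) p (dot u).
Proof.
pose L : {linear 'rV[R]_3 -> R} := HB.pack (dot u)
  (GRing.isLinear.Build _ _ _ _ _ (dot_linear u)).
exact: (@has_diff_linear _ _ L p (@dot_continuous u)).
Qed.

Lemma has_diff_sqr_norm p : has_diff (fun x => dot x x) p (fun v => 2 * dot p v).
Proof.
have c i : has_diff (fun x : 'rV[R]_3 => x 0 i) p (fun v => v 0 i).
  have H := has_diff_dot (evec i) p.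
  have E : dot (evec i) = (fun x : 'rV[R]_3 => x 0 i).
    by apply/funext => x; rewrite dotC dot_evec.
  by rewrite E in H.
have -> : (fun x : 'rV[R]_3 => dot x x) =
    (fun x => x 0 0 * x 0 0 + x 0 1 * x 0 1 + x 0 2 * x 0 2).
  by apply/funext => x; rewrite dotE3.
apply: has_diff_eq (has_diffD (has_diffD (has_diffM (c 0) (c 0)) (has_diffM (c 1) (c 1)))
  (has_diffM (c 2) (c 2))) _ => v.
by rewrite dotE3; ring.
Qed.

End Frames.

Section HyperbolicChristoffel.
Context {R : realType}.
Implicit Types (x u v : 'rV[R]_3).

Lemma derive_hyp_metric x (l i j : 'I_3) : 1 - dot x x != 0 ->
  'D_(evec l) (fun y => hyp_metric y i j) x =
  (i == j)%:R * (16 * x 0 l / (1 - dot x x) ^+ 3).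
Proof.
move=> x0; rewrite /hyp_metric.
have -> : (fun y : 'rV[R]_3 => (4 / (1 - dot y y) ^+ 2)%:M i j) =
  (fun y => cst ((i == j)%:R * 4) y * (((1 + - dot y y) * (1 + - dot y y))^-1)).
  by apply/funext => y; rewrite mxE -expr2 /cst; case: eqP => _ /=; rewrite ?mulr1n ?mulr0n; ring.
have H1 := has_diffD (has_diff_cst 1 x) (has_diffN (has_diff_sqr_norm x)).
have H2 := has_diffM H1 H1.
have n2 : (1 - dot x x) * (1 - dot x x) != 0 by rewrite mulf_neq0.
have H3 := has_diffM (has_diff_cst ((i == j)%:R * 4) x) (has_diffV (h := fun q => (cst 1 q - dot q q) * (cst 1 q - dot q q)) n2 H2).
have [_ ->] := has_diff_derive (evec l) H3.
by rewrite dot_evec /cst; field.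
Qed.

Lemma christoffel_hyp x (i j k : 'I_3) : 1 - dot x x != 0 ->
  christoffel hyp_metric x i j k = 2 / (1 - dot x x) *
    ((k == j)%:R * x 0 i + (k == i)%:R * x 0 j - (i == j)%:R * x 0 k).
Proof.
move=> x0; rewrite /christoffel (bigD1 k)//= big1 ?addr0; last first.
  move=> l lk; rewrite /hyp_metric invmx_scalar mxE eq_sym (negPf lk) mulr0n.
  by rewrite mul0r.
rewrite !derive_hyp_metric// /hyp_metric invmx_scalar mxE eqxx mulr1n.
rewrite (eq_sym j k) (eq_sym i k).
by field.
Qed.

(** The connection of a conformally flat metric phi^2 |dx|^2 differs from the
    flat one by the derivative of log phi, here 2 x / (1 - |x|^2). *)
Lemma christoffel_hyp_sum x u v : 1 - dot x x != 0 ->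
  \row_k \sum_a \sum_b christoffel hyp_metric x a b k * u 0 a * v 0 b =
  (2 / (1 - dot x x)) *: (dot x u *: v + dot x v *: u - dot u v *: x).
Proof.
move=> x0; apply/rowP => k; rewrite !mxE.
rewrite !sum_ord3 !christoffel_hyp// !dotE3.
by case: (ord3_case k) => -> /=; ring.
Qed.

Lemma metric_dot_hyp x u v : metric_dot hyp_metric x u v = 4 / (1 - dot x x) ^+ 2 * dot u v.
Proof.
rewrite /metric_dot /hyp_metric mul_mx_scalar -scalemxAl mxE; congr (_ * _).
by rewrite mxE; apply: eq_bigr => i _; rewrite mxE.
Qed.

End HyperbolicChristoffel.

(** * Stereographic projection and the gradient of the density *)

Section Stereographic.
Context {R : realType}.
Local Notation V := 'rV[R]_2.
Implicit Types (th x v : 'rV[R]_3) (z : R[i]) (p : V).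
Variable E : 'M[R]_3.
Hypothesis EE : E *m E^T = 1%:M.

Definition sqnorm z : R := complex.Re z ^+ 2 + complex.Im z ^+ 2.

Lemma sqnorm1_gt0 z : 0 < 1 + sqnorm z.
Proof. by rewrite ltr_pwDl// addr_ge0// sqr_ge0. Qed.

Lemma gammaE z : gamma z = 2 / (1 + sqnorm z).
Proof. by rewrite /gamma cabs_sqr. Qed.

Lemma gamma_gt0 z : 0 < gamma z.
Proof. by rewrite gammaE divr_gt0// sqnorm1_gt0. Qed.

Lemma stereo_invE z : stereo_inv E z =
  in_frame E (gamma z * complex.Re z) (gamma z * complex.Im z) (1 - gamma z).
Proof.
rewrite /stereo_inv -[X in _ *: X]/(in_frame E _ _ _) in_frameZ cabs_sqr -/(sqnorm z).
have n0 : 1 + sqnorm z != 0 by rewrite gt_eqF// sqnorm1_gt0.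
by congr in_frame; rewrite gammaE; field.
Qed.

Lemma dot_stereo_inv z : dot (stereo_inv E z) (stereo_inv E z) = 1.
Proof.
rewrite stereo_invE dot_in_frame// gammaE.
have := sqnorm1_gt0 z; rewrite /sqnorm => /gt_eqF/negbT n0.
by field.
Qed.

Lemma one_sub_dot_stereo_inv_pole z : 1 - dot (stereo_inv E z) (pole E) = gamma z.
Proof.
rewrite stereo_invE /pole; have [_ _ ->] := dot_in_frame_row EE (gamma z * complex.Re z)
  (gamma z * complex.Im z) (1 - gamma z); ring.
Qed.

Lemma stereoK z : stereo E (stereo_inv E z) = z.
Proof.
have g0 := lt0r_neq0 (gamma_gt0 z).
rewrite /stereo one_sub_dot_stereo_inv_pole stereo_invE.
have [-> -> _] := dot_in_frame_row EE (gamma z * complex.Re z)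
  (gamma z * complex.Im z) (1 - gamma z).
by rewrite ![gamma z * _]mulrC !mulfK//; case: z g0.
Qed.

Lemma stereo_inv_neq_pole z : stereo_inv E z <> pole E.
Proof.
move=> zE; have := one_sub_dot_stereo_inv_pole z; have := gamma_gt0 z.
by rewrite zE /pole dot_row//= subrr => /[swap] <-; rewrite ltxx.
Qed.

Lemma one_sub_dot_pole_neq0 th : dot th th = 1 -> th <> pole E -> 1 - dot th (pole E) != 0.
Proof.
move=> th1 thp; apply/eqP => t2; apply: thp.
have := in_frame_dot EE th => thE; move: th1; rewrite thE dot_in_frame//.
have e2 : dot th (row 2 E) = 1 by move: t2; rewrite /pole; lra.
rewrite e2; move: (dot th (row 0 E)) (dot th (row 1 E)) => a b ab.
have a0 : a = 0 by nra.
have b0 : b = 0 by nra.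
by rewrite a0 b0 /in_frame !scale0r !add0r scale1r.
Qed.

Lemma stereo_invK th : dot th th = 1 -> th <> pole E -> stereo_inv E (stereo E th) = th.
Proof.
move=> th1 thp; have := one_sub_dot_pole_neq0 th1 thp; rewrite /pole.
have abc : dot th (row 0 E) * dot th (row 0 E) + dot th (row 1 E) * dot th (row 1 E) +
    dot th (row 2 E) * dot th (row 2 E) = 1.
  by rewrite -(dot_in_frame EE) -!in_frame_dot.
rewrite [RHS](in_frame_dot EE th) stereo_invE gammaE /sqnorm /stereo /pole /=.
move: (dot th (row 0 E)) (dot th (row 1 E)) (dot th (row 2 E)) abc => a b c abc c1.
have ab : a ^+ 2 + b ^+ 2 = (1 - c) * (1 + c) by rewrite -!expr2 in abc; lra.
have nn : 1 + ((a / (1 - c)) ^+ 2 + (b / (1 - c)) ^+ 2) = 2 / (1 - c).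
  by rewrite !expr_div_n -mulrDl ab; field.
by rewrite nn; congr in_frame; field; rewrite c1.
Qed.

Lemma of_coordsK z : of_coords (coords z) = z.
Proof. by rewrite /of_coords !mxE /=; case: z. Qed.

Lemma coordsK p : coords (of_coords p) = p.
Proof.
apply/rowP => i; rewrite mxE /=.
by case: i => [[|[|]]] // h; rewrite /of_coords /=; congr (p 0 _); exact: val_inj.
Qed.

(** The stereographic coordinates of x / |x|, with numerator and denominator
    multiplied by |x|. *)
Definition stereo_coord (i : 'I_3) x : R := dot x (row i E) / (enorm x - dot x (pole E)).

Lemma has_diff_enorm th : dot th th = 1 -> has_diff (@enorm R 3) th (dot th).
Proof.
move=> th1; have p0 : 0 < dot th th by rewrite th1.
have H := has_diff_comp (has_diff_sqr_norm th) (is_derive1_sqrt p0).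
by apply: has_diff_eq H _ => v; rewrite th1 sqrtr1; field.
Qed.

Lemma enorm1 th : dot th th = 1 -> enorm th = 1.
Proof. by rewrite /enorm => ->; rewrite sqrtr1. Qed.

Lemma has_diff_dotr u x : has_diff (fun x => dot x u) x (fun v => dot v u).
Proof.
have -> : (fun x => dot x u) = dot u by apply/funext => y; exact: dotC.
exact: has_diff_dot.
Qed.

Lemma has_diff_stereo_den th : dot th th = 1 ->
  has_diff (fun x => enorm x + - dot x (pole E)) th (fun v => dot th v + - dot v (pole E)).
Proof.
move=> th1; exact: (has_diffD (has_diff_enorm th1) (has_diffN (has_diff_dotr (pole E) th))).
Qed.

Lemma has_diff_stereo_coord i z : let th := stereo_inv E z in
  has_diff (stereo_coord i) th (dot ((gamma z)^-1 *: row i E -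
      (dot th (row i E) / gamma z ^+ 2) *: (th - pole E))).
Proof.
move=> th; have th1 : dot th th = 1 := dot_stereo_inv z.
have dE : enorm th + - dot th (pole E) = gamma z.
  by rewrite enorm1// one_sub_dot_stereo_inv_pole.
have g0 := lt0r_neq0 (gamma_gt0 z).
have n0 : enorm th + - dot th (pole E) != 0 by rewrite dE.
clearbody th.
have H := has_diffM (has_diff_dotr (row i E) th)
  (has_diffV (h := fun x => enorm x + - dot x (pole E)) n0 (has_diff_stereo_den th1)).
apply: has_diff_eq H _ => v; rewrite dE !(dotDl, dotZl, dotNl) (dotC (row i E) v) (dotC (pole E) v).
by field.
Qed.

Lemma has_diff_chain2 (W : normedModType R) (h0 h1 : W -> R) (L0 L1 : W -> R) (k : V -> R) w a b :
  has_diff h0 w L0 -> has_diff h1 w L1 ->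
  has_grad k (h0 w *: evec 0 + h1 w *: evec 1) a b ->
  has_diff (fun y => k (h0 y *: evec 0 + h1 y *: evec 1)) w (fun s => a * L0 s + b * L1 s).
Proof.
move=> [d0 e0] [d1 e1] [dk ek].
pose c (y : W) : V := h0 y *: evec 0 + h1 y *: evec 1.
have dc0 : differentiable (fun y => h0 y *: (evec 0 : V)) w by exact: differentiableZl.
have dc1 : differentiable (fun y => h1 y *: (evec 1 : V)) w by exact: differentiableZl.
have dc : differentiable c w by exact: (differentiableD dc0 dc1).
have ec s : 'd c w s = L0 s *: evec 0 + L1 s *: evec 1.
  have E1 := congr1 (@^~ s) (diffD dc0 dc1).
  have E2 := congr1 (@^~ s) (diffZl (evec 0 : V) d0).
  have E3 := congr1 (@^~ s) (diffZl (evec 1 : V) d1).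
  have E4 := congr1 (@^~ s) e0.
  have E5 := congr1 (@^~ s) e1.
  apply: (etrans E1); apply: (etrans (f_equal2 +%R E2 E3)).
  exact: (f_equal2 (fun r1 r2 : R => r1 *: evec 0 + r2 *: evec 1) E4 E5).
split; first exact: (differentiable_comp dc dk).
apply/funext => s.
apply: (etrans (congr1 (@^~ s) (diff_comp dc dk))).
apply: (etrans (congr1 (@^~ ('d c w s)) ek)).
rewrite ec /pairing /evec !mxE /=; ring.
Qed.

End Stereographic.

(** * The envelope in closed form *)

Section EpsteinPoint.
Context {R : realType}.
Local Notation V := 'rV[R]_2.
Implicit Types (x y l A B : R).

(** With X the point of the hyperboloid described at the top, the denominator is
    2 l (1 + X_0) and the numerators are 2 l X_k, so that the quotient is the
    corresponding point of the ball. The arguments are the parameter x + i y,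
    the density l and the derivatives A, B of its logarithm. *)
Definition epstein_den x y l A B : R :=
  2 * l + (l ^+ 2 + A ^+ 2 + B ^+ 2) * (1 + (x ^+ 2 + y ^+ 2)) / 2 +
  2 * (A * x + B * y) + 2.

Definition epstein_num x y l A B (k : 'I_3) : R :=
  let K := l ^+ 2 + A ^+ 2 + B ^+ 2 in
  if k == 0 then K * x + 2 * A else if k == 1 then K * y + 2 * B
  else K * (x ^+ 2 + y ^+ 2 - 1) / 2 + 2 * (A * x + B * y) + 2.

Definition epstein_coord x y l A B k : R :=
  epstein_num x y l A B k / epstein_den x y l A B.

(** The quadratic terms combine into squares by Lagrange's identity for (A, B)
    and (x, y). *)
Lemma epstein_den_gt0 x y l A B : 0 < l -> 0 < epstein_den x y l A B.
Proof.
move=> l0; have -> : epstein_den x y l A B = 2 * l +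
  ((A * x + B * y + 2) ^+ 2 + (A * y - B * x) ^+ 2 +
   (l ^+ 2 * (1 + (x ^+ 2 + y ^+ 2)) + A ^+ 2 + B ^+ 2)) / 2.
  by rewrite /epstein_den; field.
have s1 := sqr_ge0 (A * x + B * y + 2).
have s2 := sqr_ge0 (A * y - B * x).
have s3 : 0 <= l ^+ 2 * (1 + (x ^+ 2 + y ^+ 2)).
  by rewrite mulr_ge0 ?addr_ge0 ?sqr_ge0.
by have := sqr_ge0 A; have := sqr_ge0 B; lra.
Qed.

End EpsteinPoint.

Section HoroMap.
Context {R : realType}.
Local Notation C := (Num.NumField.sort (complex_complex__canonical__Num_NumField R)).
Local Notation V := 'rV[R]_2.
Variables (E : 'M[R]_3) (f : 'rV[R]_3 -> R[i]) (p : V).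
Hypothesis EE : E *m E^T = 1%:M.
Let F : C -> C := in_stereo E f.
Let z : C := of_coords p.
Let th := stereo_inv E z.
Let x := p 0 0.
Let y := p 0 1.
Hypothesis Fz : regular_at F z.
Let l := density F z.
Let A := log_density_x F z.
Let B := log_density_y F z.
Let a := A + gamma z * x.
Let b := B + gamma z * y.

Let log_factor (q : V) : R := ln (density F (of_coords q) / gamma (of_coords q)).

Let l0 : 0 < l. Proof. exact: density_gt0. Qed.

Let z_sqnorm : sqnorm z = x ^+ 2 + y ^+ 2. Proof. by []. Qed.

Let r0 : 0 < 1 + (x ^+ 2 + y ^+ 2). Proof. exact: (sqnorm1_gt0 z). Qed.

Lemma log_factor_grad : has_grad log_factor p a b.
Proof.
have -> : log_factor = (fun q => ln (density F (of_coords q) *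
    (cst (2^-1) q * (cst 1 q + (q 0 0 * q 0 0 + q 0 1 * q 0 1))))).
  apply/funext => q; rewrite /log_factor gammaE invf_div /sqnorm /of_coords /= /cst.
  by congr (ln (_ * _)); rewrite mulrC -!expr2.
have H := has_gradM (density_grad Fz erefl) (has_gradM (has_grad_cst 2^-1 p)
  (has_gradD (has_grad_cst 1 p) (has_gradD
   (has_gradM (has_grad_coord0 p) (has_grad_coord0 p))
   (has_gradM (has_grad_coord1 p) (has_grad_coord1 p))))).
have pos : 0 < density F (of_coords p) *
    (cst (2^-1) p * (cst 1 p + (p 0 0 * p 0 0 + p 0 1 * p 0 1))).
  rewrite /cst -!expr2; apply: mulr_gt0; first exact: l0.
  by apply: mulr_gt0; [rewrite invr_gt0|exact: r0].
have G := has_grad_comp H (is_derive1_ln pos).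
have ln0 := lt0r_neq0 l0; have rn0 := lt0r_neq0 r0.
apply: has_grad_eq G _ _; rewrite /a /b gammaE z_sqnorm /cst -/z -/l -/A -/B -/x -/y.
  by field; rewrite ln0 rn0.
by field; rewrite ln0 rn0.
Qed.

Lemma rho_atE (t : 'rV[R]_3) : dot t t = 1 -> t <> pole E ->
  rho_at E f t = ln (density F (stereo E t) / gamma (stereo E t)).
Proof.
move=> t1 tp; rewrite /rho_at /density /F /in_stereo stereo_invK//.
by congr ln; rewrite mulrAC.
Qed.

Lemma of_coords_evec (s t : R) : of_coords (s *: evec 0 + t *: evec 1) = s +i* t.
Proof.
by rewrite /of_coords /evec !mxE /= !mulr1 !mulr0 addr0 add0r.
Qed.

Lemma stereo_coord_normalize (t : 'rV[R]_3) : 0 < dot t t ->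
  enorm t + - dot t (pole E) != 0 ->
  let u := (enorm t)^-1 *: t in
  [/\ dot u u = 1, u <> pole E &
   stereo E u = stereo_coord E 0 t +i* stereo_coord E 1 t].
Proof.
move=> t0 d0 u.
have n0 : 0 < enorm t by rewrite /enorm sqrtr_gt0.
have nn := lt0r_neq0 n0.
have nt : enorm t ^+ 2 = dot t t by rewrite /enorm sqr_sqrtr// ltW.
have uu : dot u u = 1 by rewrite /u dotZl dotZr -nt; field.
split=> //.
  move=> up; move/eqP: d0; apply.
  have : dot u (pole E) = 1 by rewrite up /pole dot_row.
  rewrite /u dotZl => /(congr1 (fun s => enorm t * s)).
  by rewrite mulrA mulfV// mul1r mulr1 => ->; rewrite subrr.
have d1 : 1 - dot u (pole E) = (enorm t)^-1 * (enorm t + - dot t (pole E)).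
  by rewrite /u dotZl mulrDr mulVf// mulrN.
rewrite /stereo /stereo_coord d1 /u !dotZl.
by congr (_ +i* _); field; rewrite nn d0.
Qed.

Lemma rho_near : \forall t \near th, rho_at E f ((enorm t)^-1 *: t) =
  log_factor (stereo_coord E 0 t *: evec 0 + stereo_coord E 1 t *: evec 1).
Proof.
have th1 : dot th th = 1 := dot_stereo_inv EE z.
have c1 := differentiable_continuous (proj1 (has_diff_sqr_norm th)).
have c2 := differentiable_continuous (proj1 (has_diff_stereo_den E th1)).
have n1 : \forall t \near th, 0 < dot t t.
  have : 0 < dot th th by rewrite th1.
  by move=> /(cvgr_gt (dot th th) c1); apply.
have n2 : \forall t \near th, 0 < enorm t + - dot t (pole E).
  have : 0 < enorm th + - dot th (pole E).
    by rewrite enorm1// one_sub_dot_stereo_inv_pole// gamma_gt0.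
  by move=> /(cvgr_gt (enorm th + - dot th (pole E)) c2); apply.
apply: filterS2 n1 n2 => t t0 /lt0r_neq0 d0.
have [u1 up us] := stereo_coord_normalize t0 d0.
by rewrite rho_atE// us /log_factor of_coords_evec.
Qed.

(** rho is constant along rays, and near th it is a function of the two
    stereographic coordinates; their gradients have simple components in the
    frame. *)
Lemma sphere_grad_rho : sphere_grad (rho_at E f) th =
  in_frame E (a * ((gamma z)^-1 - x ^+ 2) - b * (x * y))
    (b * ((gamma z)^-1 - y ^+ 2) - a * (x * y)) (a * x + b * y).
Proof.
have g0 := lt0r_neq0 (gamma_gt0 z).
have tE : th = in_frame E (gamma z * x) (gamma z * y) (1 - gamma z) := stereo_invE E z.
have [t0 t1 t2] := dot_in_frame_row EE (gamma z * x) (gamma z * y) (1 - gamma z).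
rewrite -tE in t0 t1 t2.
have s0 : stereo_coord E 0 th *: evec 0 + stereo_coord E 1 th *: evec 1 = p.
  have sc (i : 'I_3) : stereo_coord E i th = dot th (row i E) / gamma z.
    by rewrite /stereo_coord enorm1 ?dot_stereo_inv// one_sub_dot_stereo_inv_pole.
  rewrite !sc t0 t1 !(mulrC (gamma z)) !mulfK//.
  by rewrite -[LHS]coordsK of_coords_evec -[RHS]coordsK.
have G := log_factor_grad; rewrite -s0 in G.
have H := has_diff_chain2 (has_diff_stereo_coord EE 0 z) (has_diff_stereo_coord EE 1 z) G.
have {}H := near_has_diff rho_near H.
have -> : sphere_grad (rho_at E f) th = a *: ((gamma z)^-1 *: row 0 E -
      (dot th (row 0 E) / gamma z ^+ 2) *: (th - pole E)) +
   b *: ((gamma z)^-1 *: row 1 E -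
      (dot th (row 1 E) / gamma z ^+ 2) *: (th - pole E)).
  apply/rowP => i; rewrite mxE; have [_ ->] := has_diff_derive (evec i) H.
  by rewrite -[RHS]dot_evec (dotDl (a *: _)) (dotZl a) (dotZl b).
have r0E : row 0 E = in_frame E 1 0 0 by rewrite /in_frame scale1r !scale0r !addr0.
have r1E : row 1 E = in_frame E 0 1 0 by rewrite /in_frame scale1r !scale0r addr0 add0r.
have pE : pole E = in_frame E 0 0 1 by rewrite /in_frame scale1r !scale0r !add0r.
have NE u v w : - in_frame E u v w = in_frame E (- u) (- v) (- w).
  by rewrite -scaleN1r in_frameZ !mulN1r.
rewrite t0 t1 tE pE {1}r0E {1}r1E.
rewrite !(in_frameZ, in_frameD, NE).
by congr in_frame; field.
Qed.

Lemma expR_rho : expR (rho_at E f th) = l / gamma z.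
Proof.
rewrite rho_atE ?dot_stereo_inv//; last exact: stereo_inv_neq_pole.
by rewrite stereoK// lnK// posrE divr_gt0// gamma_gt0.
Qed.

Lemma horo_map_rho : horo_map (rho_at E f) th =
  in_frame E (epstein_coord x y l A B 0) (epstein_coord x y l A B 1)
    (epstein_coord x y l A B 2).
Proof.
rewrite /horo_map sphere_grad_rho dot_in_frame// mulr_natl mulr2n expRD expR_rho.
have tE : th = in_frame E (gamma z * x) (gamma z * y) (1 - gamma z) := stereo_invE E z.
rewrite tE !(in_frameZ, in_frameD).
have g0 := lt0r_neq0 (gamma_gt0 z).
have ln0 := lt0r_neq0 l0; have rn0 := lt0r_neq0 r0.
have Q0 := lt0r_neq0 (epstein_den_gt0 x y A B l0).
set q := _ + (l / gamma z + 1) ^+ 2.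
have qE : q = epstein_den x y l A B * (1 + (x ^+ 2 + y ^+ 2)) / 2.
  by rewrite /q /a /b gammaE z_sqnorm /epstein_den; field.
rewrite qE /epstein_coord /epstein_num /= /a /b gammaE z_sqnorm.
move: (epstein_den _ _ _ _ _) Q0 => Q Q0.
by congr in_frame; field; rewrite rn0 Q0.
Qed.

End HoroMap.

(** * Tangent vectors and normal of the envelope *)

Section EpsteinAlgebra.
Context {R : realType}.
Variables x y l A B Sr Si : R.
Hypothesis l0 : 0 < l.

(** [cone_time] and [cone_space] are the components of the light-like vector n;
    [cone_dtime] and [cone_dspace] those of (d_j psi) / l, where psi = l n. *)
Definition cone_time : R := (1 + (x ^+ 2 + y ^+ 2)) / 2.

Definition cone_space (k : 'I_3) : R :=
  if k == 0 then x else if k == 1 then y else (x ^+ 2 + y ^+ 2 - 1) / 2.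

Definition cone_dtime (j : 'I_2) : R :=
  if j == 0 then A * cone_time + x else B * cone_time + y.

Definition cone_dspace (j : 'I_2) (k : 'I_3) : R :=
  if j == 0 then A * cone_space k + (if k == 0 then 1 else if k == 1 then 0 else x)
  else B * cone_space k + (if k == 0 then 0 else if k == 1 then 1 else y).

Let Q := epstein_den x y l A B.
Let Y := epstein_coord x y l A B.

(** The image of (d_j psi) / l under the differential of the projection of the
    hyperboloid to the ball. Up to the conformal factor these two vectors are
    orthonormal. *)
Definition unit_frame j k : R :=
  2 * l * (cone_dspace j k - cone_dtime j * Y k) / Q.

(** The matrix mu (1 + sig). *)
Definition shape_coef (i j : 'I_2) : R :=
  if i == 0 then (if j == 0 then l ^+ 2 + Sr else - Si)
  else (if j == 0 then - Si else l ^+ 2 - Sr).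

Definition tangent_coord (i : 'I_2) (k : 'I_3) : R :=
  (shape_coef i 0 * unit_frame 0 k + shape_coef i 1 * unit_frame 1 k) / l.

(** The image of N under the same differential, rescaled to Euclidean length
    1. *)
Definition normal_coord (k : 'I_3) : R := l * cone_space k - (1 + l * cone_time) * Y k.

Definition dot3 (u v : 'I_3 -> R) : R := u 0 * v 0 + u 1 * v 1 + u 2 * v 2.

Let Q0 : Q != 0. Proof. by rewrite gt_eqF// epstein_den_gt0. Qed.
Let ln0 : l != 0. Proof. by rewrite gt_eqF. Qed.

(* The only denominators are l and a multiple of Q by a numeral; the latter is
   compared with Q by linear arithmetic on monomials. *)
Ltac epstein_field :=
  move: Q0; rewrite /dot3 /normal_coord /unit_frame /Y /Q /cone_dspace /cone_dtime
    /cone_space /cone_time /epstein_coord /epstein_num /= /epstein_den;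
  let Qn0 := fresh in intro Qn0; field; rewrite ?ln0 /=; refine (contra _ Qn0);
  let Qe := fresh in move/eqP; intro Qe; apply/eqP; lra.

Lemma epstein_coord_norm : 1 - dot3 Y Y = 4 * l / Q.
Proof. by epstein_field. Qed.

Lemma unit_frame_dot i j : dot3 (unit_frame i) (unit_frame j) =
  if i == j then (2 * l / Q) ^+ 2 else 0.
Proof.
by case: (ord2_case i) (ord2_case j) => -> [] -> /=; epstein_field.
Qed.

Lemma unit_frame_normal i : dot3 (unit_frame i) normal_coord = 0.
Proof. by case: (ord2_case i) => ->; epstein_field. Qed.

Lemma normal_coord_norm : dot3 normal_coord normal_coord = 1.
Proof. by epstein_field. Qed.

Lemma epstein_coord_normal :
  dot3 Y normal_coord * (Q / (2 * l)) = l * cone_time + 1 - Q / (2 * l).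
Proof. by epstein_field. Qed.

Lemma tangent_unit_frame_dot i j :
  dot3 (tangent_coord i) (unit_frame j) = 4 * l * shape_coef i j / Q ^+ 2.
Proof.
have H : dot3 (tangent_coord i) (unit_frame j) =
  (shape_coef i 0 * dot3 (unit_frame 0) (unit_frame j) +
   shape_coef i 1 * dot3 (unit_frame 1) (unit_frame j)) / l.
  by rewrite /dot3 /tangent_coord; field.
rewrite H !unit_frame_dot.
by case: (ord2_case j) => -> /=; field; rewrite ln0 Q0.
Qed.

Lemma tangent_dot i j : dot3 (tangent_coord i) (tangent_coord j) =
  4 * (shape_coef i 0 * shape_coef j 0 + shape_coef i 1 * shape_coef j 1) / Q ^+ 2.
Proof.
have H : dot3 (tangent_coord i) (tangent_coord j) =
  (shape_coef j 0 * dot3 (tangent_coord i) (unit_frame 0) +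
   shape_coef j 1 * dot3 (tangent_coord i) (unit_frame 1)) / l.
  by rewrite /dot3 {2 4 6}/tangent_coord; field.
by rewrite H !tangent_unit_frame_dot; field; rewrite ln0 Q0.
Qed.

Lemma tangent_normal_dot i : dot3 (tangent_coord i) normal_coord = 0.
Proof.
have H : dot3 (tangent_coord i) normal_coord =
  (shape_coef i 0 * dot3 (unit_frame 0) normal_coord +
   shape_coef i 1 * dot3 (unit_frame 1) normal_coord) / l.
  by rewrite /dot3 {1 2 3}/tangent_coord; field.
by rewrite H !unit_frame_normal !mulr0 addr0 mul0r.
Qed.

Definition normal_dcoord (j : 'I_2) (k : 'I_3) : R :=
  Q / 2 * unit_frame j k - (1 + l * cone_time) * tangent_coord j k.

Lemma tangent_normal_dcoord i j : dot3 (tangent_coord i) (normal_dcoord j) =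
  2 * l * shape_coef i j / Q -
  4 * (1 + l * cone_time) *
    (shape_coef i 0 * shape_coef j 0 + shape_coef i 1 * shape_coef j 1) / Q ^+ 2.
Proof.
have H : dot3 (tangent_coord i) (normal_dcoord j) =
  Q / 2 * dot3 (tangent_coord i) (unit_frame j) -
  (1 + l * cone_time) * dot3 (tangent_coord i) (tangent_coord j).
  rewrite /dot3 /normal_dcoord.
  by move: (tangent_coord i) (tangent_coord j) (unit_frame j) => f g h; ring.
by rewrite H tangent_unit_frame_dot tangent_dot; field.
Qed.

End EpsteinAlgebra.

Section EpsteinGradient.
Context {R : realType}.
Local Notation V := 'rV[R]_2.
Variables (l A B : V -> R) (Sr Si : R) (p : V).
Hypothesis l0 : 0 < l p.
Hypothesis l_grad : has_grad l p (l p * A p) (l p * B p).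
Hypothesis A_grad : has_grad A p ((l p ^+ 2 + A p ^+ 2 - B p ^+ 2) / 2 + Sr)
  (A p * B p - Si).
Hypothesis B_grad : has_grad B p (A p * B p - Si)
  ((l p ^+ 2 - A p ^+ 2 + B p ^+ 2) / 2 - Sr).

Let x := p 0 0.
Let y := p 0 1.
Let Ax : R := (l p ^+ 2 + A p ^+ 2 - B p ^+ 2) / 2 + Sr.
Let Ay : R := A p * B p - Si.
Let By : R := (l p ^+ 2 - A p ^+ 2 + B p ^+ 2) / 2 - Sr.
Let Kx : R := 2 * (l p ^+ 2 * A p + A p * Ax + B p * Ay).
Let Ky : R := 2 * (l p ^+ 2 * B p + A p * Ay + B p * By).
Let K (q : V) : R := l q ^+ 2 + A q ^+ 2 + B q ^+ 2.
Let r2 (q : V) : R := q 0 0 ^+ 2 + q 0 1 ^+ 2.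
Let S (q : V) : R := A q * q 0 0 + B q * q 0 1.

Let has_grad_sqr (h : V -> R) a b : has_grad h p a b ->
  has_grad (fun q => h q ^+ 2) p (2 * h p * a) (2 * h p * b).
Proof. by move=> H; apply: has_grad_ext (has_gradM H H) _ _ _ => [q||]; ring. Qed.

Let has_gradZ (c : R) (h : V -> R) a b : has_grad h p a b ->
  has_grad (fun q => c * h q) p (c * a) (c * b).
Proof.
by move=> H; apply: has_grad_ext (has_gradM (has_grad_cst c p) H) _ _ _ => [q||];
  rewrite /cst; ring.
Qed.

Let has_grad_shift (c : R) (h : V -> R) a b : has_grad h p a b ->
  has_grad (fun q => h q + c) p a b.
Proof.
by move=> H; apply: has_grad_ext (has_gradD H (has_grad_cst c p)) _ _ _ => [q||];
  rewrite /cst; ring.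
Qed.

Let K_grad : has_grad K p Kx Ky.
Proof.
apply: has_grad_eq (has_gradD (has_gradD (has_grad_sqr l_grad) (has_grad_sqr A_grad))
  (has_grad_sqr B_grad)) _ _; rewrite /Kx /Ky /Ax /Ay /By; ring.
Qed.

Let r2_grad : has_grad r2 p (2 * x) (2 * y).
Proof.
by apply: has_grad_eq (has_gradD (has_grad_sqr (has_grad_coord0 p))
  (has_grad_sqr (has_grad_coord1 p))) _ _; rewrite /x /y; ring.
Qed.

Let S_grad : has_grad S p (Ax * x + A p + Ay * y) (Ay * x + By * y + B p).
Proof.
by apply: has_grad_eq (has_gradD (has_gradM A_grad (has_grad_coord0 p))
  (has_gradM B_grad (has_grad_coord1 p))) _ _; rewrite /x /y /Ax /Ay /By; ring.
Qed.

Let den (q : V) : R := epstein_den (q 0 0) (q 0 1) (l q) (A q) (B q).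

Let den_grad : has_grad den p
  (2 * l p * A p + (Kx * (1 + r2 p) + K p * (2 * x)) / 2 + 2 * (Ax * x + A p + Ay * y))
  (2 * l p * B p + (Ky * (1 + r2 p) + K p * (2 * y)) / 2 + 2 * (Ay * x + By * y + B p)).
Proof.
have H := has_grad_shift 2 (has_gradD (has_gradD (has_gradZ 2 l_grad)
   (has_gradZ 2^-1 (has_gradM K_grad (has_grad_shift 1 r2_grad)))) (has_gradZ 2 S_grad)).
apply: has_grad_ext H _ _ _ => [q||]; last 2 first.
- by ring.
- by ring.
by rewrite /den /epstein_den /K /r2 /S; ring.
Qed.

Let num_grad k : has_grad (fun q => epstein_num (q 0 0) (q 0 1) (l q) (A q) (B q) k) p
  (if k == 0 then Kx * x + K p + 2 * Ax else if k == 1 then Kx * y + 2 * Ay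
   else (Kx * (r2 p - 1) + K p * (2 * x)) / 2 + 2 * (Ax * x + A p + Ay * y))
  (if k == 0 then Ky * x + 2 * Ay else if k == 1 then Ky * y + K p + 2 * By
   else (Ky * (r2 p - 1) + K p * (2 * y)) / 2 + 2 * (Ay * x + By * y + B p)).
Proof.
rewrite /epstein_num; case: ifP => _; [|case: ifP => _].
- by apply: has_grad_eq (has_gradD (has_gradM K_grad (has_grad_coord0 p))
    (has_gradZ 2 A_grad)) _ _; rewrite /x /Ax /Ay; ring.
- by apply: has_grad_eq (has_gradD (has_gradM K_grad (has_grad_coord1 p))
    (has_gradZ 2 B_grad)) _ _; rewrite /y /By /Ay; ring.
have H := has_grad_shift 2 (has_gradD
  (has_gradZ 2^-1 (has_gradM K_grad (has_grad_shift (-1) r2_grad))) (has_gradZ 2 S_grad)).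
apply: has_grad_ext H _ _ _ => [q||]; last 2 first.
- by ring.
- by ring.
by rewrite /K /r2 /S; ring.
Qed.

Let den0 : den p != 0. Proof. by rewrite gt_eqF// epstein_den_gt0. Qed.

Let ln0 : l p != 0. Proof. by rewrite gt_eqF. Qed.

Lemma epstein_coord_grad k :
  has_grad (fun q => epstein_coord (q 0 0) (q 0 1) (l q) (A q) (B q) k) p
    (tangent_coord x y (l p) (A p) (B p) Sr Si 0 k)
    (tangent_coord x y (l p) (A p) (B p) Sr Si 1 k).
Proof.
apply: has_grad_eq (has_gradM (num_grad k) (has_gradV den0 den_grad)) _ _.
  move: den0; case: (ord3_case k) => ->; rewrite /tangent_coord /shape_coef /unit_frame
    /cone_dspace /cone_dtime /cone_space /cone_time /epstein_coord /epstein_num /=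
    /Kx /Ky /Ax /Ay /By /K /r2 /den -/x -/y /epstein_den => Q0; field;
    rewrite ?ln0 /=; apply: contra Q0 => /eqP Qe; apply/eqP; lra.
move: den0; case: (ord3_case k) => ->; rewrite /tangent_coord /shape_coef /unit_frame
    /cone_dspace /cone_dtime /cone_space /cone_time /epstein_coord /epstein_num /=
    /Kx /Ky /Ax /Ay /By /K /r2 /den -/x -/y /epstein_den => Q0; field;
    rewrite ?ln0 /=; apply: contra Q0 => /eqP Qe; apply/eqP; lra.
Qed.

(** Differentiate l n_k - (1 + l n_0) Y_k, where d_j (l n) = d_j psi. *)
Lemma normal_coord_grad k :
  has_grad (fun q => normal_coord (q 0 0) (q 0 1) (l q) (A q) (B q) k) p
    (normal_dcoord x y (l p) (A p) (B p) Sr Si 0 k)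
    (normal_dcoord x y (l p) (A p) (B p) Sr Si 1 k).
Proof.
have time_grad : has_grad (fun q => cone_time (q 0 0) (q 0 1)) p x y.
  have H := has_gradZ 2^-1 (has_grad_shift 1 r2_grad).
  apply: has_grad_ext H _ _ _ => [q||]; [by rewrite /cone_time /r2; ring| |]; by field.
have space_grad : has_grad (fun q => cone_space (q 0 0) (q 0 1) k) p
    (if k == 0 then 1 else if k == 1 then 0 else x)
    (if k == 0 then 0 else if k == 1 then 1 else y).
  rewrite /cone_space; case: ifP => _; [exact: has_grad_coord0|].
  case: ifP => _; [exact: has_grad_coord1|].
  have H := has_gradZ 2^-1 (has_grad_shift (-1) r2_grad).
  apply: has_grad_ext H _ _ _ => [q||]; [by rewrite /r2; ring| |]; by field.
have Y_grad := epstein_coord_grad k.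
have H := has_gradD (has_gradM l_grad space_grad)
  (has_gradN (has_gradM (has_grad_shift 1 (has_gradM l_grad time_grad)) Y_grad)).
apply: has_grad_ext H _ _ _ => [q||]; first by rewrite /normal_coord; ring.
  rewrite /normal_dcoord /unit_frame /cone_dspace /cone_dtime /= -/x -/y -/(den p).
  by field; rewrite den0.
rewrite /normal_dcoord /unit_frame /cone_dspace /cone_dtime /= -/x -/y -/(den p).
by field; rewrite den0.
Qed.

End EpsteinGradient.

(** * The fundamental forms of the envelope *)

Section DifferentiableScalars.
Context {R : realType}.
Local Notation V := 'rV[R]_2.
Implicit Types (h k : V -> R) (p : V).

(** The second derivatives of the surface involve those of the Schwarzian, of
    which only the existence is at stake: their contribution along the normal is
    determined by orthogonality. *)
Definition has_some_grad h p := exists a b, has_grad h p a b.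

Lemma has_some_gradD h k p : has_some_grad h p -> has_some_grad k p ->
  has_some_grad (fun q => h q + k q) p.
Proof. by move=> [a [b H1]] [c [d H2]]; do 2 eexists; exact: has_gradD H1 H2. Qed.

Lemma has_some_gradM h k p : has_some_grad h p -> has_some_grad k p ->
  has_some_grad (fun q => h q * k q) p.
Proof. by move=> [a [b H1]] [c [d H2]]; do 2 eexists; exact: has_gradM H1 H2. Qed.

Lemma has_some_gradN h p : has_some_grad h p -> has_some_grad (fun q => - h q) p.
Proof. by move=> [a [b H1]]; do 2 eexists; exact: has_gradN H1. Qed.

Lemma has_some_gradV h p : h p != 0 -> has_some_grad h p ->
  has_some_grad (fun q => (h q)^-1) p.
Proof. by move=> h0 [a [b H1]]; do 2 eexists; exact: has_gradV h0 H1. Qed.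

Lemma has_some_gradX2 h p : has_some_grad h p -> has_some_grad (fun q => h q ^+ 2) p.
Proof. by move=> H; exact: (has_some_gradM H H). Qed.

Lemma has_some_grad_cst (c : R) p : has_some_grad (fun=> c) p.
Proof. by do 2 eexists; exact: has_grad_cst. Qed.

End DifferentiableScalars.

Section FrameFields.
Context {R : realType}.
Local Notation V := 'rV[R]_2.
Variable E : 'M[R]_3.

Definition frame3 (u : 'I_3 -> R) : 'rV[R]_3 := in_frame E (u 0) (u 1) (u 2).

Lemma dot_frame3 u v : E *m E^T = 1%:M -> dot (frame3 u) (frame3 v) = dot3 u v.
Proof. by move=> EE; rewrite /frame3 dot_in_frame. Qed.

Lemma differentiable_frame3 (h : V -> 'I_3 -> R) p :
  (forall k, differentiable (fun q => h q k) p) ->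
  differentiable (fun q => frame3 (h q)) p.
Proof.
move=> H; have dk k : differentiable (fun q => h q k *: row k E) p.
  exact: (differentiableZl (row k E) (H k)).
exact: (differentiableD (differentiableD (dk 0) (dk 1)) (dk 2)).
Qed.

Lemma derive_frame3 (h : V -> 'I_3 -> R) (d : 'I_2 -> 'I_3 -> R) p (i : 'I_2) :
  (forall k, has_grad (fun q => h q k) p (d 0 k) (d 1 k)) ->
  derivable (fun q => frame3 (h q)) p (evec i) /\
  'D_(evec i) (fun q => frame3 (h q)) p = frame3 (d i).
Proof.
move=> H.
have P k : 'd (fun q => h q k) p (evec i) = d i k.
  rewrite (congr1 (@^~ (evec i)) (proj2 (H k))) /pairing /evec.
  by case: (ord2_case i) => ->; rewrite !mxE /= ?mulr1 ?mulr0 ?addr0 ?add0r.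
have dk k : differentiable (fun q => h q k *: row k E) p.
  exact: (differentiableZl (row k E) (proj1 (H k))).
have d01 : differentiable (fun q => h q 0 *: row 0 E + h q 1 *: row 1 E) p.
  exact: (differentiableD (dk 0) (dk 1)).
have d012 := differentiable_frame3 (fun k => proj1 (H k)).
split; first exact: diff_derivable.
rewrite deriveE//.
have Z k : 'd (fun q => h q k *: row k E) p (evec i) = d i k *: row k E.
  have E1 := congr1 (@^~ (evec i)) (diffZl (row k E) (proj1 (H k))).
  apply: (etrans E1); exact: (congr1 (fun r : R => r *: row k E) (P k)).
apply: (etrans (congr1 (@^~ (evec i)) (diffD d01 (dk 2)))).
apply: (f_equal2 +%R _ (Z 2)).
apply: (etrans (congr1 (@^~ (evec i)) (diffD (dk 0) (dk 1)))).
exact: (f_equal2 +%R (Z 0) (Z 1)).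
Qed.

End FrameFields.

Section EpsteinForms.
Context {R : realType}.
Local Notation V := 'rV[R]_2.
Variables (E : 'M[R]_3) (Y : V -> 'rV[R]_3) (l A B Sr Si : V -> R) (p0 : V).
Hypothesis EE : E *m E^T = 1%:M.

(** The system satisfied by the hyperbolic density and the derivatives of its
    logarithm, with Sr + i Si the Schwarzian. *)
Definition liouville_at p := [/\ 0 < l p, has_grad l p (l p * A p) (l p * B p),
  has_grad A p ((l p ^+ 2 + A p ^+ 2 - B p ^+ 2) / 2 + Sr p) (A p * B p - Si p) &
  has_grad B p (A p * B p - Si p) ((l p ^+ 2 - A p ^+ 2 + B p ^+ 2) / 2 - Sr p)].

Hypothesis sys : \forall p \near p0, liouville_at p.
Hypothesis Sr_grad : has_some_grad Sr p0.
Hypothesis Si_grad : has_some_grad Si p0.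

Let c (p : V) k := epstein_coord (p 0 0) (p 0 1) (l p) (A p) (B p) k.
Let t (p : V) i k := tangent_coord (p 0 0) (p 0 1) (l p) (A p) (B p) (Sr p) (Si p) i k.
Let m (p : V) k := normal_coord (p 0 0) (p 0 1) (l p) (A p) (B p) k.
Let dm (p : V) j k := normal_dcoord (p 0 0) (p 0 1) (l p) (A p) (B p) (Sr p) (Si p) j k.
Let Q (p : V) := epstein_den (p 0 0) (p 0 1) (l p) (A p) (B p).

Hypothesis Yc : \forall p \near p0, Y p = frame3 E (c p).

Let sys0 : liouville_at p0 := nbhs_singleton sys.
Let Y0 : Y p0 = frame3 E (c p0) := nbhs_singleton Yc.
Let l0 : 0 < l p0. Proof. by case: sys0. Qed.
Let ln0 : l p0 != 0. Proof. by rewrite gt_eqF. Qed.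
Let Q0 : Q p0 != 0. Proof. by rewrite gt_eqF// epstein_den_gt0. Qed.

Lemma epstein_tangent : \forall p \near p0, forall i,
  derivable Y p (evec i) /\ tangent_field Y i p = frame3 E (t p i).
Proof.
apply: filterS2 sys (nbhs_interior Yc) => p [lp lg Ag Bg] Yp i.
have [d1 d2] := derive_frame3 E i (epstein_coord_grad lp lg Ag Bg).
split.
  by apply: near_eq_derivable d1; apply: filterS Yp => q ->.
by rewrite /tangent_field -d2; apply: near_eq_derive; exact: Yp.
Qed.

Let coord_some (j : 'I_2) : has_some_grad (fun q : V => q 0 j) p0.
Proof.
by case: (ord2_case j) => ->; do 2 eexists; [exact: has_grad_coord0|exact: has_grad_coord1].
Qed.

Lemma tangent_some_grad i k : has_some_grad (fun q => t q i k) p0.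
Proof.
have [_ lg Ag Bg] := sys0.
have sl : has_some_grad l p0 by do 2 eexists; exact: lg.
have sA : has_some_grad A p0 by do 2 eexists; exact: Ag.
have sB : has_some_grad B p0 by do 2 eexists; exact: Bg.
have sY kk : has_some_grad (fun q => c q kk) p0.
  by do 2 eexists; exact: (epstein_coord_grad l0 lg Ag Bg).
have sx := coord_some 0; have sy := coord_some 1.
have sc (r : R) := has_some_grad_cst r p0.
have sr2 := has_some_gradD (has_some_gradX2 sx) (has_some_gradX2 sy).
have sn kk : has_some_grad (fun q : V => cone_space (q 0 0) (q 0 1) kk) p0.
  rewrite /cone_space; case: (kk == 0); [exact sx|case: (kk == 1); [exact sy|]].
  exact (has_some_gradM (has_some_gradD sr2 (sc (- 1))) (sc 2^-1)).
have st : has_some_grad (fun q : V => cone_time (q 0 0) (q 0 1)) p0.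
  exact (has_some_gradM (has_some_gradD (sc 1) sr2) (sc 2^-1)).
have sK := has_some_gradD (has_some_gradD (has_some_gradX2 sl) (has_some_gradX2 sA))
  (has_some_gradX2 sB).
have sS := has_some_gradD (has_some_gradM sA sx) (has_some_gradM sB sy).
have sQ : has_some_grad Q p0.
  exact (has_some_gradD (has_some_gradD (has_some_gradD (has_some_gradM (sc 2) sl)
    (has_some_gradM (has_some_gradM sK (has_some_gradD (sc 1) sr2)) (sc 2^-1)))
    (has_some_gradM (sc 2) sS)) (sc 2)).
have sds j kk : has_some_grad (fun q : V => cone_dspace (q 0 0) (q 0 1) (A q) (B q) j kk) p0.
  rewrite /cone_dspace; case: (j == 0).
    apply: (has_some_gradD (has_some_gradM sA (sn kk))).
    by case: (kk == 0); [exact (sc 1)|case: (kk == 1); [exact (sc 0)|exact sx]].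
  apply: (has_some_gradD (has_some_gradM sB (sn kk))).
  by case: (kk == 0); [exact (sc 0)|case: (kk == 1); [exact (sc 1)|exact sy]].
have sdt j : has_some_grad (fun q : V => cone_dtime (q 0 0) (q 0 1) (A q) (B q) j) p0.
  rewrite /cone_dtime; case: (j == 0).
    exact (has_some_gradD (has_some_gradM sA st) sx).
  exact (has_some_gradD (has_some_gradM sB st) sy).
have su j : has_some_grad (fun q : V => unit_frame (q 0 0) (q 0 1) (l q) (A q) (B q) j k) p0.
  exact (has_some_gradM (has_some_gradM (has_some_gradM (sc 2) sl)
    (has_some_gradD (sds j k) (has_some_gradN (has_some_gradM (sdt j) (sY k)))))
    (has_some_gradV Q0 sQ)).
have ss j : has_some_grad (fun q : V => shape_coef (l q) (Sr q) (Si q) i j) p0.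
  rewrite /shape_coef; case: (i == 0); case: (j == 0).
  - exact (has_some_gradD (has_some_gradX2 sl) Sr_grad).
  - exact (has_some_gradN Si_grad).
  - exact (has_some_gradN Si_grad).
  - exact (has_some_gradD (has_some_gradX2 sl) (has_some_gradN Sr_grad)).
exact (has_some_gradM (has_some_gradD (has_some_gradM (ss 0) (su 0))
  (has_some_gradM (ss 1) (su 1))) (has_some_gradV ln0 sl)).
Qed.

(** The tangent fields are orthogonal to the normal m at all nearby points, so
    that the derivative of a tangent field pairs with m like minus the tangent
    field with the derivative of m. *)
Lemma epstein_second_derivative : exists s : 'I_2 -> 'I_2 -> 'I_3 -> R,
  (forall i j, derivable (tangent_field Y i) p0 (evec j) /\
     'D_(evec j) (tangent_field Y i) p0 = frame3 E (s i j)) /\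
  (forall i j, dot3 (s i j) (m p0) = - dot3 (t p0 i) (dm p0 j)).
Proof.
pose s i j k := 'D_(evec j) (fun q => t q i k) p0.
have sg i k : has_grad (fun q => t q i k) p0 (s i 0 k) (s i 1 k).
  have [a [b H]] := tangent_some_grad i k.
  have [_ Da _ Db] := has_grad_derive H.
  by apply: has_grad_eq H _ _; rewrite /s.
have [_ lg Ag Bg] := sys0.
have mg k : has_grad (fun q => m q k) p0 (dm p0 0 k) (dm p0 1 k).
  exact: (normal_coord_grad l0 lg Ag Bg).
exists s; split=> i j.
  have [d1 d2] := derive_frame3 E j (sg i).
  have near_t : \forall q \near p0, frame3 E (t q i) = tangent_field Y i q.
    by apply: filterS epstein_tangent => q /(_ i)[_ ->].
  split; first exact: (near_eq_derivable near_t d1).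
  by rewrite -d2; apply/esym; exact: near_eq_derive.
have H := has_gradD (has_gradD (has_gradM (sg i 0) (mg 0)) (has_gradM (sg i 1) (mg 1)))
  (has_gradM (sg i 2) (mg 2)).
have Z : \forall q \near p0, cst 0 q = t q i 0 * m q 0 + t q i 1 * m q 1 + t q i 2 * m q 2.
  apply: filterS sys => q [lq _ _ _].
  by have := tangent_normal_dot (q 0 0) (q 0 1) (A q) (B q) (Sr q) (Si q) lq i.
have {}H := near_has_diff Z H.
have [_ e0 _ e1] := has_grad_derive H.
have [_ c0 _ c1] := has_grad_derive (has_grad_cst (0 : R) p0).
rewrite c0 in e0; rewrite c1 in e1.
rewrite /dot3; case: (ord2_case j) => ->.
  by rewrite -[LHS]subr0 [X in _ - X]e0; ring.
by rewrite -[LHS]subr0 [X in _ - X]e1; ring.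
Qed.

Let Yn : 1 - dot (Y p0) (Y p0) = 4 * l p0 / Q p0.
Proof. by rewrite Y0 dot_frame3//; exact: epstein_coord_norm. Qed.

Let tangent0 i : tangent_field Y i p0 = frame3 E (t p0 i).
Proof. by have /nbhs_singleton/(_ i)[] := epstein_tangent. Qed.

Let shape i j := shape_coef (l p0) (Sr p0) (Si p0) i j.

Lemma first_form_epstein i j : first_form hyp_metric Y p0 i j =
  (shape i 0 * shape j 0 + shape i 1 * shape j 1) / l p0 ^+ 2.
Proof.
rewrite mxE metric_dot_hyp Yn !tangent0 dot_frame3// (tangent_dot _ _ _ _ _ _ l0).
by rewrite -/(Q p0) -!/(shape _ _); field; rewrite ln0 Q0.
Qed.

Variable N : 'rV[R]_3.
Hypothesis NE : N = (2 * l p0 / Q p0) *: frame3 E (m p0).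

Lemma dot_covariant_derivative (w u v y n : 'rV[R]_3) (k a b g r : R) :
  dot (w + k *: (a *: v + b *: u - g *: y)) (r *: n) =
  r * (dot w n + k * (a * dot v n + b * dot u n - g * dot y n)).
Proof. by rewrite !dotE3 !mxE; ring. Qed.

(** With g = mu (1 + sig)^2 this is g - mu (1 + sig) = mu (1 + sig) sig. *)
Lemma second_form_epstein i j : second_form hyp_metric Y N p0 i j =
  (shape i 0 * shape j 0 + shape i 1 * shape j 1) / l p0 ^+ 2 - shape i j.
Proof.
have n0 : 1 - dot (Y p0) (Y p0) != 0.
  by rewrite Yn mulf_neq0 ?invr_neq0// mulf_neq0.
have [s [sD sm]] := epstein_second_derivative.
rewrite mxE metric_dot_hyp /cov_deriv_tangent christoffel_hyp_sum// (proj2 (sD i j)).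
rewrite Yn NE dot_covariant_derivative.
rewrite !tangent0 Y0 !dot_frame3// sm.
rewrite !(tangent_normal_dot _ _ _ _ _ _ l0) !mulr0 addr0 add0r.
rewrite (tangent_normal_dcoord _ _ _ _ _ _ l0) (tangent_dot _ _ _ _ _ _ l0).
have := epstein_coord_normal (p0 0 0) (p0 0 1) (A p0) (B p0) l0.
rewrite -/(c p0) -/(m p0) -/(Q p0) -/(shape i j) => YM.
have {}YM : dot3 (c p0) (m p0) = 2 * l p0 / Q p0 *
    (l p0 * cone_time (p0 0 0) (p0 0 1) + 1) - 1.
  have e : dot3 (c p0) (m p0) = 2 * l p0 / Q p0 * (dot3 (c p0) (m p0) * (Q p0 / (2 * l p0))).
    by field; rewrite ln0 Q0.
  by rewrite e YM; field; rewrite ln0 Q0.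
rewrite YM.
move: (Q p0) Q0 => q q0; rewrite -!/(shape _ _).
by field; rewrite ln0 q0.
Qed.

End EpsteinForms.

(** * Principal curvatures *)

Section PrincipalCurvatures.
Context {R : realType}.

Lemma det2 (M : 'M[R]_2) : \det M = M 0 0 * M 1 1 - M 0 1 * M 1 0.
Proof.
rewrite (expand_det_row _ 0) !big_ord_recl big_ord0 addr0 /cofactor !det_mx11 !mxE.
rewrite /= !expr0 expr1 !mul1r mulN1r mulrN.
by congr (_ * M _ _ - M _ _ * M _ _); exact: val_inj.
Qed.

Lemma eigenvalue_invmx_mul (G P : 'M[R]_2) k : G \in unitmx ->
  eigenvalue (invmx G *m P) k <-> \det (P - k *: G) = 0.
Proof.
move=> Gu; have -> : P - k *: G = G *m (invmx G *m P - k%:M).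
  by rewrite mulmxBr mulKVmx// mul_mx_scalar.
rewrite det_mulmx.
have dG : \det G != 0 by move: Gu; rewrite unitmxE unitfE.
rewrite /eigenvalue /eigenspace kermx_eq0 row_free_unit unitmxE unitfE negbK.
split=> [/eqP ->|/eqP]; first by rewrite mulr0.
by rewrite mulf_eq0 (negPf dG).
Qed.

Variables (l Sr Si : R).
Hypothesis l0 : 0 < l.
Let shape := shape_coef l Sr Si.

(** det (P - k G) factors as det(B) det((1 - k) B / mu - 1) with
    B = mu (1 + sig), and sig has trace 0 and determinant - s^2. *)
Lemma shape_eigenvalues (G P : 'M[R]_2) s :
  (forall i j, G i j = (shape i 0 * shape j 0 + shape i 1 * shape j 1) / l ^+ 2) ->
  (forall i j, P i j =
     (shape i 0 * shape j 0 + shape i 1 * shape j 1) / l ^+ 2 - shape i j) ->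
  0 <= s -> s != 1 -> (s * l ^+ 2) ^+ 2 = Sr ^+ 2 + Si ^+ 2 ->
  G \in unitmx /\
  forall k, eigenvalue (invmx G *m P) k <-> k = s / (s + 1) \/ k = s / (s - 1).
Proof.
move=> GE PE s0 s1 sS.
have ln0 : l != 0 by rewrite gt_eqF.
have sp : s + 1 != 0 by rewrite gt_eqF// ltr_wpDl.
have sm : s - 1 != 0 by rewrite subr_eq0.
have Si2 : Si ^+ 2 = (s * l ^+ 2) ^+ 2 - Sr ^+ 2 by rewrite sS; ring.
have dG : \det G = l ^+ 4 * ((s + 1) * (s - 1)) ^+ 2.
  rewrite det2 !GE /shape /shape_coef /=.
  have -> : l ^+ 4 * ((s + 1) * (s - 1)) ^+ 2 =
    ((s * l ^+ 2) ^+ 2 - l ^+ 4) ^+ 2 / l ^+ 4 by field.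
  by rewrite sS; field.
have Gu : G \in unitmx by rewrite unitmxE unitfE dG !mulf_neq0 ?expf_neq0// mulf_neq0.
split=> // k; rewrite eigenvalue_invmx_mul//.
have -> : \det (P - k *: G) =
    l ^+ 4 * ((s + 1) * (s - 1)) * (k * (s + 1) - s) * (k * (s - 1) - s).
  rewrite det2 !mxE !PE !GE /shape /shape_coef /=.
  have -> : l ^+ 4 * ((s + 1) * (s - 1)) * (k * (s + 1) - s) * (k * (s - 1) - s) =
    ((s * l ^+ 2) ^+ 2 - l ^+ 4) *
      ((1 - k) ^+ 2 * (s * l ^+ 2) ^+ 2 - k ^+ 2 * l ^+ 4) / l ^+ 4 by field.
  by rewrite sS; field.
split=> [/eqP|[|] ->].
- have c0 : l ^+ 4 * ((s + 1) * (s - 1)) != 0 by rewrite mulf_neq0 ?expf_neq0// mulf_neq0.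
  rewrite mulf_eq0 mulf_eq0 (negPf c0) orFb.
  by move=> /orP[]; rewrite subr_eq0 => /eqP e; [left|right]; rewrite -[X in X / _]e mulfK.
- by rewrite divfK// subrr mulr0 mul0r.
- by rewrite divfK// subrr mulr0.
Qed.

End PrincipalCurvatures.

Section HoroNormal.
Context {R : realType}.
Local Notation C := (Num.NumField.sort (complex_complex__canonical__Num_NumField R)).
Variables (E : 'M[R]_3) (f : 'rV[R]_3 -> R[i]) (p : 'rV[R]_2).
Hypothesis EE : E *m E^T = 1%:M.
Let F : C -> C := in_stereo E f.
Let z : C := of_coords p.
Let th := stereo_inv E z.
Let x := p 0 0.
Let y := p 0 1.
Hypothesis Fz : regular_at F z.
Let l := density F z.
Let A := log_density_x F z.
Let B := log_density_y F z.

(** The Euclidean sphere H(th, rho) has radius 1 / (1 + e^rho), which is the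
    length of the vector from the envelope to its centre. *)
Lemma horo_normal_rho :
  horo_normal th (rho_at E f th) (horo_map (rho_at E f) th) =
  (2 * l / epstein_den x y l A B) *: frame3 E (normal_coord x y l A B).
Proof.
have l0 : 0 < l := density_gt0 Fz.
have Q0 := lt0r_neq0 (epstein_den_gt0 x y A B l0).
rewrite horo_map_rho// -/z -/F -/x -/y -/l -/A -/B.
rewrite -[in_frame E _ _ _]/(frame3 E (epstein_coord x y l A B)).
rewrite /horo_normal /horo_centre expR_rho// -/z -/F -/l.
have w0 : 0 < l / gamma z by rewrite divr_gt0// gamma_gt0.
have tE : th = in_frame E (gamma z * x) (gamma z * y) (1 - gamma z) := stereo_invE E z.
have g0 := lt0r_neq0 (gamma_gt0 z).
have gE : (gamma z)^-1 = cone_time x y by rewrite gammaE invf_div.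
have w1 : 1 + l * cone_time x y != 0 by rewrite -gE gt_eqF// addr_gt0.
have vE : (2^-1 * (1 + (l / gamma z - 1) / (l / gamma z + 1))) *: th -
    frame3 E (epstein_coord x y l A B) =
    (1 + l * cone_time x y)^-1 *: frame3 E (normal_coord x y l A B).
  rewrite tE /frame3 -[X in _ + X]scaleN1r !in_frameZ in_frameD -gE.
  have w1' : 1 + l / gamma z != 0 by rewrite gE.
  have w2 : l + gamma z != 0 by rewrite gt_eqF// addr_gt0// gamma_gt0.
  have n2 : (x ^+ 2 + y ^+ 2 - 1) / 2 = (gamma z)^-1 - 1 by rewrite gE /cone_time; field.
  rewrite /normal_coord /cone_space /= -gE n2.
  move: (gamma z) g0 w0 w1' w2 => g g0 w0 w1' w2.
  move: (epstein_coord _ _ _ _ _ _) (epstein_coord _ _ _ _ _ _) (epstein_coord _ _ _ _ _ _).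
  move=> Y0 Y1 Y2; have w3 : g + l != 0 by rewrite addrC.
  by congr in_frame; field; rewrite ?w2 ?w3 ?g0.
rewrite vE.
(* The radius of the horosphere, as the Euclidean length of that vector. *)
have nE : enorm ((1 + l * cone_time x y)^-1 *: frame3 E (normal_coord x y l A B)) =
    (1 + l * cone_time x y)^-1.
  rewrite /enorm dotZl dotZr dot_frame3// normal_coord_norm// mulr1 -expr2 sqrtr_sqr.
  by rewrite ger0_norm// invr_ge0 -gE addr_ge0// ltW.
rewrite nE dot_frame3// epstein_coord_norm// scalerA; congr (_ *: _).
move: (epstein_den _ _ _ _ _) Q0 => q Q0.
by field; rewrite Q0.
Qed.

End HoroNormal.

(** * The envelope of the hyperbolic density *)

Section Main.
Context {R : realType}.
Local Notation C := (Num.NumField.sort (complex_complex__canonical__Num_NumField R)).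
Local Notation V := 'rV[R]_2.

Lemma near_coords (P : C -> Prop) (z0 : C) :
  (\forall z \near z0, P z) <-> (\forall p \near (coords z0 : V), P (of_coords p)).
Proof.
split=> [/near_complexP[r r0 H]|/nbhs_normP[r /= r0 H]].
  apply/nbhs_normP; exists (r / 2); first by rewrite /= divr_gt0.
  move=> p /= pr; apply: H; have := ler_cabs_coords (p - coords z0).
  have -> : of_coords (p - coords z0) = of_coords p - z0.
    rewrite -[in RHS](of_coordsK z0) -scaleN1r of_coordsD; congr (_ + _).
    by rewrite /of_coords !mxE !mulN1r.
  by rewrite distrC in pr; lra.
apply/near_complexP; exists (r / 2); first by rewrite divr_gt0.
move=> z zr; rewrite -(of_coordsK z); apply: H => /=.
have bd i : `|(coords z0 - coords z) 0 i| <= cabs (z - z0).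
  rewrite !mxE distrC; case: ifP => _; rewrite -?Re_subc -?Im_subc.
    exact: ler_Re_cabs.
  exact: ler_Im_cabs.
rewrite [ltLHS]mx_normrE; apply: (@le_lt_trans _ _ (cabs (z - z0))); last by lra.
apply: bigmax_le; first exact: cabs_ge0.
by move=> [i j] _ /=; rewrite ord1 bd.
Qed.

Lemma near_in_domain (Om : set 'rV[R]_3) (E : 'M[R]_3) th : E *m E^T = 1%:M ->
  sphere_domain Om -> Om th -> th <> pole E ->
  \forall z \near (stereo E th : C), Om (stereo_inv E z).
Proof.
move=> EE [[U oU OmE] _ _] Omth thp.
have [Uth th1] : U th /\ dot th th = 1 by move: Omth; rewrite OmE => -[].
apply/near_coords.
pose c (p : V) : 'rV[R]_3 := stereo_inv E (of_coords p).
have cc p : {for p, continuous c}.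
  apply: differentiable_continuous.
  have -> : c = (fun q : V => frame3 E (fun k =>
      if k == 0 then gamma (of_coords q) * q 0 0 else
      if k == 1 then gamma (of_coords q) * q 0 1 else cst 1 q + - gamma (of_coords q))).
    by apply/funext => q; rewrite /c stereo_invE.
  have dg : has_some_grad (fun q : V => gamma (of_coords q)) p.
    have -> : (fun q : V => gamma (of_coords q)) =
        (fun q => 2 * (1 + (q 0 0 ^+ 2 + q 0 1 ^+ 2))^-1).
      by apply/funext => q; rewrite gammaE.
    have s0 : has_some_grad (fun q : V => q 0 0) p by do 2 eexists; exact: has_grad_coord0.
    have s1 : has_some_grad (fun q : V => q 0 1) p by do 2 eexists; exact: has_grad_coord1.
    apply: (has_some_gradM (has_some_grad_cst 2 p)).
    apply: (has_some_gradV (h := fun q : V => 1 + (q 0 0 ^+ 2 + q 0 1 ^+ 2))).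
      exact: (lt0r_neq0 (sqnorm1_gt0 (of_coords p))).
    exact: (has_some_gradD (has_some_grad_cst 1 p)
      (has_some_gradD (has_some_gradX2 s0) (has_some_gradX2 s1))).
  have [g1 [g2 dgg]] := dg.
  apply: differentiable_frame3 => k; case: (k == 0).
    exact: (proj1 (has_gradM dgg (has_grad_coord0 p))).
  case: (k == 1); first exact: (proj1 (has_gradM dgg (has_grad_coord1 p))).
  exact: (proj1 (has_gradD (has_grad_cst 1 p) (has_gradN dgg))).
have cth : c (coords (stereo E th)) = th by rewrite /c of_coordsK stereo_invK.
have nU : nbhs (c (coords (stereo E th))) U by rewrite cth; exact: open_nbhs_nbhs.
have nUc : \forall p \near (coords (stereo E th) : V), U (c p) := cc _ _ nU.
apply: filterS nUc => p Up; rewrite OmE; split=> //.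
exact: dot_stereo_inv.
Qed.

Lemma near_regular_parameter (Om : set 'rV[R]_3) f (E : 'M[R]_3) th :
  oriented_frame E -> sphere_domain Om -> conformal_bijection_disk Om f ->
  Om th -> th <> pole E -> \forall z \near (stereo E th : C), regular_at (in_stereo E f : C -> C) z.
Proof.
move=> Ef OmD [fc [fd _ _]] Omth thp; have [EE _] := Ef.
apply: near_regular; apply: filterS (near_in_domain EE OmD Omth thp) => z Omz.
have [d n0] := fc E (stereo_inv E z) Ef Omz (stereo_inv_neq_pole (E := E) EE (z := z)).
rewrite stereoK// in d n0.
have lt1 : cabs (in_stereo E f z) < 1 by exact: (fd _ Omz).
split; [exact: d|exact/eqP|exact: lt1].
Qed.

End Main.

Unset Implicit Arguments.

Theorem proposition7p4 (R : realType) (Om : set 'rV[R]_3)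
    (f : 'rV[R]_3 -> R[i])
    (Om_domain : sphere_domain Om)
    (Om_sc : simply_connected Om)
    (Om_bd : exists a b c : 'rV[R]_3,
       [/\ sphere_boundary Om a, sphere_boundary Om b & sphere_boundary Om c]
       /\ [/\ a <> b, a <> c & b <> c])
    (f_conf : conformal_bijection_disk Om f)
    (E : 'M[R]_3) (E_frame : oriented_frame E)
    (th : 'rV[R]_3) (Om_th : Om th) (th_pole : th <> pole E) :
  let S := schwarzian_at E f th in
  let mu := mu_at E f th in
  let s := cabs S / mu in
  let kp := s / (s + 1) in
  let km := s / (s - 1) in
  cabs S <> mu ->
  [/\ horo_curvatures E (rho_at E f) th kp km,
      kp * km - 1 = - ((1 - kp) * (1 - km))
    & S <> 0 -> kp = 1 / (1 + cabs (mu%:C / S)) /\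
                km = 1 / (1 - cabs (mu%:C / S))].
Proof.
move=> S mu s kp km Smu.
have [EE _] := E_frame.
have regular := near_regular_parameter E_frame Om_domain f_conf Om_th th_pole.
have th1 : dot th th = 1.
  by case: Om_domain => -[U _ OmE] _ _; move: Om_th; rewrite OmE => -[].
have thE : stereo_inv E (stereo E th) = th by exact: stereo_invK.
have Fz := nbhs_singleton regular.
have muE : mu = density (in_stereo E f) (stereo E th) ^+ 2.
  rewrite /mu /mu_at /density expr_div_n exprMn /in_stereo thE.
  by congr (_ * _ / _); ring.
have l0 := density_gt0 Fz.
have mu0 : 0 < mu by rewrite muE exprn_gt0.
have s0 : 0 <= s by rewrite divr_ge0 ?cabs_ge0// ltW.
have s1 : s != 1.
  by apply/eqP => e; apply: Smu; rewrite -[LHS](divfK (lt0r_neq0 mu0)) -/s e mul1r.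
have sp : s + 1 != 0 by rewrite gt_eqF// ltr_wpDl.
have sm : s - 1 != 0 by rewrite subr_eq0.
split; last 2 first.
- by rewrite /kp /km; field; rewrite sp sm.
- move=> /eqP S0; have cS : cabs S != 0 by rewrite cabs_eq0.
  have -> : cabs (mu%:C / S) = mu / cabs S by rewrite cabsM cabsV cabs_real gtr0_norm.
  have mun := lt0r_neq0 mu0.
  have e1 : cabs S + mu != 0 by rewrite gt_eqF// ltr_wpDl// cabs_ge0.
  have e2 : cabs S - mu != 0 by rewrite subr_eq0; apply/eqP.
  by rewrite /kp /km /s; split; field; rewrite ?cS ?mun ?e1 ?e2.
pose p0 := coords (stereo E th).
pose F := in_stereo E f : Num.NumField.sort (complex_complex__canonical__Num_NumField R) ->
  Num.NumField.sort (complex_complex__canonical__Num_NumField R).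
have p0z : of_coords p0 = stereo E th := of_coordsK _.
pose l (p : 'rV[R]_2) := density F (of_coords p).
pose A (p : 'rV[R]_2) := log_density_x F (of_coords p).
pose B (p : 'rV[R]_2) := log_density_y F (of_coords p).
pose Sr (p : 'rV[R]_2) := complex.Re (schwarzian F (of_coords p)).
pose Si (p : 'rV[R]_2) := complex.Im (schwarzian F (of_coords p)).
have reg : \forall p \near p0, regular_at F (of_coords p) := proj1 (near_coords _ _) regular.
have reg0 := nbhs_singleton reg.
have sys : \forall p \near p0, liouville_at l A B Sr Si p.
  apply: filterS reg => p Fp; split.
  - exact: density_gt0 Fp.
  - exact: density_grad Fp erefl.
  - exact: log_density_x_grad Fp erefl.
  - exact: log_density_y_grad Fp erefl.
have [[a1 [b1 Srg]] [a2 [b2 Sig]]] := schwarzian_grads reg0 erefl.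
have Sr_grad : has_some_grad Sr p0 by do 2 eexists; exact: Srg.
have Si_grad : has_some_grad Si p0 by do 2 eexists; exact: Sig.
have Yc : \forall p \near p0, horo_surface E (rho_at E f) p =
    frame3 E (epstein_coord (p 0 0) (p 0 1) (l p) (A p) (B p)).
  by apply: filterS reg => p Fp; exact: horo_map_rho.
have NE := horo_normal_rho EE reg0.
rewrite p0z thE in NE.
have lE : density F (stereo E th) = l p0 by rewrite /l p0z.
have AE : log_density_x F (stereo E th) = A p0 by rewrite /A p0z.
have BE : log_density_y F (stereo E th) = B p0 by rewrite /B p0z.
rewrite -/F lE AE BE in NE.
have l0' : 0 < l p0 by rewrite -lE.
have sS : (s * l p0 ^+ 2) ^+ 2 = Sr p0 ^+ 2 + Si p0 ^+ 2.
  rewrite -lE -muE /s divfK ?lt0r_neq0// cabs_sqr.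
  by rewrite /Sr /Si p0z.
have [Gu eig] := shape_eigenvalues l0' (first_form_epstein EE sys Yc)
  (second_form_epstein EE sys Sr_grad Si_grad Yc NE) s0 s1 sS.
split=> //; split=> //.
- by apply: filterS (epstein_tangent sys Yc) => p H i; have [] := H i.
- have [sd [sD _]] := epstein_second_derivative sys Sr_grad Si_grad Yc.
  by move=> i j; have [] := sD i j.
Qed.
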